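(* Fix $I\in\mathbb{N}$. For each $N\in\mathbb{N}$, consider the box-ball system initiated from a random configuration $\eta$ with distribution $\mathbf{P}_N$ supported on $\Omega_I$. Suppose that there exists $\rho^0=(\rho^0_i)_{i=1}^I\in \mathcal{D}_{\mathrm{density}}$ such that, for every $\varepsilon>0$ and $(F_i)_{i=1}^I \in C_0(\mathbb{R}_+,\mathbb{R})^I$, \[\lim_{N\rightarrow\infty} \mathbf{P}_N\left(\sup_{i\in\{1,\dots,I\}} \left| \int_{\mathbb{R}_+} F_i(u) \pi_i^{N,0}(du) - \int_{\mathbb{R}_+} F_i(u) \rho^0_i(u)\,du \right| > \varepsilon\right) =0.\] Then for every $\varepsilon>0$, $t\in(0,\infty)$ and $(F_i)_{i=1}^I \in C_0(\mathbb{R}_+,\mathbb{R})^I$, \[\lim_{N\rightarrow\infty} \mathbf{P}_N\left(\sup_{i\in\{1,\dots,I\}} \left| \int_{\mathbb{R}_+} F_i(u)\pi_i^{N,t} (du)- \int_{\mathbb{R}_+} F_i (u)\rho_i(u,t)\,du \right| > \varepsilon\right) =0,\] where $(\rho_i(u,t))_{u,t\in\mathbb{R}_+,i=1,\dots,I}$ is the unique classical solution of \[\partial_t \rho_i =- \partial_u \left( v_i^{\mathrm{eff}}(\rho) \rho_i\right),\qquad \rho_i(\cdot,0)=\rho^0_i(\cdot),\qquad i=1,\dots,I,\] amongst the class of functions $\rho\in C^1(\mathbb{R}_+^2,\mathbb{R}_+)^I$ satisfying $\rho(\cdot,t)\in\mathcal{D}_{\mathrm{density}}$ for all $t\ge 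0$.
   Context: Box-ball system (BBS): a configuration is $\eta=(\eta(x))_{x\in\mathbb{N}}\in\{0,1\}^{\mathbb{N}}$ ($\mathbb{N}=\{1,2,\dots\}$, $\mathbb{Z}_+=\{0,1,\dots\}$). Define the carrier $W(0)=0$ and for $x\ge1$: $W(x)=W(x-1)+1$ if $\eta(x)=1$; $W(x)=W(x-1)$ if $\eta(x)=0$ and $W(x-1)=0$; $W(x)=W(x-1)-1$ if $\eta(x)=0$ and $W(x-1)>0$. One step of the dynamics is $T\eta(x)=\min\{1-\eta(x),W(x-1)\}$, and $T^k$ is its $k$-fold iterate. Let $\Omega=\{\eta:\limsup_{x\to\infty}\sum_{x'=1}^x(1-2\eta(x'))=\infty\}$ (one has $T(\Omega)\subseteq\Omega$). Soliton decomposition of $\eta\in\Omega$: let $S(0)=0$, $S(x)-S(x-1)=1-2\eta(x)$, $M(x)=\max_{x'\le x}S(x')$; $x\in\mathbb{Z}_+$ is a record if $x=0$ or $M(x)>M(x-1)$. Between consecutive records $x_0<x_1$, consider the finite sequence of sites $x_0+1,\dots,x_1-1$ (with their values of $\eta$). While the remaining sequence is non-empty: let $i$ be the length of the left-most maximal run of equal values in the remaining sequence that is followed by a run of length at least $i$; the sites of this run together with the first $i$ sites of the following run form a soliton of size $i$; remove these $2i$ sites and repeat. Every non-record site belongs to exactly one soliton. Set $\sigma_i(x,k)=1$ if $T^k\eta$ has a size-$i$ soliton whose left-most site is $x$, and $\sigma_i(x,k)=0$ otherwise. $\Omega_I=\{\eta\in\Omega:\sigma_i(x,0)=0\ \forall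 i>I, x\in\mathbb{N}\}$. For $N\in\mathbb{N}$, $u,t\ge0$: $\pi_i^{N,t}=\frac1N\sum_{x\in\mathbb{N}}\sigma_i(x,\lfloor Nt\rfloor)\delta_{x/N}$. Effective speeds: for $\rho\in\mathbb{R}_+^I$ with $\sum_{i}2i\rho_i<1$, let $M(\rho)$ be the $I\times I$ matrix with $M_{ii}(\rho)=1-\sum_{j\ne i}2(i\wedge j)\rho_j$ and $M_{ij}(\rho)=2(i\wedge j)\rho_j$ ($i\neq j$); it is invertible, and $v^{\mathrm{eff}}(\rho):=M(\rho)^{-1}v$ with $v=(1,2,\dots,I)^T$. $\mathcal{C}^1(\mathbb{R}_+,\mathbb{R}_+)$ is the set of $f:\mathbb{R}_+\to\mathbb{R}_+$ whose extension by $0$ on $(-\infty,0)$ is $C^1$ on $\mathbb{R}$. $\mathcal{D}_{\mathrm{density}}$ is the set of $(\rho_i)_{i=1}^I\in\mathcal{C}^1(\mathbb{R}_+,\mathbb{R}_+)^I$ with $\sum_{i=1}^I2i\rho_i(u)<1$ for all $u\ge0$ and $\sum_{i=1}^I i\sup_u\frac{\rho_i(u)}{1-\sum_{j=1}^I2(i\wedge j)\rho_j(u)}<\frac12$. $C_0(\mathbb{R}_+,\mathbb{R})$ denotes continuous compactly supported functions on $\mathbb{R}_+$. *)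

(* Defs.v *)
From HB Require Import structures.
From mathcomp Require Import all_boot all_order all_algebra.
From mathcomp Require Import all_classical all_reals all_analysis.
Set Implicit Arguments. Unset Strict Implicit. Unset Printing Implicit Defensive.
Import Order.TTheory GRing.Theory Num.Theory.
Import numFieldNormedType.Exports.
Local Open Scope classical_set_scope.
Local Open Scope ring_scope.

(* Configurations: eta : nat -> bool, sites x = 1, 2, ...; eta 0 is ignored. *)
Definition config := nat -> bool.

(* Carrier W; truncated subtraction realises "W-1 if W>0, else 0 (=W)". *)
Fixpoint carrier (eta : config) (x : nat) : nat :=
  match x with
  | 0 => 0
  | y.+1 => if eta y.+1 then (carrier eta y).+1 else (carrier eta y - 1)%N
  end.

(* One BBS step: T eta x = min(1 - eta x, W(x-1)) for x >= 1. *)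
Definition bbs_step (eta : config) : config :=
  fun x => match x with
           | 0 => false
           | y.+1 => ~~ eta y.+1 && (0 < carrier eta y)%N
           end.

Fixpoint Spath (eta : config) (x : nat) : int :=
  match x with
  | 0 => 0
  | y.+1 => Spath eta y + (if eta y.+1 then (-1)%R else 1%R)
  end.

Definition in_Omega (eta : config) : Prop :=
  forall (M : int) (x0 : nat), exists x, (x0 <= x)%N /\ M < Spath eta x.

Definition is_record (eta : config) (x : nat) : Prop :=
  x = 0%N \/ (forall y, (y < x)%N -> Spath eta y < Spath eta x).

Definition segment (eta : config) (x0 x1 : nat) : seq (nat * bool) :=
  [seq (y, eta y) | y <- iota x0.+1 (x1 - x0.+1)].

Fixpoint runs (s : seq (nat * bool)) : seq (seq (nat * bool)) :=
  match s with
  | [::] => [::]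
  | p :: s' =>
      match runs s' with
      | [::] => [:: [:: p]]
      | r :: rs => if (head p r).2 == p.2 then (p :: r) :: rs
                   else [:: p] :: r :: rs
      end
  end.

Fixpoint find_soliton (rs : seq (seq (nat * bool)))
  : option (nat * nat * seq (seq (nat * bool))) :=
  match rs with
  | r1 :: tl =>
      match tl with
      | r2 :: rest =>
          if (size r1 <= size r2)%N
          then Some (size r1, (head (0%N, false) r1).1, drop (size r1) r2 :: rest)
          else match find_soliton tl with
               | Some (i, x, rs') => Some (i, x, r1 :: rs')
               | None => None
               end
      | [::] => None
      end
  | [::] => None
  end.

(* Iterate the removal procedure (each step removes >= 2 sites, so
   fuel = size suffices). Output: list of (size, left-most site). *)
Fixpoint solitons_fuel (n : nat) (s : seq (nat * bool)) : seq (nat * nat) :=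
  match n with
  | 0 => [::]
  | n'.+1 =>
      match find_soliton (runs s) with
      | Some (i, x, rs') => (i, x) :: solitons_fuel n' (flatten rs')
      | None => [::]
      end
  end.

Definition solitons (s : seq (nat * bool)) : seq (nat * nat) :=
  solitons_fuel (size s) s.

Definition has_soliton (eta : config) (i x : nat) : Prop :=
  exists x0 x1, is_record eta x0 /\ is_record eta x1 /\ (x0 < x1)%N /\
    (forall y, (x0 < y < x1)%N -> ~ is_record eta y) /\
    (i, x) \in solitons (segment eta x0 x1).

Definition sigma (eta : config) (i x k : nat) : Prop :=
  has_soliton (iter k bbs_step eta) i x.

Definition in_Omega_I (I : nat) (eta : config) : Prop :=
  in_Omega eta /\ forall i x, (I < i)%N -> ~ has_soliton eta i x.

Section Analysis.
Variable R : realType.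

(* int F d pi_i^{N,k}  =  (1/N) sum_{x >= 1} sigma_i(x,k) F(x/N) *)
Definition pi_pair (N k i : nat) (F : R -> R) (eta : config) : R :=
  limn (fun n => \sum_(1 <= x < n)
          (N%:R^-1 * (if `[< sigma eta i x k >] then F (x%:R / N%:R) else 0))).

Definition leb_int_Rplus (f : R -> R) : R :=
  Rintegral (@lebesgue_measure R) [set u : R | 0 <= u] f.

Definition C0_Rplus (F : R -> R) : Prop :=
  {within [set u : R | 0 <= u], continuous F} /\
  exists K : R, forall u, K < u -> F u = 0.

Definition Mmat (I : nat) (r : 'I_I -> R) : 'M[R]_I :=
  \matrix_(i, j) (if i == j
                  then 1 - \sum_(j' < I | j' != i) 2 * (minn i.+1 j'.+1)%:R * r j'
                  else 2 * (minn i.+1 j.+1)%:R * r j).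

Definition vvec (I : nat) : 'cV[R]_I := \col_(i < I) (i.+1)%:R.

Definition veff (I : nat) (r : 'I_I -> R) (i : 'I_I) : R :=
  (invmx (Mmat r) *m vvec I) i ord0.

Definition C1_Rplus (f : R -> R) : Prop :=
  (forall u, 0 <= u -> 0 <= f u) /\
  let g := fun u : R => if u < 0 then 0 else f u in
  (forall u, derivable g u 1) /\ continuous (derive1 g).

Definition D_density (I : nat) (rho : 'I_I -> R -> R) : Prop :=
  (forall i, C1_Rplus (rho i)) /\
  (forall u, 0 <= u -> \sum_(i < I) 2 * (i.+1)%:R * rho i u < 1) /\
  (\sum_(i < I) ((i.+1)%:R)%:E *
      ereal_sup [set ((rho i u / (1 - \sum_(j < I) 2 * (minn i.+1 j.+1)%:R * rho j u))%R)%:E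
                | u in [set u : R | (0 <= u)%R]] < (2^-1)%:E)%E.

Definition has_du (f : R -> R -> R) (u t l : R) : Prop :=
  (fun h => h^-1 * (f (u + h) t - f u t))
    @ within [set h : R | h != 0 /\ 0 <= u + h] (nbhs (0 : R)) --> l.

Definition has_dt (f : R -> R -> R) (u t l : R) : Prop :=
  (fun h => h^-1 * (f u (t + h) - f u t))
    @ within [set h : R | h != 0 /\ 0 <= t + h] (nbhs (0 : R)) --> l.

Definition quadrant : set (R * R) := [set p | 0 <= p.1 /\ 0 <= p.2].

Definition C1_quad (f : R -> R -> R) : Prop :=
  (forall u t, 0 <= u -> 0 <= t -> 0 <= f u t) /\
  {within quadrant, continuous (fun p => f p.1 p.2)} /\
  exists du dt : R -> R -> R,
    (forall u t, 0 <= u -> 0 <= t -> has_du f u t (du u t) /\ has_dt f u t (dt u t)) /\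
    {within quadrant, continuous (fun p => du p.1 p.2)} /\
    {within quadrant, continuous (fun p => dt p.1 p.2)}.

Definition classical_solution (I : nat) (rho0 : 'I_I -> R -> R)
    (rho : 'I_I -> R -> R -> R) : Prop :=
  (forall i, C1_quad (rho i)) /\
  (forall t, 0 <= t -> D_density (fun i u => rho i u t)) /\
  (forall i u, 0 <= u -> rho i u 0 = rho0 i u) /\
  (forall i u t, 0 <= u -> 0 <= t -> exists d,
      has_dt (rho i) u t d /\
      has_du (fun u' t' => veff (fun j => rho j u' t') i * rho i u' t') u t (- d)).

End Analysis.

(* Main.v *)
(** Solitons of size [i] live on the "slots" of level [i]: deleting from [eta] every
    letter that differs from its predecessor removes the size-one solitons and lowers
    the size of all others by one, and this deletion intertwines the dynamics with
    itself up to a shift by one site.  In the [i]-th reduced word the solitons of unit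
    size are moved rigidly by [i] slots per time step.  Hence, up to bounded errors, the
    number [n_i(x,k)] of size-[i] solitons of [T^k eta] in [[1,x]] equals [n_i(x',0)] as
    soon as [x - sum_j 2 (i /\ j) n_j(x,k) - i k = x' - sum_j 2 (i /\ j) n_j(x',0)].

    In the scaling limit, with [N_i] the cumulative density of size-[i] solitons and
    [G_i] the initial cumulative density as a function of the slot coordinate, this reads
    [N_i(u,t) = G_i(u - i t - sum_j 2 (i /\ j) N_j(u,t))].  The second condition defining
    [D_density] says that [sum_i 2 i sup G_i' < 1], so this fixed point equation is a
    contraction; it is solved by a smooth [N], its error terms are controlled, and
    differentiating it in [u] and [t] gives the conservation law with velocities
    [veff].  Uniqueness: for a classical solution with cumulative densities [N_i] put
    [H_i = N_i - G_i(u - i t - sum_j 2 (i /\ j) N_j)] and let [a_i] be the density of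
    slots; then [a_i H_i^2] satisfies a conservation law with nonnegative flux and
    zero initial value, so that [H_i = 0]. *)
Require Import Defs.
From HB Require Import structures.
From mathcomp Require Import all_boot all_order all_algebra.
From mathcomp Require Import all_classical all_reals all_analysis.
From mathcomp Require Import ring lra zify.
Set Implicit Arguments. Unset Strict Implicit. Unset Printing Implicit Defensive.
Import Order.TTheory GRing.Theory Num.Theory.
Import numFieldNormedType.Exports.

(** * Carriers and reduced words *)

Section Words.
Local Open Scope nat_scope.

(** The bridge between the removal algorithm of the statement and the reduced words is a carrier of
    finite capacity [l], whose pick-ups are counted twice. Removing a soliton of size [i] costs
    exactly [minn l i] pick-ups; deleting letters peels a carrier of capacity one off a carrier of
    capacity [l.+1]. So the ascent numbers of the reduced words are first differences, and the
    soliton counts second differences, of the same numbers. Errors arise only at the excursion cut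
    by [x]: what the algorithm leaves there is an irreducible word, of length at most [I * I]
    because sizes up to [I] persist in time.

    The analysis rests on one linear system, [solves], contracting in the sup norm: slot densities,
    effective velocities and all derivatives of the fixed point are solutions of it, and stability
    under convergence of its coefficients gives both continuity and differentiability.

    Randomness enters only at the end. For each configuration, finitely many piecewise linear test
    functions at time zero control the pairings at time [t], so a union bound suffices. *)

Fixpoint load (w : nat) (s : seq bool) : nat :=
  if s is b :: s' then load (if b then w.+1 else w.-1) s' else w.

Fixpoint bbs_word (w : nat) (s : seq bool) : seq bool :=
  if s is b :: s' then (~~ b && (0 < w)) :: bbs_word (if b then w.+1 else w.-1) s'
  else [::].

(* Deletes the letters that differ from their predecessor, i.e. those that a
   carrier of capacity one picks up or drops; [p] is the letter before [s]. *)
Fixpoint elim_from (p : bool) (s : seq bool) : seq bool :=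
  if s is b :: s' then if b == p then b :: elim_from b s' else elim_from b s' else [::].

Fixpoint ascents (p : bool) (s : seq bool) : nat :=
  if s is b :: s' then (b && ~~ p) + ascents b s' else 0.

(* A deleted letter completes a size-one soliton when it equals [e], the last letter
   kept so far; otherwise the next deleted letter will. *)
Fixpoint unit_solitons_from (p e : bool) (s : seq bool) : nat :=
  if s is b :: s' then
    if b == p then unit_solitons_from b b s'
    else (b == e) + unit_solitons_from b e s'
  else 0.

Definition elim10 := elim_from false.
Definition unit_solitons := unit_solitons_from false false.

Lemma load_rcons w s b :
  load w (rcons s b) = if b then (load w s).+1 else (load w s).-1.
Proof. by elim: s w => //= a s IH w; rewrite IH. Qed.

Lemma bbs_word_rcons w s b :
  bbs_word w (rcons s b) = rcons (bbs_word w s) (~~ b && (0 < load w s)).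
Proof. by elim: s w => //= a s IH w; rewrite IH. Qed.

Lemma size_bbs_word w s : size (bbs_word w s) = size s.
Proof. by elim: s w => //= a s IH w; rewrite IH. Qed.

Lemma bbs_word_take w s n : bbs_word w (take n s) = take n (bbs_word w s).
Proof. by elim: s w n => [|a s IH] w [|n] //=; rewrite IH. Qed.

Lemma elim_from_rcons p s b :
  elim_from p (rcons s b) =
  if b == last p s then rcons (elim_from p s) b else elim_from p s.
Proof.
elim: s p => [|a s IH] p /=; first by case: (b == p).
by rewrite IH; case: (a == p); case: (b == _).
Qed.

Lemma elim_from_cat p s1 s2 :
  elim_from p (s1 ++ s2) = elim_from p s1 ++ elim_from (last p s1) s2.
Proof. by elim: s1 p => //= a s IH p; rewrite IH; case: (a == p). Qed.

Lemma unit_solitons_from_rcons p e s b :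
  unit_solitons_from p e (rcons s b) =
  unit_solitons_from p e s + ((b != last p s) && (b == last e (elim_from p s))).
Proof.
elim: s p e => [|a s IH] p e /=; first by case: eqP => //= _; rewrite addn0.
by rewrite !IH; case: ifP => //= H; rewrite addnA.
Qed.

(** The carrier splits in two: a carrier of capacity one, whose content is always the last letter
    read, and a second carrier that meets only the letters the first lets through, which are the
    kept ones. *)
Lemma load_elim (p : bool) v s :
  load (v + p) s = load v (elim_from p s) + last p s.
Proof.
elim: s p v => [|b s IH] p v //=.
rewrite -[in RHS]/(last b s).
case: b; case: p => /=; rewrite -?IH ?addn0 ?addn1 //=.
Qed.

Lemma load_elim10 s : load 0 s = load 0 (elim10 s) + last false s.
Proof. exact: (load_elim false 0). Qed.

(* The invariant, in terms of the last letters only, that makes the induction on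
   prefixes go through; the second clause is the commutation of [elim10] with the
   dynamics, the last one the conservation of size-one solitons. *)
Lemma coupling s (t := bbs_word 0 s) (p := last false s) (q := last false t)
  (e := last false (elim10 s)) (e' := last false (elim10 t))
  (v := load 0 (elim10 s)) :
  [/\ ~~ (p && q),
      elim10 t ++ nseq (~~ (p || q)) false = false :: bbs_word 0 (elim10 s),
      (v == 0) ==> ~~ e,
      if p || q then (0 < v) ==> (e != e') else v == 0
    & unit_solitons t + (~~ p && q) = unit_solitons s + (~~ p && q) * (e + e')].
Proof.
subst t p q e e' v; elim/last_ind: s => [|s b] //.
have hw := load_elim10 s; move: hw.
rewrite /elim10 /unit_solitons ?load_rcons !bbs_word_rcons !elim_from_rcons
  !unit_solitons_from_rcons !last_rcons.
set t := bbs_word 0 s; set p := last false s; set q := last false t.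
set e := last false (elim_from false s); set e' := last false (elim_from false t).
set v := load 0 (elim_from false s) => hw.
case=> hpq hE hv hpe hnu.
rewrite hw; clear hw.
(* The last letter of the evolved reduced word can be read off [hE]: it is [e'], or the padding
   [false] when [p] and [q] both vanish. *)
have hlast : last false (bbs_word 0 (elim_from false s)) = (p || q) && e'.
  by move/(congr1 (last false)): hE; rewrite last_cat /=; case: (p || q).
move: hpq hE hv hpe hnu hlast; rewrite /is_true.
(* What remains is a finite check over the last letters and over whether the reduced carrier is
   empty. *)
case: b; case: p => /=; case: q => //=; rewrite ?andbF ?andbT ?addn0 ?addn1 //=;
 rewrite ?last_rcons ?load_rcons ?bbs_word_rcons ?last_rcons -/e -/e' -/v ?cats0 /=.
all: rewrite {}/v; case: (load 0 _) => [|v] /=.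
all: rewrite {}/e {}/e'.
all: move: (elim_from false t) (bbs_word 0 (elim_from false s)) => X Y.
all: case: (last false (elim_from false s)); case: (last false X) => //=.
all: rewrite ?last_rcons ?cats0 ?cats1 ?eqxx //= => _ hE _ _ hn _; split; rewrite ?last_rcons //=.
all: by [lia | rewrite hE | rewrite -hE].
Qed.

(** * Carriers of finite capacity and the size of reduced words *)

Fixpoint cload (l w : nat) (s : seq bool) : nat :=
  if s is b :: s' then cload l (if b then minn l w.+1 else w.-1) s' else w.

(* Number of balls picked up by a carrier of capacity [l]. *)
Fixpoint picks (l w : nat) (s : seq bool) : nat :=
  if s is b :: s' then
    (b && (w < l)) + picks l (if b then minn l w.+1 else w.-1) s'
  else 0.

Lemma cload_cat l w s1 s2 : cload l w (s1 ++ s2) = cload l (cload l w s1) s2.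
Proof. by elim: s1 w => //= a s IH w; rewrite IH. Qed.

Lemma picks_cat l w s1 s2 :
  picks l w (s1 ++ s2) = picks l w s1 + picks l (cload l w s1) s2.
Proof. by elim: s1 w => //= a s IH w; rewrite IH addnA. Qed.

Lemma cload_le l w s : w <= l -> cload l w s <= l.
Proof. by elim: s w => //= b s IH w hw; apply: IH; case: b; lia. Qed.

Lemma picks_le_count l w s : picks l w s <= count id s.
Proof. by elim: s w => //= b s IH w; apply: leq_add => //; case: b => //=; case: (w < l). Qed.

(** The splitting of [load_elim], with capacity [l.+1] divided into one and [l]. *)
Lemma cload_elim (p : bool) l v s : v <= l ->
  cload l.+1 (v + p) s = cload l v (elim_from p s) + last p s.
Proof.
elim: s p v => [|b s IH] p v //= hv.
rewrite -[in RHS]/(last b s).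
case: b; case: p => /=; rewrite -?IH ?addn0 ?addn1 //=; try lia.
all: congr (cload _ _ _); lia.
Qed.

(** In the same splitting the unit carrier picks up once at each ascent; the other pick-ups are
    those of the second carrier on the kept letters. *)
Lemma picks_elim (p : bool) l v s : v <= l ->
  picks l.+1 (v + p) s = ascents p s + picks l v (elim_from p s).
Proof.
elim: s p v => [|b s IH] p v //= hv.
case: b; case: p => /=.
- have -> : minn l.+1 (v + 1).+1 = minn l v.+1 + true by rewrite /=; lia.
  rewrite IH ?geq_minl //; lia.
- have -> : minn l.+1 (v + 0).+1 = v + true by rewrite /=; lia.
  rewrite IH //; lia.
- have -> : (v + 1).-1 = v + false by rewrite /=; lia.
  by rewrite IH.
- have -> : (v + 0).-1 = v.-1 + false by rewrite /=; lia.
  rewrite IH //; lia.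
Qed.

Lemma count_elim p s : count id s = ascents p s + count id (elim_from p s).
Proof.
by elim: s p => //= b s IH p; have := IH b; case: b; case: p => /=; lia.
Qed.

(** Deleted letters are alternately ascents and descents, hence the factor two and the correction by
    the two end letters. *)
Lemma size_elim_from (p : bool) s :
  size (elim_from p s) + 2 * ascents p s + p = size s + last p s.
Proof.
elim: s p => //= b s IH p; have := IH b.
by case: b; case: p => /=; rewrite ?mul2n ?doubleS; lia.
Qed.

(** Up to the end letters, size-one solitons are the ascents lost by the deletion. This turns their
    number into a second difference of [picks]. *)
Lemma unit_solitons_ascents p e s :
  unit_solitons_from p e s + ascents e (elim_from p s)
  + (last p s && ~~ last e (elim_from p s)) = ascents p s + (p && ~~ e).
Proof.
elim: s p e => //= b s IH p e.
have := IH b b; have := IH b e.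
by case: b; case: p; case: e => /=; lia.
Qed.

Lemma iter_elim_cat l s1 s2 :
  exists r, iter l elim10 (s1 ++ s2) = iter l elim10 s1 ++ r.
Proof.
elim: l => [|l [r IH]]; first by exists s2.
by rewrite !iterS IH /elim10 elim_from_cat; eexists.
Qed.

Lemma picks0 s : picks 0 0 s = 0.
Proof. by elim: s => //= b s IH; rewrite andbF min0n; case: b. Qed.

Lemma cload0 s : cload 0 0 s = 0.
Proof. by elim: s => //= b s IH; rewrite min0n; case: b. Qed.

Lemma picksS l s : picks l.+1 0 s = picks l 0 s + ascents false (iter l elim10 s).
Proof.
elim: l s => [|l IH] s; first by rewrite (@picks_elim false 0 0) // !picks0 addn0.
by rewrite (@picks_elim false _ 0) // IH (@picks_elim false _ 0) // addnA iterSr.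
Qed.

(** This is the slot coordinate of the end of [s]: its length minus twice the pick-ups, up to a
    carrier content of at most [l]. *)
Lemma size_iter_elim l s :
  size (iter l elim10 s) + 2 * picks l 0 s = size s + cload l 0 s.
Proof.
elim: l s => [|l IH] s; first by rewrite picks0 cload0.
rewrite iterSr (@picks_elim false _ 0) // (@cload_elim false _ 0) //.
have := IH (elim10 s); have := size_elim_from false s; rewrite /elim10 /=; lia.
Qed.

Lemma count_iter_elim l s : count id s = picks l 0 s + count id (iter l elim10 s).
Proof.
elim: l => [|l IH]; first by rewrite picks0.
by rewrite IH iterS picksS -addnA -count_elim.
Qed.

Lemma elim_from_nseq p n : exists d, elim_from p (nseq n false) = nseq d false.
Proof.
elim: n p => [|n IH] p; first by exists 0.
have [d hd] := IH false; case: p => /=; rewrite hd; first by exists d.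
by exists d.+1.
Qed.

Lemma elim10_nseq_cat n s : elim10 (nseq n false ++ s) = nseq n false ++ elim10 s.
Proof. by rewrite /elim10; elim: n => //= n ->. Qed.

(** Each deletion contributes one leading [false] through [coupling]. The padding [d] absorbs what
    happens at the right end. *)
Lemma iter_elim_bbs l s : exists d,
  iter l elim10 (bbs_word 0 s) ++ nseq d false
  = nseq l false ++ bbs_word 0 (iter l elim10 s).
Proof.
elim: l => [|l [d IH]]; first by exists 0; rewrite cats0.
have [_ hE _ _ _] := coupling (iter l elim10 s).
rewrite 2!iterS -addn1 nseqD -catA /= -hE catA -elim10_nseq_cat -IH /elim10.
rewrite elim_from_cat; set p := last _ _.
have [d' ->] := elim_from_nseq p d.
by rewrite -catA -nseqD; eexists.
Qed.

(* [g] counts the size-one solitons of [z] in slot coordinates. *)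
Definition fits (g : nat -> nat) (z : seq bool) :=
  forall u r, z = u ++ r ->
    g (size (elim10 u)) <= unit_solitons u <= g (size (elim10 u)).+1.

Lemma fits_prefix g u r : fits g (u ++ r) -> fits g u.
Proof. by move=> h a b e; apply: (h a (b ++ r)); rewrite e catA. Qed.

Lemma fits_cons0 g z : g 0 = 0 -> fits g z -> fits (fun y => g y.-1) (false :: z).
Proof.
move=> g0 h [|b u] r /=; first by rewrite g0.
case=> <- e; have := h u r e; rewrite /elim10 /unit_solitons /= => /andP[h1 h2].
by rewrite h1.
Qed.

Lemma fits_nseq_cat g n z : g 0 = 0 ->
  fits g z -> fits (fun y => g (y - n)) (nseq n false ++ z).
Proof.
move=> g0 h; elim: n => [|n IH] /=.
  by move=> u r e; rewrite !subn0; apply: h e.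
have := @fits_cons0 (fun y => g (y - n)) _ g0 IH.
have aux y : y.-1 - n = y - n.+1 by lia.
by move=> h' u r e; have := h' u r e; rewrite !aux.
Qed.

Lemma bbs_word_inv w s t r :
  bbs_word w s = t ++ r -> exists u v, s = u ++ v /\ t = bbs_word w u.
Proof.
move=> e; exists (take (size t) s), (drop (size t) s); rewrite cat_take_drop.
by rewrite bbs_word_take e take_size_cat.
Qed.

(** The leading [false] in [coupling] shifts the slot coordinate by one, and its last clause
    transfers the count up to end terms. These are absorbed by the room between the two values of
    [g]. *)
Lemma fits_bbs_word g z : g 0 = 0 -> {homo g : x y / x <= y} ->
  fits g z -> fits (fun y => g y.-1) (bbs_word 0 z).
Proof.
move=> g0 gm h t' r /bbs_word_inv[u [v [zuv ->]]] {t'}.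
case/lastP: u zuv => [|u b] zuv; first by rewrite /= g0.
have [hpq hE hv hpe hn] := coupling (rcons u b).
have hb := h _ _ zuv.
have hu : g (size (elim10 u)) <= unit_solitons u <= g (size (elim10 u)).+1.
  by apply: (h u (b :: v)); rewrite zuv cat_rcons.
have /(congr1 size) := hE; have /(congr1 (last false)) := hE.
move: hv hpe hn; rewrite size_cat size_nseq /= size_bbs_word last_rcons.
set t := bbs_word 0 (rcons u b); have ht : last false t = ~~ b && (0 < load 0 u).
  by rewrite /t bbs_word_rcons last_rcons.
rewrite ht last_cat.
move: hb; rewrite /unit_solitons unit_solitons_from_rcons /elim10 elim_from_rcons.
rewrite -/unit_solitons -/elim10.
case: b {zuv hpq hE ht} @t => t /=.
  rewrite !addn0 => hb _ _ -> _ ->; exact: hb.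
have := load_elim10 u; rewrite /elim10.
case: (last false u) => -> /=; rewrite ?addn1 /=.
  (* If the reduced carrier is empty and [e'] is [false], the evolved word has the count of [u], not
     of [rcons u false]; here the bound [hu] for the shorter prefix is needed. *)
  rewrite !addn0 -/elim10 => hb hv hpe hn _ ->; move: hb hu hn => /=.
  move: hv hpe; rewrite /elim10 -/unit_solitons.
  case: (load 0 _) => [|v0] /=; case: (last false (elim_from false u)) => //=;
   case: (last false (elim_from false t)) => //= _ _;
   rewrite ?addn0 ?addn1 /unit_solitons; lia.
rewrite ?last_rcons ?load_rcons ?bbs_word_rcons !addn0 size_rcons /=.
case: (posnP (load 0 _)) => [->|hl] /=.
  by rewrite !addn0 addn1 => _ _ _ -> _ [->].
rewrite ?last_rcons !addn0 ?add0n ?mul1n => hb _ _ hn hl' ->.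
by move: hn; rewrite hl' !addn1 => -[->].
Qed.

Definition drift j k (g : nat -> nat) y := g (y - j.+1 * k).

(** The shift per time step is [j.+1]: [j] leading zeros from commuting [j] deletions with the
    dynamics, and one slot from [fits_bbs_word]. *)
Lemma fits_iter_bbs j k g w : g 0 = 0 -> {homo g : x y / x <= y} ->
  fits g (iter j elim10 w) ->
  fits (drift j k g) (iter j elim10 (iter k (bbs_word 0) w)).
Proof.
move=> g0 gm h; elim: k => [|k IH].
  by move=> u r e; rewrite /drift muln0 !subn0; apply: h e.
have [d hd] := iter_elim_bbs j (iter k (bbs_word 0) w).
apply: (@fits_prefix _ _ (nseq d false)); rewrite iterS hd.
have d0 : drift j k g 0 = 0 by rewrite /drift sub0n.
have dm : {homo drift j k g : x y / x <= y}.
  by move=> x y xy; apply: gm; apply: leq_sub2r.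
have := @fits_nseq_cat _ j _ _ (fits_bbs_word d0 dm IH).
move=> h' u r e; have := h' d0 u r e; rewrite /drift.
have aux y : (y - j).-1 - j.+1 * k = y - j.+1 * k.+1 by rewrite mulnS; lia.
by rewrite !aux.
Qed.

Lemma unit_solitons_cat u r : unit_solitons u <= unit_solitons (u ++ r).
Proof.
elim/last_ind: r => [|r b IH]; first by rewrite cats0.
by rewrite -rcons_cat /unit_solitons unit_solitons_from_rcons (leq_trans IH) ?leq_addr.
Qed.

(** Several prefixes share a slot coordinate, so the count is not a function of it. The largest
    count over prefixes with fewer than [y] slots works, as such prefixes are shorter than any
    prefix with [y] slots. *)
Lemma fits_exists z : exists g : nat -> nat,
  [/\ g 0 = 0, {homo g : x y / x <= y} & fits g z].
Proof.
exists (fun y => \max_(n < (size z).+1 | size (elim10 (take n z)) < y)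
                   unit_solitons (take n z)); split.
- by rewrite big_pred0.
- move=> x y xy; apply/bigmax_leqP => i hi.
  by apply: (bigop.bigmax_sup i) => //; apply: leq_trans xy.
- move=> u r e; apply/andP; split.
    apply/bigmax_leqP => -[i /= _] hi; move: hi; rewrite e.
    have [le_i _|lt_i] := leqP i (size u).
      by rewrite takel_cat // -{2}(cat_take_drop i u) unit_solitons_cat.
    rewrite take_cat [i < _]ltnNge (ltnW lt_i) /=.
    by rewrite /elim10 elim_from_cat size_cat ltnNge leq_addr.
  have hi : size u < (size z).+1 by rewrite e size_cat ltnS leq_addr.
  by apply: (bigop.bigmax_sup (Ordinal hi)) => /=; rewrite e take_size_cat.
Qed.

(** Both prefixes are compared with one [g], drifted for the evolved word; the strict inequalities
    bridge the step from [g n] to [g n.+1]. *)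
Lemma soliton_transport w j k n n'
  (u := iter j elim10 (take n (iter k (bbs_word 0) w)))
  (u0 := iter j elim10 (take n' w)) :
  (size (elim10 u) < size (elim10 u0) + j.+1 * k ->
     unit_solitons u <= unit_solitons u0) /\
  (size (elim10 u0) + j.+1 * k < size (elim10 u) ->
     unit_solitons u0 <= unit_solitons u).
Proof.
have [g [g0 gm hg]] := fits_exists (iter j elim10 w).
have hk := @fits_iter_bbs j k _ _ g0 gm hg.
have [r hr] := iter_elim_cat j (take n (iter k (bbs_word 0) w))
                 (drop n (iter k (bbs_word 0) w)).
rewrite cat_take_drop in hr.
have [r' hr'] := iter_elim_cat j (take n' w) (drop n' w).
rewrite cat_take_drop in hr'.
have /andP[h1 h2] := hk _ _ hr; have /andP[h3 h4] := hg _ _ hr'.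
rewrite /drift -/u -/u0 in h1 h2 h3 h4.
split=> hlt.
  apply: leq_trans h2 _; apply: leq_trans h3; apply: gm; lia.
apply: leq_trans h4 _; apply: leq_trans h1; apply: gm; lia.
Qed.

End Words.

(** * The soliton decomposition of an excursion *)

Section Takahashi.
Local Open Scope nat_scope.
Implicit Types (s u v : seq (nat * bool)) (rs : seq (seq (nat * bool))).

Definition bits s : seq bool := map snd s.

Fixpoint alternating (b : bool) rs : bool :=
  if rs is r :: rs' then
    [&& r != [::], all (fun p => p.2 == b) r & alternating (~~ b) rs']
  else true.

Lemma flatten_runs s : flatten (runs s) = s.
Proof.
elim: s => //= p s; case: (runs s) => [|r rs] /= IH; first by rewrite -IH.
by case: ifP => _ /=; rewrite IH.
Qed.

Lemma alternating_runs p s : alternating p.2 (runs (p :: s)).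
Proof.
elim: s p => [|q s IH] p; first by rewrite /= eqxx.
have := IH q; have -> : runs (p :: q :: s) =
    if runs (q :: s) is r :: rs then
      if (head p r).2 == p.2 then (p :: r) :: rs else [:: p] :: r :: rs
    else [:: [:: p]] by [].
case: (runs (q :: s)) => [|r rs]; first by rewrite /= eqxx.
rewrite [alternating q.2 _]/=.
case/and3P; case: r => [|q' r] // _ har ha.
have hq : q'.2 = q.2 by case/andP: har => /eqP.
move: har ha; rewrite /= hq; case: (q.2 =P p.2) => [e|ne] /=; rewrite ?hq.
  by rewrite e !eqxx /= => -> ->.
have -> : q.2 = ~~ p.2 by move: ne; case: p.2; case: q.2.
by rewrite !eqxx /= => -> ->.
Qed.

Lemma bits_const b s : all (fun p => p.2 == b) s -> bits s = nseq (size s) b.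
Proof. by elim: s => //= p s IH /andP[/eqP -> /IH ->]. Qed.

Lemma find_soliton_cons r1 r2 rs :
  find_soliton (r1 :: r2 :: rs) =
  if size r1 <= size r2
  then Some (size r1, (head (0, false) r1).1, drop (size r1) r2 :: rs)
  else if find_soliton (r2 :: rs) is Some (i, x, rs')
       then Some (i, x, r1 :: rs') else None.
Proof. by []. Qed.

Lemma alternating_cons b r rs : alternating b (r :: rs) =
  [&& r != [::], all (fun p => p.2 == b) r & alternating (~~ b) rs].
Proof. by []. Qed.

(** The search passes a run only if it is strictly longer than the next one. So whatever precedes
    the soliton ends with [i] letters of the value opposite to its first half, which determines how
    a carrier arrives there. *)
Lemma find_solitonP b rs i x rs' : alternating b rs ->
  find_soliton rs = Some (i, x, rs') ->
  exists a r1 r2 c beta,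
    [/\ flatten rs = a ++ r1 ++ r2 ++ c, flatten rs' = a ++ c,
        [/\ size r1 = i, 0 < i & x = (head (0, false) r1).1],
        bits r1 = nseq i beta /\ bits r2 = nseq i (~~ beta) &
        if a is [::] then beta = b /\ i = size (head [::] rs)
        else exists a', bits a = a' ++ nseq i (~~ beta)].
Proof.
elim: rs b i x rs' => [|r rs IH] b i x rs' //.
case: rs IH => [|r2 rs] IH //; rewrite alternating_cons => /and3P[r0 hr hrs].
rewrite find_soliton_cons; case: ifP => [hle|/negbT].
  case=> <- <- <- /=; exists [::], r, (take (size r) r2), (drop (size r) r2 ++ flatten rs), b.
  rewrite /= (catA (take _ _)) cat_take_drop; split=> //; split=> //.
  - by case: (r) r0.
  - exact: bits_const.
  - move: hrs; rewrite alternating_cons => /and3P[_ h2 _]; rewrite [bits _]map_take [map _ _](bits_const h2).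
    by rewrite take_nseq.
rewrite -ltnNge => hle; case E: (find_soliton (r2 :: rs)) => [[[i0 x0] rs0]|] // [<- <- <-].
have [a [r1 [r2' [c [beta [h1 h2 [h3 h3' h3''] h4 h5]]]]]] := IH _ _ _ _ hrs E.
exists (r ++ a), r1, r2', c, beta; split=> //.
- by move: h1 => /= ->; rewrite -catA.
- by rewrite /= h2 catA.
case: r r0 hr hle => // p r _ hr hle.
case: a h5 {h1 h2} => [[hb hi]|q a [a' ha]] /=.
  exists (nseq (size (p :: r) - i0) b); rewrite cats0.
  have := bits_const hr; rewrite /= => ->.
  rewrite hb negbK -nseqD.
  by rewrite -[_ :: _]/(nseq (size r).+1 b); congr nseq; move: hle hi => /=; lia.
by exists (p.2 :: bits r ++ a'); rewrite /= /bits map_cat -catA -/(bits (q :: a)) ha.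
Qed.

(** Words inside an excursion: an empty carrier never meets an empty site, so there is no record. *)
Fixpoint ballot (h : nat) (w : seq bool) : bool :=
  if w is b :: w' then (b || (0 < h)) && ballot (if b then h.+1 else h.-1) w'
  else true.

Lemma load_cat h w1 w2 : load h (w1 ++ w2) = load (load h w1) w2.
Proof. by elim: w1 h => //= b w IH h; rewrite IH. Qed.

Lemma ballot_cat h w1 w2 : ballot h (w1 ++ w2) = ballot h w1 && ballot (load h w1) w2.
Proof. by elim: w1 h => //= b w IH h; rewrite IH andbA. Qed.

Lemma load_nseq h n b : load h (nseq n b) = if b then h + n else h - n.
Proof. by case: b; elim: n h => [|n IH] h /=; rewrite ?IH; lia. Qed.

Lemma ballot_nseq_false h n : ballot h (nseq n false) -> n <= h.
Proof. by elim: n h => [|n IH] [|h] //= /IH. Qed.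

Lemma cload_nseq l h n b : h <= l ->
  cload l h (nseq n b) = if b then minn l (h + n) else h - n.
Proof. by case: b; elim: n h => [|n IH] h hl /=; rewrite ?IH; lia. Qed.

Lemma picks_nseq l h n b : h <= l ->
  picks l h (nseq n b) = if b then minn n (l - h) else 0.
Proof. by case: b; elim: n h => [|n IH] h hl /=; rewrite ?IH; lia. Qed.

(* Removing a soliton of size [i] from an excursion leaves every carrier in the state
   it had before the soliton and costs a carrier of capacity [l] exactly [minn l i]
   balls. *)
Lemma find_soliton_step s i x rs' (s' := flatten rs') :
  ballot 0 (bits s) -> find_soliton (runs s) = Some (i, x, rs') ->
  [/\ ballot 0 (bits s'), load 0 (bits s') = load 0 (bits s)
    & forall l, picks l 0 (bits s) = minn l i + picks l 0 (bits s')].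
Proof.
case: s => [|p s] // hbal hf.
have := find_solitonP (alternating_runs p s) hf.
case=> a [r1 [r2 [c [beta [h1 h2 [h3 h3' h3''] [h4 h4'] h5]]]]].
move: hbal; rewrite /s' {}h2; move: h1; rewrite flatten_runs => e.
have p1 : ballot 0 (bits (p :: s)) -> p.2 by rewrite /= orbF => /andP[].
rewrite {}e in p1 *; move: p1 h4 h4'.
rewrite /bits !map_cat -!/(bits _) => p1 e1 e2; rewrite {}e1 {}e2 in p1 *; move=> hbal.
(* If [beta] is a ball, the [i] empty sites before it have made room for [i] balls; otherwise the
   [i] balls before it are on board as far as capacity allows. With nothing before it, the carrier
   is empty and [beta] is a ball. *)
have hstate l : if beta then cload l 0 (bits a) <= l - i
                else minn l i <= cload l 0 (bits a) <= l.
  case: (a) h5 (p1 hbal) => [[-> _] ->|q a0 [a' ->] _] //.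
  rewrite cload_cat; have := @cload_le l 0 a' isT; set w := cload _ _ _ => hw.
  by rewrite cload_nseq //; case: (beta) => /=; lia.
have hload : load (load (load 0 (bits a)) (nseq i beta)) (nseq i (~~ beta))
    = load 0 (bits a).
  move: hbal; rewrite !ballot_cat !load_nseq => /and3P[_ + _].
  by case: (beta) => /=; [lia | move/ballot_nseq_false; lia].
split.
- by move: hbal; rewrite !ballot_cat hload => /and4P[-> _ _ ->].
- by rewrite !load_cat hload.
- move=> l; have := hstate l; rewrite !picks_cat.
  set w := cload l 0 (bits a) => hw.
  have wl : w <= l by apply: cload_le.
  have w1 : cload l w (nseq i beta) <= l by apply: cload_le.
  have -> : cload l (cload l w (nseq i beta)) (nseq i (~~ beta)) = w.
    by rewrite !cload_nseq //; case: (beta) hw => /=; lia.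
  rewrite !picks_nseq // !cload_nseq //; case: (beta) hw => /=; lia.
Qed.

(** The removal procedure without fuel and stoppable at any time, so that executions can be
    concatenated and those on a prefix extended to the whole word. *)
Inductive reduces : seq (nat * bool) -> seq (nat * nat) -> seq (nat * bool) -> Prop :=
| reduces_nil s : reduces s [::] s
| reduces_cons s i x rs L s' : find_soliton (runs s) = Some (i, x, rs) ->
    reduces (flatten rs) L s' -> reduces s ((i, x) :: L) s'.

Lemma find_soliton_perm s i x rs : find_soliton (runs s) = Some (i, x, rs) ->
  exists r, [/\ perm_eq s (r ++ flatten rs), x \in map fst r, 0 < i &
            size (flatten rs) < size s].
Proof.
case: s => [|p s] // hf.
have := find_solitonP (alternating_runs p s) hf.
case=> a [r1 [r2 [c [beta [h1 h2 [h3 h3' h3''] _ _]]]]].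
exists (r1 ++ r2); rewrite -[p :: s]flatten_runs h1 h2; split=> //.
- by rewrite (catA r1) perm_catCA.
- case: r1 h3 h3'' {h1} => [h0|q r1 _ ->] //=; first by rewrite -h0 in h3'.
  by rewrite in_cons eqxx.
- rewrite !size_cat; lia.
Qed.

Lemma reduces_total s : exists L s', reduces s L s' /\ find_soliton (runs s') = None.
Proof.
have [n] := ubnP (size s); elim: n s => // n IH s hs.
case E: (find_soliton (runs s)) => [[[i x] rs]|]; last first.
  by exists [::], s; split=> //; constructor.
have [r [hp _ _ r0]] := find_soliton_perm E.
have [|L [s' [h1 h2]]] := IH (flatten rs).
  lia.
by exists ((i, x) :: L), s'; split=> //; apply: reduces_cons E h1.
Qed.

Lemma reduces_cat s L s' L' s'' :
  reduces s L s' -> reduces s' L' s'' -> reduces s (L ++ L') s''.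
Proof.
by move=> h; elim: h L' => // {}s i x rs {}L {}s' hf _ IH L' h; apply: reduces_cons hf (IH _ h).
Qed.

Lemma runs_cat u v : u != [::] -> exists rs r r' rs',
  [/\ runs u = rcons rs r, runs (u ++ v) = rs ++ (r ++ r') :: rs' &
      r' ++ flatten rs' = v].
Proof.
elim: u => // p u IH _; case: u IH => [|q u] IH.
  exists [::], [:: p]; rewrite /=; case E: (runs v) => [|r rs].
    by exists [::], [::]; split=> //; rewrite -(flatten_runs v) E.
  case: ifP => _; first by exists r, rs; split=> //; rewrite -(flatten_runs v) E.
  by exists [::], (r :: rs); split=> //; rewrite -(flatten_runs v) E.
have unf w : runs (p :: w) =
    if runs w is r :: rs then
      if (head p r).2 == p.2 then (p :: r) :: rs else [:: p] :: r :: rs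
    else [:: [:: p]] by [].
have [rs [r [r' [rs' [h1 h2 h3]]]]] := IH isT.
rewrite cat_cons unf (unf ((q :: u) ++ v)) h1 h2.
case: rs h1 h2 => [|r0 rs] h1 h2 /=.
  have r0 : r != [::] by have := alternating_runs q u; rewrite h1 => /and3P[].
  have -> : head p (r ++ r') = head p r by case: (r) r0.
  case: ifP => _; first by exists [::], (p :: r), r', rs'.
  by exists [:: [:: p]], r, r', rs'.
case: ifP => _; first by exists ((p :: r0) :: rs), r, r', rs'.
by exists ([:: p] :: r0 :: rs), r, r', rs'.
Qed.

(** Appending letters only lengthens the last run and adds runs after it. Earlier comparisons are
    unchanged and a successful one stays successful, so the left-most choice is the same. *)
Lemma find_soliton_cat rs r r' rs' i x rs0 :
  find_soliton (rcons rs r) = Some (i, x, rs0) -> exists rs1,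
  find_soliton (rs ++ (r ++ r') :: rs') = Some (i, x, rs1) /\
  flatten rs1 = flatten rs0 ++ r' ++ flatten rs'.
Proof.
elim: rs i x rs0 => [|r1 rs IH] i x rs0 //.
case: rs IH => [|r2 rs] IH.
  rewrite -cats1 !cat_cons /= -/(find_soliton _); case: ifP => // hle [<- <- <-].
  rewrite size_cat (leq_trans hle) ?leq_addr //; eexists; split=> //=.
  rewrite drop_cat; case: ltnP => h; first by rewrite cats0 -catA.
  have -> : size r1 = size r by lia.
  by rewrite subnn drop0 drop_size.
rewrite !rcons_cons !cat_cons !find_soliton_cons; case: ifP => hle.
  case=> <- <- <-; eexists; split=> //=.
  by rewrite -cats1 !flatten_cat /= cats0 -!catA.
rewrite -rcons_cons -cat_cons.
case E: (find_soliton _) => [[[i1 x1] rs1]|] // [<- <- <-].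
have [rs2 [-> h]] := IH _ _ _ E; eexists; split=> //=.
by rewrite h catA.
Qed.

Lemma reduces_prefix u v L u' : reduces u L u' -> reduces (u ++ v) L (u' ++ v).
Proof.
elim=> [s|s i x rs L' s' hf _ IH]; first by constructor.
have s0 : s != [::] by apply/eqP => e; rewrite e in hf.
have [rs1 [r [r' [rs' [h1 h2 h3]]]]] := runs_cat v s0.
rewrite h1 in hf; have [rs2 [h4 h5]] := find_soliton_cat r' rs' hf.
by apply: (@reduces_cons _ _ _ rs2); rewrite ?h2 // h5 h3.
Qed.

Lemma solitons_reduces s L s' :
  reduces s L s' -> find_soliton (runs s') = None -> solitons s = L.
Proof.
rewrite /solitons => h hN; have : size s <= size s by [].
move: {2 3}(size s) => n; elim: h hN n => [{}s|{}s i x rs {}L {}s' hf _ IH] hN n hn.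
  by case: n {hn} => //= n; rewrite hN.
have [r [hp _ _ r0]] := find_soliton_perm hf.
case: n hn => [|n] hn /=; first by lia.
by rewrite hf IH //; lia.
Qed.

Lemma reduces_ballot s L s' : reduces s L s' -> ballot 0 (bits s) ->
  [/\ ballot 0 (bits s'), load 0 (bits s') = load 0 (bits s)
    & forall l, picks l 0 (bits s) = \sum_(p <- L) minn l p.1 + picks l 0 (bits s')].
Proof.
elim=> [{}s|{}s i x rs {}L {}s' hf _ IH] hb; first by split=> // l; rewrite big_nil.
have [h1 h2 h3] := find_soliton_step hb hf.
have [h4 h5 h6] := IH h1; split=> //; first by rewrite h5.
by move=> l; rewrite h3 h6 big_cons addnA.
Qed.

Lemma reduces_sites s L s' : reduces s L s' -> uniq (map fst s) ->
  uniq (map snd L ++ map fst s') /\ {subset map snd L ++ map fst s' <= map fst s}.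
Proof.
elim=> [{}s|{}s i x rs {}L {}s' hf _ IH] hu; first by split.
have [r [hp hx _ _]] := find_soliton_perm hf.
have hp' := perm_map fst hp; rewrite map_cat in hp'.
move: hu; rewrite (perm_uniq hp') cat_uniq => /and3P[_ hd hu].
have [h1 h2] := IH hu; split.
  rewrite /= h1 andbT; apply/negP => /h2 hx'.
  by move/hasPn: hd => /(_ _ hx'); rewrite hx.
move=> y; rewrite /= in_cons (perm_mem hp') mem_cat => /orP[/eqP->|/h2 ->].
  by rewrite hx.
by rewrite orbT.
Qed.

(** A failed search means strictly decreasing run lengths. *)
Lemma irreducible_size_flatten r rs :
  find_soliton (r :: rs) = None -> size (flatten (r :: rs)) <= size r * size r.
Proof.
elim: rs r => [|r2 rs IH] r; first by rewrite /= cats0; nia.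
rewrite find_soliton_cons; case: ifP => [//|/negbT]; rewrite -ltnNge => hlt.
case E: (find_soliton _) => [[[? ?] ?]|] // _.
by have := IH _ E; rewrite /= !size_cat; nia.
Qed.

(** With decreasing runs, every run of balls outweighs the run of empty sites after it; a word that
    begins with a ball therefore ends with a carrier fuller than at its start. *)
Lemma irreducible_load b r rs h : alternating b (r :: rs) ->
  find_soliton (r :: rs) = None ->
  if b then h < load h (bits (flatten (r :: rs)))
  else h - size r <= load h (bits (flatten (r :: rs))).
Proof.
elim: rs b r h => [|r2 rs IH] b r h.
  rewrite alternating_cons => /and3P[r0 /bits_const hr _] _ /=; rewrite cats0 hr load_nseq.
  by case: b {hr}; [case: r r0 => //= *; lia | ].
rewrite alternating_cons => /and3P[r0 /bits_const hr hal].
rewrite find_soliton_cons; case: ifP => [//|/negbT]; rewrite -ltnNge => hlt.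
case E: (find_soliton _) => [[[? ?] ?]|] // _.
have := IH _ _ (load h (bits r)) hal E.
rewrite [flatten (r :: _)]/= -/(flatten (r2 :: rs)) /bits map_cat load_cat -!/(bits _).
by rewrite hr load_nseq; case: b {hr hal IH} => /=; lia.
Qed.

Lemma irreducible_balanced s : ballot 0 (bits s) -> load 0 (bits s) = 0 ->
  find_soliton (runs s) = None -> s = [::].
Proof.
case: s => // p s hb h0 hN; have := alternating_runs p s.
have p1 : p.2 by move: hb; rewrite /= orbF => /andP[].
rewrite p1; move: hN h0; rewrite -{2}(flatten_runs (p :: s)).
case: (runs _) (flatten_runs (p :: s)) => [|r rs] // _ hN h0 hal.
by have := irreducible_load 0 hal hN; rewrite /= -/(flatten (r :: rs)) h0.
Qed.

(** The first run consists of balls, all picked up by a carrier of capacity [I], so its length is at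
    most [I]; it is also the longest run. *)
Lemma irreducible_size I s : ballot 0 (bits s) ->
  picks I 0 (bits s) = count id (bits s) ->
  find_soliton (runs s) = None -> size s <= I * I.
Proof.
case: s => // p s hb hI hN; have := alternating_runs p s.
have p1 : p.2 by move: hb; rewrite /= orbF => /andP[].
rewrite p1; move: hN hI; rewrite -{2 3 5}(flatten_runs (p :: s)).
case: (runs _) => [|r rs] // hN; rewrite alternating_cons => + /and3P[_ /bits_const hr _].
rewrite [flatten _]/= /bits map_cat picks_cat count_cat -!/(bits _) => hI.
have := picks_le_count I (cload I 0 (bits r)) (bits (flatten rs)).
have := picks_le_count I 0 (bits r).
move: hI; rewrite hr picks_nseq // count_nseq /= mul1n => hI h1 h2.
have := irreducible_size_flatten hN; rewrite /=; nia.
Qed.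

Lemma picks_big l w b : w + size b <= l -> picks l w b = count id b.
Proof.
elim: b w => //= b s IH w h; rewrite IH; last by case: b {IH}; lia.
by congr (_ + _); case: b => //=; lia.
Qed.

Lemma cload_le_load l w w' b : w <= w' -> cload l w b <= load w' b.
Proof. by elim: b w w' => //= b s IH w w' h; apply: IH; case: b; lia. Qed.

End Takahashi.

(** * Counting solitons of a configuration *)

(* Plain [lia] is too slow in the large contexts below. *)
Ltac slia := repeat match goal with H : ?P |- _ => lazymatch P with
  | is_true (leq _ _) => fail | is_true (andb _ _) => fail
  | @eq nat _ _ => fail | is_true (negb _) => fail
  | _ => lazymatch type of P with Prop => clear H end end end; lia.

Section Configurations.
Local Open Scope nat_scope.
Implicit Types (eta : config) (x y i l I : nat).

Definition word eta x := [seq eta y | y <- iota 1 x].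

Lemma wordS eta x : word eta x.+1 = rcons (word eta x) (eta x.+1).
Proof. by rewrite /word -[x.+1]addn1 iotaD map_cat /= add1n addn1 cats1. Qed.

Lemma size_word eta x : size (word eta x) = x.
Proof. by rewrite size_map size_iota. Qed.

Lemma take_word eta x X : x <= X -> take x (word eta X) = word eta x.
Proof. by move=> h; rewrite -map_take take_iota (minn_idPl h). Qed.

Lemma load_word eta x : load 0 (word eta x) = carrier eta x.
Proof.
elim: x => // x IH; rewrite wordS load_rcons IH /=; case: (eta _) => //.
by rewrite subn1.
Qed.

Lemma word_bbs_step eta x : word (bbs_step eta) x = bbs_word 0 (word eta x).
Proof. by elim: x => // x IH; rewrite !wordS bbs_word_rcons IH load_word. Qed.

Lemma word_iter_bbs_step eta k x :
  word (iter k bbs_step eta) x = iter k (bbs_word 0) (word eta x).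
Proof. by elim: k => //= k IH; rewrite word_bbs_step IH. Qed.

Definition record eta x := (x == 0) || (~~ eta x && (carrier eta x.-1 == 0)).

Fixpoint empty_passages eta x : nat :=
  if x is y.+1 then empty_passages eta y + record eta y.+1 else 0.

(** [empty_passages] is the running maximum of the walk, and the carrier is the distance below it.
    This makes being a record a local condition on the carrier. *)
Lemma SpathE eta x : Spath eta x = (Posz (empty_passages eta x) - Posz (carrier eta x))%R.
Proof.
elim: x => //= x ->; rewrite /record /=; case: (eta _) => /=; first lia.
by case: (carrier eta x) => [|c] /=; lia.
Qed.

Lemma empty_passages_homo eta x y : x <= y -> empty_passages eta x <= empty_passages eta y.
Proof.
move=> /subnK <-; elim: (y - x) => // n IH; rewrite addSn /=.
exact: leq_trans IH (leq_addr _ _).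
Qed.

Lemma empty_passages_attained eta x :
  exists2 y, y <= x & Spath eta y = Posz (empty_passages eta x).
Proof.
elim: x => [|x [y hy e]]; first by exists 0.
rewrite /=; case E: (record eta x.+1); last by exists y; rewrite ?addn0 // ltnW.
exists x.+1 => //; rewrite SpathE /= E; move: E.
by rewrite /record /= => /andP[/negbTE -> /eqP ->]; lia.
Qed.

Lemma recordP eta x : is_record eta x <-> record eta x.
Proof.
case: x => [|x]; first by split=> // _; left.
split.
  case=> // h; rewrite /record /=.
  have hx := h x (ltnSn x); have := hx; rewrite /=; case E: (eta x.+1) => /= h'; first lia.
  have [y hy e] := empty_passages_attained eta x.
  have := h y; rewrite ltnS hy => /(_ isT); rewrite e /= E SpathE.
  by case: (carrier eta x) => // c; lia.
rewrite /record /= => /andP[h0 /eqP hc]; right => y; rewrite ltnS => hy.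
have := empty_passages_homo eta hy; rewrite (SpathE eta y) /= SpathE hc (negbTE h0); lia.
Qed.

Lemma next_record eta x : in_Omega eta -> exists2 x1, x < x1 & record eta x1.
Proof.
move=> hO; have [y [_ hy]] := hO (Posz (empty_passages eta x)) 0.
have {}hy : empty_passages eta x < empty_passages eta y.
  by move: hy; rewrite SpathE; lia.
have xy : x <= y.
  by rewrite leqNgt; apply/negP => /ltnW /(empty_passages_homo eta); lia.
move: hy; rewrite -(subnKC xy); elim: (y - x) => [|n IH]; first by rewrite addn0 ltnn.
rewrite addnS /=; case E: (record eta (x + n).+1) => h.
  by exists (x + n).+1 => //; rewrite ltnS leq_addr.
by apply: IH; rewrite addn0 in h.
Qed.

Lemma Spath_bbs_step eta x :
  Spath (bbs_step eta) x = (Spath eta x + Posz (2 * carrier eta x))%R.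
Proof.
elim: x => //= x ->; case: (eta x.+1) => /=; first lia.
by case: (carrier eta x) => [|c] /=; lia.
Qed.

Lemma in_Omega_bbs_step eta : in_Omega eta -> in_Omega (bbs_step eta).
Proof.
move=> h M x0; have [x [h1 h2]] := h M x0; exists x; split=> //.
by rewrite Spath_bbs_step; lia.
Qed.

Lemma ballot_rcons h b w :
  ballot h (rcons w b) = ballot h w && (b || (0 < load h w)).
Proof. by rewrite -cats1 ballot_cat /= andbT. Qed.

Lemma bits_segment eta x0 x1 :
  bits (segment eta x0 x1) = [seq eta y | y <- iota x0.+1 (x1 - x0.+1)].
Proof. by rewrite /bits /segment -map_comp. Qed.

Lemma sites_segment eta x0 x1 : map fst (segment eta x0 x1) = iota x0.+1 (x1 - x0.+1).
Proof. by rewrite /segment -map_comp map_id. Qed.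

Definition consecutive_records eta x0 x1 :=
  [/\ record eta x0, record eta x1, x0 < x1 &
      forall y, x0 < y < x1 -> ~~ record eta y].

Lemma carrier_record eta x : record eta x -> carrier eta x = 0.
Proof.
by case: x => //= x; rewrite /record /= => /andP[/negbTE -> /eqP ->]; rewrite sub0n.
Qed.

Lemma word_segment eta x0 x : x0 <= x ->
  word eta x = word eta x0 ++ bits (segment eta x0 x.+1).
Proof.
move=> h; rewrite bits_segment /word -map_cat subSS; congr map.
by rewrite -[x0.+1]add1n -iotaD subnKC.
Qed.

Lemma cload_record eta l x : record eta x -> cload l 0 (word eta x) = 0.
Proof.
move=> /carrier_record h.
by have := @cload_le_load l 0 0 (word eta x) isT; rewrite load_word h leqn0 => /eqP.
Qed.

Lemma segment_ballot eta x0 x1 x : consecutive_records eta x0 x1 -> x0 <= x < x1 ->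
  ballot 0 (bits (segment eta x0 x.+1)) /\
  load 0 (bits (segment eta x0 x.+1)) = carrier eta x.
Proof.
case=> h0 h1 h01 hn /andP[hx hx1]; split; last first.
  rewrite -load_word (word_segment eta hx) load_cat.
  by rewrite (load_word eta x0) carrier_record.
move: hx hx1 => /subnKC <-; elim: (x - x0) => [|n IH] hx1.
  by rewrite bits_segment addn0 subnn.
have hlt : x0 + n < x1 by lia.
have e : word eta (x0 + n).+1 =
    word eta x0 ++ rcons (bits (segment eta x0 (x0 + n).+1)) (eta (x0 + n).+1).
  by rewrite wordS (@word_segment _ x0 (x0 + n)) ?leq_addr // rcons_cat.
have := word_segment eta (leq_addr n.+1 x0); rewrite addnS e => /eqP.
rewrite eqseq_cat // eqxx /= => /eqP <-; rewrite ballot_rcons (IH hlt) /=.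
have hload : load 0 (bits (segment eta x0 (x0 + n).+1)) = carrier eta (x0 + n).
  rewrite -load_word (@word_segment _ x0 (x0 + n)) ?leq_addr // load_cat.
  by rewrite (load_word eta x0) carrier_record.
rewrite hload; have /hn : x0 < (x0 + n).+1 < x1 by lia.
by rewrite /record /=; case: (eta _) => //=; lia.
Qed.

Lemma segment_cat eta x0 x x1 : x0 <= x < x1 ->
  segment eta x0 x1 = segment eta x0 x.+1 ++ [seq (y, eta y) | y <- iota x.+1 (x1 - x.+1)].
Proof.
move=> h; rewrite /segment -map_cat; congr map.
have -> : x1 - x0.+1 = (x.+1 - x0.+1) + (x1 - x.+1) by lia.
by rewrite iotaD; congr (_ ++ iota _ _); lia.
Qed.

Lemma segment_reduces eta x0 x1 : consecutive_records eta x0 x1 ->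
  reduces (segment eta x0 x1) (solitons (segment eta x0 x1)) [::].
Proof.
move=> hc; have [h0 h1 h01 hn] := hc.
have [L [s' [hL hN]]] := reduces_total (segment eta x0 x1).
rewrite (solitons_reduces hL hN).
have hx : x0 <= x1.-1 < x1 by lia.
have [hb hl] := segment_ballot hc hx.
rewrite (prednK (leq_ltn_trans (leq0n _) h01)) in hb hl.
have [hb' hl' _] := reduces_ballot hL hb.
suff <- : s' = [::] by [].
apply: irreducible_balanced => //; rewrite hl' hl.
case: x1 h1 {h01 hn hx hb hl hc hL hb' hl'} => // x1.
by rewrite /record /= => /andP[_ /eqP].
Qed.

Lemma soliton_site eta x0 x1 i y : consecutive_records eta x0 x1 ->
  (i, y) \in solitons (segment eta x0 x1) -> x0 < y < x1.
Proof.
move=> hc hin; have hu : uniq (map fst (segment eta x0 x1)) by rewrite sites_segment iota_uniq.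
have [_ /(_ y)] := reduces_sites (segment_reduces hc) hu.
by rewrite cats0 sites_segment mem_iota => /(_ (map_f snd hin)); lia.
Qed.

Lemma has_soliton_segment eta x0 x1 i y : consecutive_records eta x0 x1 ->
  x0 < y < x1 -> (has_soliton eta i y <-> (i, y) \in solitons (segment eta x0 x1)).
Proof.
move=> hc hy; have [h0 h1 h01 hn] := hc; split; last first.
  move=> h; exists x0, x1; split; first exact/recordP.
  split; first exact/recordP.
  by split=> //; split=> // z hz /recordP; apply/negP/hn.
case=> z0 [z1 [/recordP r0 [/recordP r1 [z01 [hz hin]]]]].
have hcz : consecutive_records eta z0 z1.
  by split=> // z /hz h; apply/negP => /recordP.
have hyz := soliton_site hcz hin.
have [_ _ _ hz'] := hcz.
have e0 : z0 = x0.
  case: (ltngtP z0 x0) => // h.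
    have /hz' : z0 < x0 < z1 by lia.
    by rewrite h0.
  have /hn : x0 < z0 < x1 by lia.
  by rewrite r0.
have e1 : z1 = x1.
  case: (ltngtP z1 x1) => // h.
    have /hn : x0 < z1 < x1 by lia.
    by rewrite r1.
  have /hz' : z0 < x1 < z1 by lia.
  by rewrite h1.
by rewrite -e0 -e1.
Qed.

Lemma has_soliton_not_record eta i y : has_soliton eta i y -> ~~ record eta y.
Proof.
case=> z0 [z1 [/recordP r0 [/recordP r1 [z01 [hz hin]]]]].
have hcz : consecutive_records eta z0 z1.
  by split=> // z /hz h; apply/negP => /recordP.
by have := soliton_site hcz hin; case: hcz => _ _ _; apply.
Qed.

Lemma last_record eta x : exists2 x0, x0 <= x &
  record eta x0 /\ forall y, x0 < y <= x -> ~~ record eta y.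
Proof.
elim: x => [|x [x0 hx [h0 h]]]; first by exists 0 => //; split=> // y; lia.
case E: (record eta x.+1).
  by exists x.+1 => //; split=> // y; lia.
exists x0; [lia | split=> // y hy].
case: (ltngtP y x.+1) => [hlt|hlt|->]; last by rewrite E.
  by apply: h; lia.
by lia.
Qed.

Lemma bracketing_records eta x : in_Omega eta ->
  exists x0 x1, consecutive_records eta x0 x1 /\ x0 <= x < x1.
Proof.
move=> hO; have [x0 h0 [hr hn]] := last_record eta x.
have [x2 h2 hr2] := next_record x hO.
have ex : exists n, (x < n) && record eta n by exists x2; rewrite h2.
case: (ex_minnP ex) => x1 /andP[h1 hr1] hmin; exists x0, x1; split; last by lia.
split=> //; first by lia.
move=> y hy; apply/negP => hyr; case: (leqP y x) => hyx.
  by move: hyr; apply/negP/hn; lia.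
by have := hmin y; rewrite hyx hyr => /(_ isT); lia.
Qed.

(** Sizes at most [I], expressed through carriers: by [thinP] no ball is left after [I] deletions, a
    property that the commutation with the dynamics visibly preserves. *)
Definition thin I eta := forall x, picks I 0 (word eta x) = count id (word eta x).

Lemma thinP I eta :
  thin I eta <-> forall x, ~~ has id (iter I elim10 (word eta x)).
Proof.
split=> h x; first have := h x; last have := h x;
  rewrite (count_iter_elim I (word eta x)) has_count; lia.
Qed.

Lemma picks_count_cat I h w1 w2 :
  picks I h (w1 ++ w2) = count id (w1 ++ w2) ->
  picks I h w1 = count id w1 /\ picks I (cload I h w1) w2 = count id w2.
Proof.
rewrite picks_cat count_cat; have := picks_le_count I h w1.
have := picks_le_count I (cload I h w1) w2; lia.
Qed.

Lemma bbs_word_zeros n : bbs_word 0 (nseq n false) = nseq n false.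
Proof. by elim: n => //= n ->. Qed.

Lemma zerosP (w : seq bool) : ~~ has id w -> w = nseq (size w) false.
Proof. by elim: w => //= b w IH; rewrite negb_or => /andP[/negbTE -> /IH <-]. Qed.

Lemma thin_bbs_step I eta : thin I eta -> thin I (bbs_step eta).
Proof.
move=> /thinP h; apply/thinP => x; rewrite word_bbs_step.
have [d hd] := iter_elim_bbs I (word eta x).
have : ~~ has id (iter I elim10 (bbs_word 0 (word eta x)) ++ nseq d false).
  by rewrite hd (zerosP (h x)) bbs_word_zeros has_cat !has_nseq !andbF.
by rewrite has_cat negb_or => /andP[].
Qed.

Lemma thin_iter I eta k : thin I eta -> thin I (iter k bbs_step eta).
Proof. by move=> h; elim: k => //= k; apply: thin_bbs_step. Qed.

Lemma in_Omega_iter eta k : in_Omega eta -> in_Omega (iter k bbs_step eta).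
Proof. by move=> h; elim: k => //= k; apply: in_Omega_bbs_step. Qed.

Lemma segment_picks eta x0 x1 l : consecutive_records eta x0 x1 ->
  picks l 0 (bits (segment eta x0 x1)) =
  \sum_(p <- solitons (segment eta x0 x1)) minn l p.1.
Proof.
move=> hc; have [_ _ h01 _] := hc.
have hx : x0 <= x1.-1 < x1 by lia.
have [hb _] := segment_ballot hc hx.
rewrite (prednK (leq_ltn_trans (leq0n _) h01)) in hb.
by have [_ _ ->] := reduces_ballot (segment_reduces hc) hb; rewrite addn0.
Qed.

Lemma word_next_record eta x0 x1 : consecutive_records eta x0 x1 ->
  word eta x1 = (word eta x0 ++ bits (segment eta x0 x1)) ++ [:: false].
Proof.
case=> _ + h01 _; case: x1 h01 => // x1 h01; rewrite /record /= => /andP[h _].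
by rewrite wordS (@word_segment _ x0 x1) // (negbTE h) cats1.
Qed.

Lemma record_ind eta (Q : nat -> Prop) : Q 0 ->
  (forall x0 x1, consecutive_records eta x0 x1 -> Q x0 -> Q x1) ->
  forall x, record eta x -> Q x.
Proof.
move=> Q0 QS x; have [n] := ubnP x; elim: n x => // n IH [|x] // hx hr.
have [x0 h0 [hr0 hn]] := last_record eta x.
apply: (QS x0); last by apply: IH => //; lia.
by split=> //.
Qed.

(** On a complete excursion a carrier of capacity [I] and one that picks up every ball collect the
    same terms [minn _ p.1]. A general prefix is cut out of the word up to the next record. *)
Lemma in_Omega_I_thin I eta : in_Omega_I I eta -> thin I eta.
Proof.
case=> hO hI x.
have hrec : forall x, record eta x -> picks I 0 (word eta x) = count id (word eta x).
  apply: record_ind => // x0 x1 hc IH; rewrite (word_next_record hc).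
  have [h0 _ _ _] := hc.
  rewrite !picks_cat !count_cat IH cload_record //= !addn0; congr (_ + _).
  rewrite segment_picks //.
  set s := segment _ _ _; rewrite -(@picks_big (I + size (bits s)) 0) ?leq_addl //.
  rewrite segment_picks // -/s big_seq [RHS]big_seq; apply: eq_bigr => -[i y] hin.
  have hi : i <= I.
    rewrite leqNgt; apply/negP => /(hI i y); apply.
    exact/(has_soliton_segment _ hc)/hin/(soliton_site hc hin).
  by move: hi => /=; clear; lia.
have [x1 hx1 hr1] := next_record x hO.
have := hrec _ hr1; rewrite -(cat_take_drop x (word eta x1)).
by rewrite take_word ?(ltnW hx1) // => /picks_count_cat[].
Qed.

Lemma leq_sum_eq (A : eqType) (L : seq A) (f g : A -> nat) :
  (forall p, f p <= g p) -> \sum_(p <- L) g p <= \sum_(p <- L) f p ->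
  forall p, p \in L -> g p <= f p.
Proof.
move=> hfg; elim: L => // q L IH; rewrite !big_cons => h p; rewrite in_cons.
have hs : \sum_(p <- L) f p <= \sum_(p <- L) g p by apply: leq_sum.
have := hfg q => hq; case/orP => [/eqP->|]; first by lia.
by apply: IH; lia.
Qed.

Lemma solitons_segment_size I eta x0 x1 (p : nat * nat) : thin I eta ->
  consecutive_records eta x0 x1 -> p \in solitons (segment eta x0 x1) ->
  0 < p.1 <= I.
Proof.
move=> hth hc hp; have hpos : forall s L s', reduces s L s' -> {in L, forall p, 0 < p.1}.
  move=> s L s'; elim=> // {}s i x rs {}L {}s' hf _ IH q; rewrite in_cons => /orP[/eqP->|/IH //].
  by have [r [_ _ ]] := find_soliton_perm hf.
rewrite (hpos _ _ _ (segment_reduces hc) _ hp) /=.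
have := hth x1; rewrite (word_next_record hc) => /picks_count_cat[+ _].
move=> /picks_count_cat[_ +]; have [h0 _ _ _] := hc; rewrite cload_record //.
(* The summand [I.+1] puts the larger capacity above [I], so that equality of the two minima,
   obtained term by term, bounds the size by [I]. *)
rewrite -(@picks_big (I.+1 + size (bits (segment eta x0 x1))) 0) ?leq_addl //.
rewrite !segment_picks // => he.
have hle q : minn I q <= minn (I.+1 + size (bits (segment eta x0 x1))) q by lia.
have := leq_sum_eq (fun p => hle p.1) _ hp; rewrite he => /(_ (leqnn _)).
by move: (p.1) => q; lia.
Qed.

(* The algorithm on a whole excursion first exhausts its prefix up to [x]; the part of
   the prefix that survives has strictly decreasing runs, the first of length at most
   [I], whence the error terms. *)
Lemma partial_segment I eta x0 x1 x : thin I eta ->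
  consecutive_records eta x0 x1 -> x0 <= x < x1 ->
  exists L : seq (nat * nat), [/\ uniq (map snd L),
    forall i y, (i, y) \in L <-> has_soliton eta i y /\ x0 < y <= x &
    forall l (A := picks l 0 (bits (segment eta x0 x.+1)))
             (B := \sum_(p <- L) minn l p.1),
      [/\ A <= B + I * I, B <= A + I * (I * I) & carrier eta x = 0 -> A = B]].
Proof.
move=> hth hc hx; have [hb hl] := segment_ballot hc hx.
have [L1 [u' [hL1 hN1]]] := reduces_total (segment eta x0 x.+1).
set v := [seq (y, eta y) | y <- iota x.+1 (x1 - x.+1)].
have [L2 [w' [hL2 hN2]]] := reduces_total (u' ++ v).
have hL := reduces_cat (reduces_prefix v hL1) hL2.
rewrite -segment_cat // in hL.
have hsol := solitons_reduces hL hN2.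
have hu : uniq (map fst (segment eta x0 x1)) by rewrite sites_segment iota_uniq.
have hu1 : uniq (map fst (segment eta x0 x.+1)) by rewrite sites_segment iota_uniq.
have [hU1 hS1] := reduces_sites hL1 hu1.
have [hU hS] := reduces_sites hL hu.
have [hbu hcx hpk] := reduces_ballot hL1 hb; rewrite hl in hcx.
have hu2 : uniq (map fst (segment eta x0 x.+1 ++ v)) by rewrite -segment_cat.
have [hUv _] := reduces_sites (reduces_prefix v hL1) hu2.
have huv : uniq (map fst (u' ++ v)) by move: hUv; rewrite cat_uniq => /and3P[].
have [hU2 hS2] := reduces_sites hL2 huv.
have hsite y : y \in map snd (L1 ++ L2) -> x0 < y < x1.
  by move=> hy; have := hS y; rewrite mem_cat hy sites_segment mem_iota => /(_ isT); slia.
have hsite1 y : y \in map snd L1 ++ map fst u' -> x0 < y <= x.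
  by move=> /hS1; rewrite sites_segment mem_iota; slia.
(* The solitons starting at or before [x]: those completed inside the prefix, and later ones, which
   must start at a surviving site. There are at most [size u'] of the latter, each of size at most
   [I]. *)
set L := L1 ++ [seq p <- L2 | p.2 <= x].
have hLs : subseq L (L1 ++ L2) by rewrite cat_subseq ?filter_subseq.
have h12 p : p \in L1 ++ L2 -> 0 < p.1 <= I.
  by rewrite -hsol; apply: solitons_segment_size.
have hmin l (K : seq (nat * nat)) : {subset K <= L1 ++ L2} -> I <= l ->
    \sum_(p <- K) minn l p.1 = \sum_(p <- K) p.1.
  move=> hK hl'; rewrite big_seq [RHS]big_seq; apply: eq_bigr => p /hK /h12.
  by move: (p.1) => q; slia.
have hL1s : {subset L1 <= L1 ++ L2} by move=> p; rewrite mem_cat => ->.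
have hsize : size u' <= I * I.
  apply: irreducible_size => //.
  have := hth x; rewrite (@word_segment _ x0 x); last by slia.
  move=> /picks_count_cat[_]; have [h0 _ _ _] := hc; rewrite cload_record //.
  set big := I + size (bits (segment eta x0 x.+1)) + size (bits u').
  rewrite -(@picks_big big 0); last by rewrite /big; slia.
  rewrite !hpk !hmin //; last by rewrite /big; slia.
  by rewrite (@picks_big big) => [/addnI|]; rewrite // /big; slia.
have hsize2 : size [seq p <- L2 | p.2 <= x] <= size u'.
  rewrite -(size_map snd) -(size_map fst); apply: uniq_leq_size.
    move: hU2; rewrite cat_uniq => /and3P[+ _ _].
    by apply: subseq_uniq; rewrite map_subseq ?filter_subseq.
  move=> y /mapP[[j z]]; rewrite mem_filter /= => /andP[hpx hp2] ->.
  have : z \in map snd L2 ++ map fst w' by rewrite mem_cat (map_f snd hp2).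
  move=> /hS2; rewrite map_cat mem_cat => /orP[] // .
  by rewrite /v -map_comp map_id mem_iota; slia.
have hpu l : picks l 0 (bits u') <= size u'.
  by apply: leq_trans (picks_le_count _ _ _) _; rewrite (leq_trans (count_size _ _)) // size_map.
have hfil l : \sum_(p <- [seq p <- L2 | p.2 <= x]) minn l p.1 <= I * size u'.
  apply: leq_trans (leq_mul (leqnn I) hsize2); rewrite -sum1_size big_distrr /=.
  rewrite big_seq [leqRHS]big_seq; apply: leq_sum => p.
  rewrite mem_filter => /andP[_ hp]; rewrite muln1.
  have : 0 < p.1 <= I by apply: h12; rewrite mem_cat hp orbT.
  by move: (p.1) => q; slia.
exists L; split.
- apply: subseq_uniq (map_subseq _ hLs) _.
  by move: hU; rewrite cat_uniq => /and3P[].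
- move=> i y; split.
    move=> hin; have hin' := mem_subseq hLs hin.
    have /= hy := hsite _ (map_f snd hin'); split.
      by apply/(has_soliton_segment _ hc); rewrite ?hsol.
    move: hin; rewrite mem_cat mem_filter => /orP[hin|/andP[/= hyx _]]; last by slia.
    by have := hsite1 y; rewrite mem_cat (map_f snd hin) => /(_ isT).
  case=> hin hy; have hy' : x0 < y < x1 by slia.
  move: hin => /(has_soliton_segment _ hc) => /(_ hy'); rewrite hsol.
  by rewrite !mem_cat mem_filter /=; have -> : y <= x by slia.
- move=> l A B; have hA : A = _ := hpk l.
  have hB : B = \sum_(p <- L1) minn l p.1 + \sum_(p <- L2 | p.2 <= x) minn l p.1.
    by rewrite /B big_cat /= big_filter.
  have h1 := hpu l; have := hfil l; rewrite big_filter => h2; split.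
  + by rewrite hA hB; slia.
  + rewrite hA hB; have : I * size u' <= I * (I * I) by rewrite leq_mul.
    slia.
  + move=> hc0; have u0 : u' = [::] by apply: irreducible_balanced; rewrite ?hcx.
    rewrite hA hB u0 /= -[X in _ = _ + X]big_filter; move: hsize2; rewrite u0 leqn0 size_eq0 => /eqP ->.
    by rewrite big_nil.
Qed.

(** Carriers of every capacity are empty at records, so complete excursions add up without error;
    only the excursion containing [x] costs the error of [partial_segment]. *)
Lemma soliton_list_exists I eta x : in_Omega eta -> thin I eta ->
  exists L : seq (nat * nat), [/\ uniq (map snd L),
    forall i y, (i, y) \in L <-> has_soliton eta i y /\ 0 < y <= x &
    forall l (A := picks l 0 (word eta x)) (B := \sum_(p <- L) minn l p.1),
      [/\ A <= B + I * I, B <= A + I * (I * I) & record eta x -> A = B]].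
Proof.
move=> hO hth.
have step x0 x1 y (L0 : seq (nat * nat)) : consecutive_records eta x0 x1 ->
  x0 <= y < x1 ->
  [/\ uniq (map snd L0),
    forall i y, (i, y) \in L0 <-> has_soliton eta i y /\ 0 < y <= x0 &
    forall l, picks l 0 (word eta x0) = \sum_(p <- L0) minn l p.1] ->
  exists L : seq (nat * nat), [/\ uniq (map snd L),
    forall i z, (i, z) \in L <-> has_soliton eta i z /\ 0 < z <= y &
    forall l (A := picks l 0 (word eta y)) (B := \sum_(p <- L) minn l p.1),
      [/\ A <= B + I * I, B <= A + I * (I * I) & carrier eta y = 0 -> A = B]].
  move=> hc hy [hu0 hm0 hs0].
  have [L [hu hm hs]] := partial_segment hth hc hy; have [h0 _ _ _] := hc.
  exists (L0 ++ L); split.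
  - rewrite map_cat cat_uniq hu0 hu andbT; apply/hasPn => z /mapP[[i z'] hin /= ->].
    apply/negP => /mapP[[j z''] hin' /= e].
    by have /hm [_] := hin; have /hm0 [_] := hin'; rewrite e; slia.
  - move=> i z; rewrite mem_cat; split.
      by case/orP => [/hm0|/hm] [? ?]; split=> //; slia.
    case=> hz hz'; case: (leqP z x0) => hzx.
      by apply/orP; left; apply/hm0; split=> //; slia.
    by apply/orP; right; apply/hm; split=> //; slia.
  - have e : word eta y = word eta x0 ++ bits (segment eta x0 y.+1).
      by apply: word_segment; slia.
    move=> l /=; have [h1 h2 h3] := hs l.
    rewrite e picks_cat cload_record // hs0 big_cat /=; split.
    + by rewrite -addnA leq_add2l.
    + by rewrite -addnA leq_add2l.
    + by move=> /h3 ->.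
(* From one record to the next, [step] is applied at the last site before the new record, where the
   carrier is empty and the count exact. *)
have exact_at x0 : record eta x0 -> exists L : seq (nat * nat), [/\ uniq (map snd L),
    forall i y, (i, y) \in L <-> has_soliton eta i y /\ 0 < y <= x0 &
    forall l, picks l 0 (word eta x0) = \sum_(p <- L) minn l p.1].
  move: x0; apply: record_ind.
    by exists [::]; split=> // [i y|l]; [split=> // -[_]; slia | rewrite big_nil].
  move=> x0 x1 hc [L0 hL0]; have [h0 h1 h01 hn] := hc.
  have hy : x0 <= x1.-1 < x1 by slia.
  have [L [hu hm hs]] := step _ _ _ _ hc hy hL0.
  have [x2 hx2] : exists x2, x1 = x2.+1 by exists x1.-1; slia.
  move: hm hs; rewrite hx2 [x2.+1.-1]/= => hm hs.
  have [hb hcar] : ~~ eta x2.+1 /\ carrier eta x2 = 0.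
    by move: h1; rewrite hx2 /record /= => /andP[-> /eqP].
  exists L; split=> // [i y|l].
    rewrite hm; split=> -[hsol hxy]; split=> //; first by slia.
    case: (ltngtP y x2.+1) => [||e]; try slia.
    by have := has_soliton_not_record hsol; rewrite e -hx2 h1.
  have [_ _ /(_ hcar) <-] := hs l.
  by rewrite wordS -cats1 picks_cat (negbTE hb) /= !addn0.
have [x0 [x1 [hc hx]]] := bracketing_records x hO; have [h0 h1 h01 hn] := hc.
have [L0 hL0] := exact_at _ h0.
have [L [hu hm hs]] := step _ _ _ _ hc hx hL0.
exists L; split=> // l /=; have [h2 h3 h4] := hs l; split=> // hr.
by apply: h4; apply: carrier_record.
Qed.

Definition soliton_count eta i x := \sum_(1 <= y < x.+1) `[< has_soliton eta i y >].

Definition soliton_mass I eta l x :=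
  \sum_(j < I) minn l j.+1 * soliton_count eta j.+1 x.

Lemma soliton_count_list eta i x (L : seq (nat * nat)) : uniq (map snd L) ->
  (forall j y, (j, y) \in L <-> has_soliton eta j y /\ 0 < y <= x) ->
  soliton_count eta i x = count (fun p => p.1 == i) L.
Proof.
move=> hu hm; rewrite -size_filter -(size_map snd).
have -> : soliton_count eta i x =
    size [seq y <- iota 1 x | `[< has_soliton eta i y >]].
  by rewrite size_filter -sum1_count /soliton_count /index_iota subn1 [RHS]big_mkcond.
apply: perm_size; apply: uniq_perm; first by rewrite filter_uniq ?iota_uniq.
  by apply: subseq_uniq hu; rewrite map_subseq ?filter_subseq.
move=> y; rewrite mem_filter mem_iota; apply/idP/idP.
  move=> /andP[/asboolP h hy]; apply/mapP; exists (i, y) => //.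
  by rewrite mem_filter /= eqxx; apply/hm; split=> //; slia.
move=> /mapP[[j z]]; rewrite mem_filter /= => /andP[/eqP-> /hm[h hy]] ->.
by apply/andP; split; [apply/asboolP | slia].
Qed.

Lemma soliton_mass_picks I eta l x : in_Omega eta -> thin I eta ->
  soliton_mass I eta l x <= picks l 0 (word eta x) + I * (I * I) /\
  picks l 0 (word eta x) <= soliton_mass I eta l x + I * I.
Proof.
move=> hO hth; have [L [hu hm hs]] := soliton_list_exists x hO hth.
have -> : soliton_mass I eta l x = \sum_(p <- L) minn l p.1.
  have hp (p : nat * nat) : p \in L -> minn l p.1 = \sum_(j < I) minn l j.+1 * (p.1 == j.+1).
    case: p => i y /hm[hsol hy].
    have [x0 [x1 [hc hx]]] := bracketing_records y hO.
    have hy0 : x0 < y < x1.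
      case: (ltngtP x0 y) => [||e]; try slia.
      by have := has_soliton_not_record hsol; have [] := hc; rewrite e => ->.
    move: hsol => /(has_soliton_segment _ hc) => /(_ hy0).
    move=> /(solitons_segment_size hth hc) /= hi.
    have hi' : i.-1 < I by slia.
    rewrite (bigD1 (Ordinal hi')) //= prednK ?eqxx ?muln1 ?big1 ?addn0 //; last by slia.
    move=> j; case: (i =P j.+1) => [e|]; last by rewrite muln0.
    by move=> /eqP []; apply/val_inj; rewrite /= e.
  rewrite big_seq (eq_bigr _ hp) -big_seq exchange_big /=.
  rewrite /soliton_mass; apply: eq_bigr => j _.
  by rewrite -big_distrr /= (soliton_count_list _ hu hm) -sum1_count big_mkcond.
by have [? ? _] := hs l.
Qed.

(** As a function of its first argument, [minn _ j.+1] has second difference [-1] at [j.+1] and [0]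
    at the other positive integers. *)
Lemma soliton_mass_second_difference I eta (i : 'I_I) x :
  2 * soliton_mass I eta i.+1 x =
  soliton_mass I eta i x + soliton_mass I eta i.+2 x + soliton_count eta i.+1 x.
Proof.
rewrite /soliton_mass big_distrr /= [in RHS](bigD1 i) //= [X in _ = _ + X + _](bigD1 i) //=.
rewrite (bigD1 i) //=; have -> : \sum_(j < I | j != i) 2 * (minn i.+1 j.+1 * soliton_count eta j.+1 x)
  = \sum_(j < I | j != i) minn i j.+1 * soliton_count eta j.+1 x +
    \sum_(j < I | j != i) minn i.+2 j.+1 * soliton_count eta j.+1 x.
  rewrite -big_split; apply: eq_bigr => j hj /=; rewrite mulnA -mulnDl; congr (_ * _).
  have : j != i :> nat by [].
  by move: (nat_of_ord i) (nat_of_ord j) => a b; slia.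
have -> : minn i.+1 i.+1 = i.+1 by slia.
have -> : minn i i.+1 = i by slia.
have -> : minn i.+2 i.+1 = i.+1 by slia.
move: (soliton_count _ _ _) => c; rewrite [i.+1 * c]mulSn; move: (i * c) (\sum_(j < I | _) _) (\sum_(j < I | _) _) => a b e; lia.
Qed.

(** A generous bound: the cubic and quadratic terms come from cut excursions, the others from
    carrier contents and end letters. *)
Definition transport_error I := 10 * (I * (I * I)) + 10 * (I * I) + I + 10.

Lemma soliton_count_transport I eta k x x' (i : 'I_I)
  (etak := iter k bbs_step eta) (C := transport_error I) : in_Omega_I I eta ->
  (x + 2 * soliton_mass I eta i.+1 x' + C <=
     x' + 2 * soliton_mass I etak i.+1 x + i.+1 * k ->
   soliton_count etak i.+1 x <= soliton_count eta i.+1 x' + C) /\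
  (x' + 2 * soliton_mass I etak i.+1 x + i.+1 * k + C <=
     x + 2 * soliton_mass I eta i.+1 x' ->
   soliton_count eta i.+1 x' <= soliton_count etak i.+1 x + C).
Proof.
move=> hI; have hth := in_Omega_I_thin hI; case: hI => hO _.
have hthk := thin_iter k hth; have hOk := in_Omega_iter k hO.
pose X := x + x'.
have := soliton_transport (word eta X) i k x x'.
rewrite -word_iter_bbs_step !take_word ?leq_addl ?leq_addr // -/etak.
(* The dictionary at a fixed time: unit solitons of the [i]-th reduced word are soliton counts, and
   its kept letters give the slot coordinate, both up to bounded errors. *)
have hloc e y : in_Omega e -> thin I e ->
    let u := iter i elim10 (word e y) in
    [/\ unit_solitons u <= soliton_count e i.+1 y + 3 * (I * (I * I)) + 3 * (I * I),
        soliton_count e i.+1 y <= unit_solitons u + 2 * (I * (I * I)) + 2 * (I * I) + 1,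
        size (elim10 u) + 2 * soliton_mass I e i.+1 y <= y + i.+1 + 2 * (I * (I * I)) &
        y <= size (elim10 u) + 2 * soliton_mass I e i.+1 y + 2 * (I * I)].
  move=> he hte /=; rewrite -iterS.
  have h1 := picksS i (word e y); have h2 := picksS i.+1 (word e y).
  have h3 := unit_solitons_ascents false false (iter i elim10 (word e y)).
  have h4 := size_iter_elim i.+1 (word e y).
  have := @cload_le i.+1 0 (word e y) isT.
  have [a1 a2] := soliton_mass_picks i y he hte.
  have [b1 b2] := soliton_mass_picks i.+1 y he hte.
  have [c1 c2] := soliton_mass_picks i.+2 y he hte.
  have := soliton_mass_second_difference e i y.
  move: h3 h4; rewrite size_word -/elim10 -iterS; move: h1 h2; rewrite /unit_solitons.
  by split; slia.
have [a1 a2 a3 a4] := hloc _ x hOk hthk; have [b1 b2 b3 b4] := hloc _ x' hO hth.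
move: a1 a2 a3 a4 b1 b2 b3 b4 (ltn_ord i); rewrite -/etak /C /transport_error.
move: (I * I) (I * (I * I)) (i.+1 * k) => I2 I3 ik a1 a2 a3 a4 b1 b2 b3 b4 hi [h1 h2].
by split=> h; [have := h1 | have := h2]; slia.
Qed.

End Configurations.

Local Open Scope classical_set_scope.
Local Open Scope ring_scope.

(** * The linear system of effective velocities *)

Section InteractionSystem.
Context {R : realType} {I : nat}.
Implicit Types (g r x : 'I_I -> R).

Definition interaction (i j : 'I_I) : R := 2 * (minn i.+1 j.+1)%:R.

(** For nonnegative [g] this bounds the sup-norm of the matrix [interaction i j * g j], since
    [minn i.+1 j.+1] is at most [j.+1]. *)
Definition weight g : R := \sum_(j < I) 2 * j.+1%:R * g j.

(** With [g] the ratio of soliton density to slot density, the right side [1] produces the slot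
    densities, and the right side [i.+1] the slot densities times the effective velocities. *)
Definition solves g r x := forall i, x i + \sum_(j < I) interaction i j * g j * x j = r i.

Lemma interaction_ge0 i j : 0 <= interaction i j.
Proof. by rewrite mulr_ge0. Qed.

Lemma interaction_le i j : interaction i j <= 2 * j.+1%:R.
Proof. by rewrite ler_pM2l // ler_nat geq_minr. Qed.

Lemma weight_norm_ge0 g : 0 <= weight (fun j => `|g j|).
Proof. by apply: sumr_ge0 => j _; rewrite !mulr_ge0. Qed.

Lemma le_weight g g' : (forall j, g j <= g' j) -> weight g <= weight g'.
Proof. by move=> h; apply: ler_sum => j _; rewrite ler_pM2l. Qed.

Lemma solves_bound g r x k b : weight (fun j => `|g j|) <= k -> k < 1 ->
  solves g r x -> (forall i, `|r i| <= b) -> forall i, `|x i| <= b / (1 - k).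
Proof.
move=> hw k1 hx hr i.
pose m := \big[Num.max/0]_(j < I) `|x j|.
have hm j : `|x j| <= m by apply: le_bigmax.
have m0 : 0 <= m by apply: le_trans (hm i).
have hstep j : `|x j| <= b + k * m.
  have -> : x j = r j - \sum_(l < I) interaction j l * g l * x l by rewrite -hx addrK.
  apply: le_trans (ler_normB _ _) _; apply: lerD => //.
  apply: le_trans (ler_norm_sum _ _ _) _.
  apply: le_trans (ler_wpM2r m0 hw); rewrite /weight mulr_suml; apply: ler_sum => l _.
  rewrite (normrM _ (x l)) (normrM _ (g l)) (ger0_norm (interaction_ge0 _ _)).
  by apply: ler_pM => //; rewrite ?mulr_ge0 ?interaction_ge0 // ler_wpM2r ?interaction_le.
have b0 : 0 <= b by apply: le_trans (hr i).
have k0 : 0 <= k by apply: le_trans hw; apply: weight_norm_ge0.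
have : m <= b + k * m by apply: bigmax_le => [|j _]; rewrite ?addr_ge0 ?mulr_ge0.
move=> h; rewrite ler_pdivlMr ?subr_gt0 //; have := hm i; nra.
Qed.

Lemma solves_uniq g r x x' : weight (fun j => `|g j|) < 1 ->
  solves g r x -> solves g r x' -> forall i, x i = x' i.
Proof.
move=> hw hx hx' i.
have h : solves g (fun=> 0) (fun i => x i - x' i).
  move=> j; have := hx j; have := hx' j => e e'.
  under eq_bigr do rewrite mulrBr.
  rewrite sumrB; lra.
have := solves_bound (lexx _) hw h (b := 0) _ i; rewrite normr0 => /(_ (fun=> lexx _)).
by rewrite mul0r normr_le0 subr_eq0 => /eqP.
Qed.

Lemma unitmx_ker (n : nat) (A : 'M[R]_n) :
  (forall v : 'cV[R]_n, A *m v = 0 -> v = 0) -> A \in unitmx.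
Proof.
move=> h; rewrite -unitmx_tr -row_free_unit; apply: inj_row_free => v hv.
apply: trmx_inj; rewrite trmx0; apply: h.
by rewrite -[A]trmxK -trmx_mul hv trmx0.
Qed.

Lemma solves_exists g r : weight (fun j => `|g j|) < 1 -> exists x, solves g r x.
Proof.
move=> hw.
pose A : 'M[R]_I := 1%:M + \matrix_(i, j) (interaction i j * g j).
have hA (v : 'cV[R]_I) i : (A *m v) i 0 =
    v i 0 + \sum_(j < I) interaction i j * g j * v j 0.
  rewrite mulmxDl mul1mx mxE; congr (_ + _); rewrite mxE.
  by apply: eq_bigr => j _; rewrite mxE.
have hu : A \in unitmx.
  apply: unitmx_ker => v hv; apply/colP => i; rewrite [RHS]mxE.
  apply: (@solves_uniq g (fun=> 0) (fun i => v i 0) (fun=> 0)) => // j.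
    by rewrite -hA hv mxE.
  by rewrite big1 ?addr0 // => l _; rewrite mulr0.
exists (fun i => (invmx A *m \col_j r j) i 0) => i.
by rewrite -hA mulKVmx // mxE.
Qed.

Definition solution g r : 'I_I -> R :=
  get [set x | solves g r x].

Lemma solutionP g r : weight (fun j => `|g j|) < 1 -> solves g r (solution g r).
Proof. by move=> /(solves_exists r) [x hx]; apply: (@getPex _ [set x | solves g r x]); exists x. Qed.

(* As a function of [n], [reach g a n] is concave with increments [tail g a n]: the
   sign lemmas below are discrete Sturm comparison arguments. *)
Let tail g (a : 'I_I -> R) (n : nat) := \sum_(j < I | (n <= j)%N) 2 * g j * a j.
Let reach g (a : 'I_I -> R) (n : nat) :=
  \sum_(j < I) 2 * (minn n j.+1)%:R * g j * a j.

Let reach0 g a : reach g a 0 = 0.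
Proof. by apply: big1 => j _; rewrite min0n mulr0 !mul0r. Qed.

Let reachS g a n : reach g a n.+1 = reach g a n + tail g a n.
Proof.
rewrite /reach /tail [X in _ + X]big_mkcond -big_split; apply: eq_bigr => j _ /=.
case: leqP => h.
  have -> : minn n.+1 j.+1 = n.+1 by lia.
  have -> : minn n j.+1 = n by lia.
  by rewrite -natr1; ring.
have -> : minn n.+1 j.+1 = j.+1 by lia.
have -> : minn n j.+1 = j.+1 by lia.
by rewrite addr0.
Qed.

Let tailS g a (n : 'I_I) : tail g a n = 2 * g n * a n + tail g a n.+1.
Proof.
rewrite /tail (bigD1 n) //=; congr (_ + _); apply: eq_bigl => j.
by rewrite ltn_neqAle andbC eq_sym.
Qed.

Let tail_end g a : tail g a I = 0.
Proof. by apply: big_pred0 => j; rewrite leqNgt ltn_ord. Qed.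

Lemma solves1_gt0 g a : (forall j, 0 <= g j) -> solves g (fun=> 1) a ->
  (forall i, 0 < a i) /\ 0 < 1 - \sum_(j < I) 2 * j.+1%:R * g j * a j.
Proof.
move=> g0 ha.
pose aa n := 1 - reach g a n.
have aE (i : 'I_I) : aa i.+1 = a i by rewrite /aa -(ha i) /reach addrK.
have aI : aa I = 1 - \sum_(j < I) 2 * j.+1%:R * g j * a j.
  by rewrite /aa; congr (1 - _); apply: eq_bigr => j _; rewrite (minn_idPr _).
have aS n : aa n = aa n.+1 + tail g a n by rewrite /aa reachS; ring.
(* [aa I] is the second quantity claimed positive. Were it nonpositive, the recursion started from
   [tail g a I = 0] would carry the sign down to [aa 0], which is [1]. *)
have pos : 0 < aa I.
  rewrite ltNge; apply/negP => hI.
  have : forall m n, (n + m = I)%N -> aa n <= 0 /\ tail g a n <= 0.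
    elim=> [|m IH] n; first by rewrite addn0 => ->; rewrite tail_end.
    rewrite addnS -addSn => e; have [h1 h2] := IH _ e.
    have hn : (n < I)%N by rewrite -e leq_addr.
    have ht : tail g a n <= 0.
      rewrite (tailS g a (Ordinal hn)) /= -(aE (Ordinal hn)) /=.
      by have := g0 (Ordinal hn); nra.
    by split=> //; rewrite aS; lra.
  by move=> /(_ I 0%N erefl) []; rewrite /aa reach0; lra.
have main : forall m n, (n + m = I)%N -> 0 < aa n /\ 0 <= tail g a n.
  elim=> [|m IH] n; first by rewrite addn0 => ->; rewrite tail_end.
  rewrite addnS -addSn => e; have [h1 h2] := IH _ e.
  have hn : (n < I)%N by rewrite -e leq_addr.
  have ht : 0 <= tail g a n.
    rewrite (tailS g a (Ordinal hn)) /= -(aE (Ordinal hn)) /=.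
    by have := g0 (Ordinal hn); nra.
  by split=> //; rewrite aS; lra.
split=> [i|]; last by rewrite -aI.
have [] := main (I - i.+1)%N i.+1 (subnKC (ltn_ord i)).
by rewrite aE.
Qed.

Lemma solves_index_ge0 g y : (forall j, 0 <= g j) ->
  solves g (fun i => i.+1%:R) y -> forall i, 0 <= y i.
Proof.
move=> g0 hy.
pose yy n := n%:R - reach g y n; pose d n := 1 - tail g y n.
have yE (i : 'I_I) : yy i.+1 = y i by rewrite /yy -(hy i) /reach addrK.
have yS n : yy n.+1 = yy n + d n by rewrite /yy /d reachS -natr1; ring.
have dS (n : 'I_I) : d n.+1 = d n + 2 * g n * yy n.+1.
  by rewrite /d (tailS g y n) yE; ring.
(* Here the recursion runs upwards from [yy 0 = 0]: a nonpositive first increment would stay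
   nonpositive, whereas [d I] is [1]. *)
have d0 : 0 < d 0%N.
  rewrite ltNge; apply/negP => h0.
  have h n : (n <= I)%N -> yy n <= 0 /\ d n <= 0.
    elim: n => [|n IH] hn; first by rewrite {1}/yy reach0 subr0.
    have [h1 h2] := IH (ltnW hn); have h3 : yy n.+1 <= 0 by rewrite yS; lra.
    split=> //; rewrite (dS (Ordinal hn)) /=; have := g0 (Ordinal hn); nra.
  by have [_] := h I (leqnn _); rewrite /d tail_end; lra.
have h n : (n <= I)%N -> 0 <= yy n /\ 0 <= d n.
  elim: n => [|n IH] hn; first by rewrite {1}/yy reach0 subr0 lexx ltW.
  have [h1 h2] := IH (ltnW hn); have h3 : 0 <= yy n.+1 by rewrite yS; lra.
  split=> //; rewrite (dS (Ordinal hn)) /=; have := g0 (Ordinal hn); nra.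
by move=> i; rewrite -yE; have [] := h i.+1 (ltn_ord i).
Qed.

Lemma MmatE (rho : 'I_I -> R) i j : Mmat rho i j =
  if i == j then 1 - \sum_(l < I | l != i) interaction i l * rho l
  else interaction i j * rho j.
Proof. by rewrite mxE. Qed.

(** [Mmat rho] is the diagonal matrix of [a] plus the matrix [interaction i j * rho j]: the term
    absent from the diagonal sum is restored there. In the unknown [a i * v i] it becomes the system
    [solves] for the ratios [rho j / a j]. *)
Lemma veffE (rho y : 'I_I -> R)
  (a := fun i => 1 - \sum_(j < I) interaction i j * rho j) :
  (forall i, 0 < a i) -> weight (fun j => `|rho j / a j|) < 1 ->
  solves (fun j => rho j / a j) (fun i => i.+1%:R) y ->
  forall i, veff rho i = y i / a i.
Proof.
move=> a0 hw hy.
have hM (v : 'cV[R]_I) i : (Mmat rho *m v) i 0 =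
    a i * v i 0 + \sum_(j < I) interaction i j * rho j * v j 0.
  rewrite mxE (bigD1 i) //= MmatE eqxx [in RHS](bigD1 i) //=.
  have -> : a i = 1 - interaction i i * rho i -
       \sum_(j < I | j != i) interaction i j * rho j.
    by rewrite /a (bigD1 i) //=; ring.
  have -> : \sum_(j < I | j != i) Mmat rho i j * v j 0 =
      \sum_(j < I | j != i) interaction i j * rho j * v j 0.
    by apply: eq_bigr => j ji; rewrite MmatE eq_sym (negbTE ji).
  by rewrite /interaction; ring.
have aN0 i : a i != 0 by rewrite gt_eqF.
have hsum (v : 'cV[R]_I) i : \sum_(j < I) interaction i j * rho j * v j 0 =
    \sum_(j < I) interaction i j * (rho j / a j) * (a j * v j 0).
  by apply: eq_bigr => j _; field.
have hu : Mmat rho \in unitmx.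
  apply: unitmx_ker => v hv; apply/colP => i; rewrite [RHS]mxE.
  have : a i * v i 0 = 0.
    apply: (@solves_uniq (fun j => rho j / a j) (fun=> 0) (fun i => a i * v i 0) (fun=> 0)) => // j.
      by rewrite -hsum -hM hv mxE.
    by rewrite big1 ?addr0 // => l _; rewrite mulr0.
  by move/eqP; rewrite mulf_eq0 (negbTE (aN0 i)) => /eqP.
move=> i; rewrite /veff.
have -> : vvec R I = Mmat rho *m \col_j (y j / a j).
  apply/colP => j; rewrite hM !mxE hsum -(hy j); congr (_ + _); first by field.
  by apply: eq_bigr => l _; rewrite mxE; field; rewrite ?aN0.
by rewrite mulKmx // mxE.
Qed.

End InteractionSystem.

(** * Calculus *)

Section Calculus.
Context {R : realType}.
Implicit Types (f g : R -> R) (x l : R).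

Lemma cvg_sumr (T : Type) (F : set_system T) {FF : Filter F} (n : nat)
    (f : 'I_n -> T -> R) (l : 'I_n -> R) :
  (forall i, f i @ F --> l i) ->
  (fun t => \sum_(i < n) f i t) @ F --> \sum_(i < n) l i.
Proof. by move=> h; apply: cvg_big => //; exact: add_continuous. Qed.

Lemma is_deriveP f x l :
  is_derive x 1 f l <-> (fun h => h^-1 * (f (x + h) - f x)) @ 0^' --> l.
Proof.
have e : (fun h : R => h^-1 *: ((f \o shift x) (h *: (1 : R)) - f x)) =
         (fun h => h^-1 * (f (x + h) - f x)).
  by apply/funext => h; rewrite /= /shift /= [_ *: 1]mulr1 (addrC x).
split=> [[h1 h2]|h].
  by move: h1; rewrite /derivable e => /cvg_ex[l' h1]; rewrite -h2 /derive e (cvg_lim _ h1).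
split; first by rewrite /derivable e; apply/cvg_ex; exists l.
by rewrite /derive e; apply: cvg_lim.
Qed.

Lemma is_derive_continuous f x l : is_derive x 1 f l -> {for x, continuous f}.
Proof. by case=> /derivable1_diffP h _; apply: differentiable_continuous. Qed.

Lemma is_derive_eqr f x l l' : is_derive x 1 f l -> l = l' -> is_derive x 1 f l'.
Proof. by move=> h <-. Qed.

Lemma is_derive_uniq f x l l' : is_derive x 1 f l -> is_derive x 1 f l' -> l = l'.
Proof. by move=> [_ <-] [_ <-]. Qed.

Lemma deriveM f g x l l' : is_derive x 1 f l -> is_derive x 1 g l' ->
  is_derive x 1 (fun y => f y * g y) (f x * l' + g x * l).
Proof. by move=> h1 h2; apply: is_deriveM. Qed.

Lemma deriveD f g x l l' : is_derive x 1 f l -> is_derive x 1 g l' ->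
  is_derive x 1 (fun y => f y + g y) (l + l').
Proof. by move=> h1 h2; apply: is_deriveD. Qed.

Lemma deriveB f g x l l' : is_derive x 1 f l -> is_derive x 1 g l' ->
  is_derive x 1 (fun y => f y - g y) (l - l').
Proof. by move=> h1 h2; apply: is_deriveB. Qed.

Lemma deriveC x (c : R) : is_derive x 1 (fun=> c) 0.
Proof. exact: is_derive_cst. Qed.

Lemma deriveI x : is_derive x 1 (fun y : R => y) 1.
Proof. exact: is_derive_id. Qed.

Lemma deriveZ (c : R) f x l : is_derive x 1 f l ->
  is_derive x 1 (fun y => c * f y) (c * l).
Proof.
by move=> h; apply: is_derive_eqr (deriveM (deriveC x c) h) _; rewrite mulr0 addr0.
Qed.

Lemma derive_comp f g x l l' : is_derive (g x) 1 f l -> is_derive x 1 g l' ->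
  is_derive x 1 (fun y => f (g y)) (l * l').
Proof. by move=> h1 h2; apply: is_derive1_comp. Qed.

Lemma derive_sum (n : nat) (f : 'I_n -> R -> R) x (l : 'I_n -> R) :
  (forall i, is_derive x 1 (f i) (l i)) ->
  is_derive x 1 (fun y => \sum_(i < n) f i y) (\sum_(i < n) l i).
Proof.
move=> h; have := is_derive_sum h.
by congr (is_derive _ _ _ _); apply/funext => y; rewrite fct_sumE.
Qed.

Lemma derive_near f g x l : is_derive x 1 f l -> (\forall y \near x, f y = g y) ->
  is_derive x 1 g l.
Proof. by move=> hf hfg; apply: near_eq_is_derive hf; near=> y; rewrite (near hfg y).
Unshelve. all: by end_near. Qed.

Lemma mean_value f (df : R -> R) (a b : R) : a < b ->
  (forall x, a < x < b -> is_derive x 1 f (df x)) ->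
  (forall x, a <= x <= b -> {for x, continuous f}) ->
  exists2 c, a < c < b & f b - f a = df c * (b - a).
Proof.
move=> ab hd hc.
have hd' x : x \in `]a, b[ -> is_derive x 1 f (df x) by rewrite in_itv; exact: hd.
have hc' : {within `[a, b], continuous f}.
  by apply: continuous_in_subspaceT => x; rewrite inE /= in_itv /=; exact: hc.
have [c hcc e] := MVT ab hd' hc'.
by exists c => //; move: hcc; rewrite in_itv.
Qed.

Lemma mean_value_le f (df : R -> R) (a b m : R) : a <= b ->
  (forall x, a < x < b -> is_derive x 1 f (df x)) ->
  (forall x, a <= x <= b -> {for x, continuous f}) ->
  (forall x, a < x < b -> `|df x| <= m) -> `|f b - f a| <= m * (b - a).
Proof.
rewrite le_eqVlt => /orP[/eqP->|ab] hd hc hm.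
  by rewrite !subrr normr0 mulr0.
have [c hcc ->] := mean_value ab hd hc.
by rewrite normrM (gtr0_norm (_ : 0 < b - a)) ?subr_gt0 // ler_wpM2r ?hm // subr_ge0 ltW.
Qed.

Lemma derive_ge0_le f (df : R -> R) (a b : R) : a <= b ->
  (forall x, a < x < b -> is_derive x 1 f (df x)) ->
  (forall x, a <= x <= b -> {for x, continuous f}) ->
  (forall x, a < x < b -> 0 <= df x) -> f a <= f b.
Proof.
rewrite le_eqVlt => /orP[/eqP->//|ab] hd hc hm.
have [c hcc e] := mean_value ab hd hc.
by rewrite -subr_ge0 e mulr_ge0 ?hm // subr_ge0 ltW.
Qed.

Lemma derive_ge0_eq f (df : R -> R) (a b : R) : a <= b ->
  (forall x, a < x < b -> is_derive x 1 f (df x)) ->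
  (forall x, a <= x <= b -> {for x, continuous f}) ->
  (forall x, a < x < b -> df x = 0) -> f a = f b.
Proof.
rewrite le_eqVlt => /orP[/eqP->//|ab] hd hc hm.
have [c hcc e] := mean_value ab hd hc.
by apply/eqP; rewrite -subr_eq0 -oppr_eq0 opprB e hm ?mul0r.
Qed.

(** The difference [x t - x0] solves the system with coefficients [s t] and a right side tending to
    zero. The arbitrary filter lets one statement serve continuity and difference quotients. *)
Lemma solves_cvg (T : Type) (F : set_system T) {FF : Filter F} (I : nat)
    (s x r : T -> 'I_I -> R) (g x0 r0 : 'I_I -> R) :
  (forall j, s^~ j @ F --> g j) -> weight (fun j => `|g j|) < 1 ->
  (forall i, r^~ i @ F --> r0 i) ->
  (\forall t \near F, solves (s t) (r t) (x t)) -> solves g r0 x0 -> forall i, x^~ i @ F --> x0 i.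
Proof.
move=> hs hw hr hx hx0 i.
(* Halfway between the limiting weight and [1], so the weights of [s t] are eventually below [k] and
   the bound [b / (1 - k)] is uniform. *)
pose k := (1 + weight (fun j => `|g j|)) / 2.
have k1 : 0 < 1 - k by rewrite /k; lra.
have hwF : \forall t \near F, weight (fun j => `|s t j|) < k.
  have : (fun t => weight (fun j => `|s t j|)) @ F --> weight (fun j => `|g j|).
    by apply: cvg_sumr => j; apply: cvgM; [apply: cvg_cst | apply: cvg_norm].
  by move=> /cvgr_lt; apply; rewrite /k; lra.
pose B t := \sum_(l < I) `|r t l - r0 l - \sum_(j < I) interaction l j * (s t j - g j) * x0 j|.
have hB : B @ F --> 0.
  rewrite -[X in _ --> X](_ : \sum_(l < I) 0 = 0); last by rewrite big1.
  apply: cvg_sumr => l; apply/norm_cvg0P; rewrite -[X in _ --> X](_ : (r0 l - r0 l) - \sum_(j < I) interaction l j * (g j - g j) * x0 j = 0).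
    apply: cvgB; first by apply: cvgB; [exact: hr | exact: cvg_cst].
    apply: cvg_sumr => j; apply: cvgM; last exact: cvg_cst.
    by apply: cvgM; [exact: cvg_cst | apply: cvgB; [exact: hs | exact: cvg_cst]].
  by rewrite subrr big1 ?subrr // => j _; rewrite subrr mulr0 mul0r.
have hle : \forall t \near F, `|x t i - x0 i| <= B t / (1 - k).
  near=> t.
  have hxt : solves (s t) (r t) (x t) by near: t.
  have hwt : weight (fun j => `|s t j|) < k by near: t.
  have hsol : solves (s t)
     (fun m : 'I_I => r t m - r0 m - \sum_(j < I) interaction m j * (s t j - g j) * x0 j)
     (fun j => x t j - x0 j).
    move=> l /=; rewrite -(hxt l) -(hx0 l).
    have -> : \sum_(j < I) interaction l j * s t j * (x t j - x0 j) =
      \sum_(j < I) interaction l j * s t j * x t j -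
      \sum_(j < I) interaction l j * g j * x0 j -
      \sum_(j < I) interaction l j * (s t j - g j) * x0 j.
      by rewrite -!sumrB; apply: eq_bigr => j _; ring.
    by ring.
  apply: (solves_bound (ltW hwt) _ hsol) => [|l]; first by lra.
  by rewrite /B [leRHS](bigD1 l) //= lerDl sumr_ge0.
apply/cvgrPdist_le => e e0; near=> t.
have h1 : `|x t i - x0 i| <= B t / (1 - k) by near: t.
have h2 : `|0 - B t| <= e * (1 - k).
  near: t; move/cvgrPdist_le : hB; apply; rewrite mulr_gt0 //; lra.
rewrite distrC; apply: le_trans h1 _; rewrite ler_pdivrMr //.
by apply: le_trans h2; rewrite sub0r normrN ler_norm.
Unshelve. all: by end_near. Qed.

(** Difference quotients of [x] solve the system with coefficients [g (t + h)], so that [solves_cvg]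
    identifies their limit. *)
Lemma solves_derive (I : nat) (g x : R -> 'I_I -> R) (r dg dx : 'I_I -> R) t :
  (forall h, solves (g h) r (x h)) -> weight (fun j => `|g t j|) < 1 ->
  (forall j, is_derive t 1 (g^~ j) (dg j)) ->
  solves (g t) (fun i => - \sum_(j < I) interaction i j * dg j * x t j) dx ->
  forall i, is_derive t 1 (x^~ i) (dx i).
Proof.
move=> hx hw hg hdx i; apply/is_deriveP.
apply: (@solves_cvg _ _ _ I (fun h j => g (t + h) j)
  (fun h j => h^-1 * (x (t + h) j - x t j))
  (fun h i => - \sum_(j < I) interaction i j * (h^-1 * (g (t + h) j - g t j)) * x t j)
  (g t) dx (fun i => - \sum_(j < I) interaction i j * dg j * x t j)) => //.
- move=> j; have := is_derive_continuous (hg j) => /= hc.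
  apply: (@cvg_within_filter _ _ _ (nbhs 0)).
  have h0 : (fun h : R => t + h) @ (0 : R) --> t.
    by rewrite -[X in _ --> X]addr0; apply: cvgD; [exact: cvg_cst | exact: cvg_id].
  exact: (cvg_comp _ _ h0 hc).
- move=> l; apply: cvgN; apply: cvg_sumr => j; apply: cvgM; last exact: cvg_cst.
  apply: cvgM; first exact: cvg_cst.
  by move/is_deriveP: (hg j).
- near=> h => l /=.
  have := hx (t + h) l; have := hx t l => e1 e2.
  have -> : \sum_(j < I) interaction l j * g (t + h) j * (h^-1 * (x (t + h) j - x t j))
     = h^-1 * (\sum_(j < I) interaction l j * g (t + h) j * x (t + h) j
      - \sum_(j < I) interaction l j * g t j * x t j)
      - \sum_(j < I) interaction l j * (h^-1 * (g (t + h) j - g t j)) * x t j.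
    rewrite -sumrB mulr_sumr -sumrB; apply: eq_bigr => j _; ring.
  have e3 : x (t + h) l - x t l = - (\sum_(j < I) interaction l j * g (t + h) j * x (t + h) j
      - \sum_(j < I) interaction l j * g t j * x t j) by lra.
  by rewrite e3; ring.
Unshelve. all: by end_near. Qed.

Lemma antiderivative f : continuous f -> (forall u, u <= 0 -> f u = 0) ->
  exists F : R -> R, (forall u : R, is_derive u 1 F (f u)) /\ (forall u, u <= 0 -> F u = 0).
Proof.
move=> fc f0.
(* Starting at [-1] makes every [u >= 0] interior to the domain of integration and changes nothing,
   as [f] vanishes on [[-1, 0]]. *)
pose F (x : R) := (\int[@lebesgue_measure R]_(t in `[(-1)%R, x]) f t)%R.
have F0 u : u <= 0 -> F u = 0.
  move=> hu; rewrite /F (@eq_Rintegral _ _ _ _ _ (cst 0)) => [|x].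
    by rewrite Rintegral_cst ?mul0r.
  by rewrite inE /= in_itv /= => /andP[_ hx]; rewrite f0 // (le_trans hx).
exists F; split=> // u; have [hu|hu] := ltP u 0; last first.
  have hint : (@lebesgue_measure R).-integrable `[(-1)%R, u + 1] (EFin \o f).
    by apply: continuous_compact_integrable; [exact: segment_compact | exact: continuous_subspaceT].
  have [||h1 h2] := continuous_FTC1_closed _ hint _ (fc u); try lra.
  by split=> //; rewrite -derive1E h2.
rewrite f0 ?ltW //; apply: derive_near (deriveC u 0) _.
by move: (lt_nbhsl hu); apply: filterS => y /ltW /F0 ->.
Qed.

Lemma leb_int_RplusE f (h F : R -> R) (K : R) : 0 < K ->
  (forall u, 0 <= u <= K -> f u = h u) -> (forall u, K < u -> f u = 0) ->
  continuous h -> (forall u : R, is_derive u 1 F (h u)) ->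
  leb_int_Rplus f = F K - F 0.
Proof.
move=> K0 hfh hf0 hc hF.
have e : (\int[@lebesgue_measure R]_(x in `[0%R, K]) (h x)%:E = (F K)%:E - (F 0)%:E)%E.
  apply: continuous_FTC2 => //; first exact: continuous_subspaceT.
    split; first by move=> x _; case: (hF x).
      by apply: cvg_at_right_filter; apply: is_derive_continuous.
    by apply: cvg_at_left_filter; apply: is_derive_continuous.
  by move=> x _; rewrite derive1E; case: (hF x).
rewrite /leb_int_Rplus.
transitivity (\int[@lebesgue_measure R]_(u in [set u : R | (0 <= u)%R]) (h \_ `[0%R, K]) u)%R.
  apply: eq_Rintegral => u; rewrite inE /= => u0; rewrite patchE.
  case: ifPn; rewrite ?inE ?notin_setE /= in_itv /= => hu; first by rewrite hfh.
  by rewrite hf0 // ltNge; apply/negP => huK; apply: hu; rewrite u0.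
rewrite -Rintegral_mkcondr.
have -> : [set u : R | 0 <= u] `&` `[0%R, K] = `[0%R, K]%classic.
  by apply/seteqP; split=> [u [_ //]|u /= ]; rewrite in_itv /= => /andP[h1 h2]; rewrite h1.
by rewrite /Rintegral e.
Qed.

(** Continuity gives product neighbourhoods of the points [(u, t)]; by compactness of [[0, U]] one
    neighbourhood of [t] serves all of them. *)
Lemma uniform_in_time (f : R -> R -> R) (U t e : R) :
  continuous (fun p : R * R => f p.1 p.2) -> 0 < e ->
  \forall s \near t, forall u, 0 <= u <= U -> `|f u s - f u t| < e.
Proof.
move=> fc e0.
have := @segment_compact R 0 U; rewrite compact_near_coveringP.
move=> /(_ R (nbhs t) (fun s u => `|f u s - f u t| < e)) H.
have : \forall s \near t, `[0%R, U] `<=` (fun u => `|f u s - f u t| < e).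
  apply: H => u _.
  have h2 : 0 < e / 2 by rewrite divr_gt0.
  have /cvgrPdist_lt /(_ _ h2) := fc (u, t).
  case=> -[A B] /= [hA hB] hAB.
  exists (A, B) => // -[u' s] /= [hu' hs].
  have h3 := hAB (u', s) (conj hu' hs).
  have h4 := hAB (u', t) (conj hu' (nbhs_singleton hB)).
  rewrite /= in h3 h4.
  rewrite (_ : f u' s - f u' t = (f u t - f u' t) - (f u t - f u' s)); last by ring.
  by rewrite (le_lt_trans (ler_normB _ _)) // (splitr e) ltrD.
by apply: filterS => s hs u hu; apply: hs; rewrite /= in_itv.
Qed.

(* Turns continuity on the closed quadrant into continuity on the plane. *)
Definition clamp (f : R -> R -> R) (u t : R) := f (Num.max u 0) (Num.max t 0).

Lemma clampE (f : R -> R -> R) (u t : R) : 0 <= u -> 0 <= t -> clamp f u t = f u t.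
Proof. by move=> hu ht; rewrite /clamp !max_l. Qed.

Lemma max0_continuous : continuous (fun u : R => Num.max u 0).
Proof. by move=> x; apply: continuous_max; [exact: cvg_id | exact: cvg_cst]. Qed.

Lemma clamp_continuous (f : R -> R -> R) :
  {within @quadrant R, continuous (fun p => f p.1 p.2)} ->
  continuous (fun p : R * R => clamp f p.1 p.2).
Proof.
move=> hf [u t].
pose c (p : R * R) := (Num.max p.1 0, Num.max p.2 0).
have hc q : quadrant (c q) by rewrite /quadrant /= !le_max !lexx !orbT.
have cc : c @ (u, t) --> c (u, t).
  have h1 : {for (u, t), continuous ((fun a : R => Num.max a 0) \o @fst R R)}.
    by apply: continuous_comp; [exact: cvg_fst | exact: max0_continuous].
  have h2 : {for (u, t), continuous ((fun a : R => Num.max a 0) \o @snd R R)}.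
    by apply: continuous_comp; [exact: cvg_snd | exact: max0_continuous].
  exact: cvg_pair h1 h2.
have hw : c @ (u, t) --> within (@quadrant R) (nbhs (c (u, t))).
  move=> A hA; have h1 := cc [set q | quadrant q -> A q] hA.
  by apply: (@filterS _ (nbhs (u, t)) _ _ (c @^-1` A) _ h1) => q h; exact: h (hc q).
have := @subspace_continuousP _ (@quadrant R) _ (fun p : R * R => f p.1 p.2).
move=> [/(_ hf) /(_ _ (hc (u, t))) hf' _].
exact: (cvg_comp _ _ hw hf').
Qed.

End Calculus.

(** * The fixed point equation *)

Section FixedPoint.
Context {R : realType} {I : nat}.
Implicit Types (G g dg : 'I_I -> R -> R) (gam y z : 'I_I -> R).

(** What the construction of the solution uses: [G] is the initial cumulative density in slot
    coordinates, [g] and [dg] its derivatives. [profile_weight] makes the fixed point equation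
    contract, and [profile_neg] keeps the half line left of the origin empty. *)
Record profile G g dg gam : Prop := Profile {
  profile_derive : forall i (z : R), is_derive z 1 (G i) (g i z);
  profile_derive2 : forall i (z : R), is_derive z 1 (g i) (dg i z);
  profile_continuous : forall i, continuous (dg i);
  profile_bound : forall i (z : R), 0 <= g i z <= gam i;
  profile_weight : weight gam < 1;
  profile_neg : forall i (z : R), z <= 0 -> G i z = 0 /\ g i z = 0 }.

Context {G g dg : 'I_I -> R -> R} {gam : 'I_I -> R} (HG : profile G g dg gam).

(* With difference quotients in place of derivatives, increments of the nonlinear
   equation solve the linear system. *)
Definition slope (j : 'I_I) (z z' : R) : R := if z' == z then g j z else (G j z' - G j z) / (z' - z).

Lemma slopeP j (z z' : R) : G j z' - G j z = slope j z z' * (z' - z).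
Proof.
rewrite /slope; case: eqP => [->|/eqP h]; first by rewrite !subrr mulr0.
by rewrite divfK // subr_eq0.
Qed.

Lemma slope_bound j (z z' : R) : 0 <= slope j z z' <= gam j.
Proof.
rewrite /slope; case: eqP => [_|/eqP h]; first exact: profile_bound HG _ _.
have main a b : a < b -> 0 <= (G j b - G j a) / (b - a) <= gam j.
  move=> ab; have [||c _ ->] := @mean_value R (G j) (g j) a b ab.
  - by move=> x _; exact: profile_derive HG _ _.
  - by move=> x _; exact: is_derive_continuous (profile_derive HG j x).
  by rewrite mulfK ?subr_eq0 ?gt_eqF //; exact: profile_bound HG _ _.
case: (ltrP z z') => h1; first exact: main.
rewrite -[_ / _]divrNN !opprB; apply: main; rewrite lt_neqAle h1 h //.
Qed.

Lemma slope_cvg j (z : R) : slope j z z' @[z' --> z] --> g j z.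
Proof.
have /is_deriveP hd := profile_derive HG j z.
apply/cvgrPdist_le => e e0; move/cvgrPdist_le : hd => /(_ e e0).
rewrite /dnbhs /within /= => -[d /= d0 hd]; exists d => //= z' hz'.
rewrite /slope; case: eqP => [_|/eqP hz]; first by rewrite subrr normr0 ltW.
have := hd (z' - z); rewrite /= sub0r normrN => /(_ _ _).
have -> : z + (z' - z) = z' by ring.
rewrite mulrC; apply; rewrite ?subr_eq0 // distrC //.
Qed.

Lemma gam_weight_norm s : (forall j, 0 <= s j <= gam j) -> weight (fun j => `|s j|) <= weight gam.
Proof. by move=> h; apply: le_weight => j; have /andP[h1 h2] := h j; rewrite ger0_norm. Qed.

Lemma gam_ge0 j : 0 <= gam j.
Proof. by have /andP[h1 h2] := profile_bound HG j 0; exact: le_trans h2. Qed.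

(** The fixed point equation with the slot coordinates [z] as unknowns instead of the cumulative
    densities [G j (z j)]. *)
Definition equilibrium y z := forall i, z i + \sum_(j < I) interaction i j * G j (z j) = y i.

Lemma equilibrium_diff y z y' z' : equilibrium y z -> equilibrium y' z' ->
  solves (fun j => slope j (z j) (z' j)) (fun i => y' i - y i) (fun i => z' i - z i).
Proof.
move=> h h' i; rewrite /= -(h i) -(h' i).
have -> : \sum_(j < I) interaction i j * slope j (z j) (z' j) * (z' j - z j) =
  \sum_(j < I) interaction i j * G j (z' j) - \sum_(j < I) interaction i j * G j (z j).
  by rewrite -sumrB; apply: eq_bigr => j _; rewrite -mulrBr slopeP mulrA.
ring.
Qed.

Lemma equilibrium_lipschitz y z y' z' b : equilibrium y z -> equilibrium y' z' ->
  (forall i, `|y' i - y i| <= b) -> forall i, `|z' i - z i| <= b / (1 - weight gam).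
Proof.
move=> h h' hb; apply: (solves_bound _ (profile_weight HG) (equilibrium_diff h h') hb).
by apply: gam_weight_norm => j; exact: slope_bound.
Qed.

Lemma equilibrium_uniq y z z' : equilibrium y z -> equilibrium y z' -> z = z'.
Proof.
move=> h h'; apply/funext => i.
have := equilibrium_lipschitz h h' (b := 0) _ i; rewrite mul0r normr_le0 => H.
by apply/esym/eqP; rewrite -subr_eq0; apply: H => j; rewrite subrr normr0.
Qed.

(** Picard iteration: [Phi] contracts the sup norm by [weight gam], as the slopes of [G j] lie
    between [0] and [gam j]. *)
Lemma equilibrium_exists y : exists z, equilibrium y z.
Proof.
pose Phi (z : 'I_I -> R) i := y i - \sum_(j < I) interaction i j * G j (z j).
pose Z n := iter n Phi (fun=> 0).
pose k := weight gam.
have k0 : 0 <= k by apply: sumr_ge0 => j _; rewrite !mulr_ge0 ?gam_ge0.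
have k1 : k < 1 := profile_weight HG.
pose M := \big[Num.max/0]_(i < I) `|Z 1%N i - Z 0%N i|.
have M0 : 0 <= M by apply: bigmax_ge_id.
have hstep n i : `|Z n.+1 i - Z n i| <= M * k ^+ n.
  elim: n i => [|n IH] i; first by rewrite expr0 mulr1; apply: (le_bigmax _ (fun i => `|Z 1%N i - Z 0%N i|)).
  rewrite [Z n.+2]/= [Z n.+1 in X in _ - X]/= /Phi opprB addrC addrA subrK -sumrB.
  apply: le_trans (ler_norm_sum _ _ _) _.
  rewrite exprSr mulrA [leRHS]mulrC /k /weight mulr_suml; apply: ler_sum => j _.
  rewrite -mulrBr slopeP (normrM (interaction i j)) (ger0_norm (interaction_ge0 _ _)) normrM.
  have /andP[s0 s1] := slope_bound j (Z n.+1 j) (Z n j).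
  rewrite (ger0_norm s0) -[2 * _ * _ * _]mulrA.
  rewrite distrC; apply: ler_pM; rewrite ?interaction_ge0 ?mulr_ge0 ?interaction_le //.
  by apply: ler_pM => //; exact: IH.
have hc i : cvgn (fun n => Z n i).
  have hs : cvgn (series (fun n => Z n.+1 i - Z n i)).
    apply: normed_cvg; apply: (@series_le_cvg _ _ (geometric M k)) => [n|n|n|].
    - exact: normr_ge0.
    - by rewrite /geometric /= mulr_ge0 ?exprn_ge0.
    - exact: hstep.
    - by apply: is_cvg_geometric_series; rewrite ger0_norm.
  have e : (fun n => Z n i) = (fun n => series (fun n => Z n.+1 i - Z n i) n + Z 0%N i).
    by apply/funext => n; rewrite /series /= telescope_sumr // subrK.
  by rewrite e; apply: is_cvgD => //; exact: is_cvg_cst.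
exists (fun i => limn (fun n => Z n i)) => i.
have h1 : (fun n => Z n.+1 i) @ \oo --> y i - \sum_(j < I) interaction i j * G j (limn (fun n => Z n j)).
  apply: cvgB; first exact: cvg_cst.
  apply: cvg_sumr => j; apply: cvgM; first exact: cvg_cst.
  apply: (cvg_comp _ _ (hc j)).
  exact: is_derive_continuous (profile_derive HG j _).
have h2 : (fun n => Z n.+1 i) @ \oo --> limn (fun n => Z n i).
  by have := hc i; rewrite -(@cvg_shiftS _ (fun n => Z n i)).
have -> : limn (fun n => Z n i) = y i - \sum_(j < I) interaction i j * G j (limn (fun n => Z n j)).
  exact: (cvg_unique _ h2 h1).
ring.
Qed.

(** Difference quotients solve the linear system with slopes as coefficients. The slopes tend to
    [g], because [Z] is Lipschitz, and [solves_cvg] concludes. *)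
Lemma equilibrium_derive (Z : R -> 'I_I -> R) (y d : 'I_I -> R) (h : R) i :
  (forall h, equilibrium (fun i => y i + h * d i) (Z h)) ->
  is_derive h 1 (Z^~ i) (solution (fun j => g j (Z h j)) d i).
Proof.
move=> hZ; apply/is_deriveP.
have hw : weight (fun j => `|g j (Z h j)|) < 1.
  apply: le_lt_trans (profile_weight HG).
  by apply: gam_weight_norm => j; exact: profile_bound HG _ _.
have Zc j : (fun e => Z (h + e) j) @ (0 : R) --> Z h j.
  pose D := \big[Num.max/0]_(i < I) `|d i|.
  have hle e : `|Z h j - Z (h + e) j| <= `|e| * D / (1 - weight gam).
    rewrite distrC; apply: (equilibrium_lipschitz (hZ h) (hZ (h + e))) => l.
    rewrite (_ : _ - _ = e * d l); last by ring.
    by rewrite normrM ler_wpM2l //; apply: (le_bigmax _ (fun i => `|d i|)).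
  have hlim : (fun e : R => `|e| * D / (1 - weight gam)) @ (0 : R) --> 0.
    have e0 : `|0 : R| * D / (1 - weight gam) = 0 by rewrite normr0 !mul0r.
    rewrite -[X in _ --> X]e0; apply: cvgM; last exact: cvg_cst.
    by apply: cvgM; [apply: cvg_norm; exact: cvg_id | exact: cvg_cst].
  apply/cvgrPdist_le => e e0; move/cvgrPdist_le : hlim => /(_ e e0); apply: filterS => x.
  by rewrite sub0r normrN => hx; apply: le_trans (hle x) (le_trans (ler_norm _) hx).
apply: (@solves_cvg _ _ _ _ I (fun e j => slope j (Z h j) (Z (h + e) j))
  (fun e j => e^-1 * (Z (h + e) j - Z h j)) (fun e i => d i) _ _ d) => //.
- move=> j; apply: (@cvg_within_filter _ _ _ (nbhs 0)).
  exact: (cvg_comp _ _ (Zc j) (@slope_cvg j (Z h j))).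
- exact: hw.
- by move=> l; exact: cvg_cst.
- have : \forall e \near (0 : R)^', e != 0 by exact: nbhs_dnbhs_neq.
  apply: filterS => e e0 l /=.
  have := equilibrium_diff (hZ h) (hZ (h + e)) l => /=.
  rewrite (_ : y l + _ - _ = e * d l); last by ring.
  move=> /(congr1 (fun x => e^-1 * x)); rewrite mulKf // mulrDr mulr_sumr => <-.
  by congr (_ + _); apply: eq_bigr => j _; ring.
- exact: solutionP.
Qed.

End FixedPoint.

(** * Existence of the hydrodynamic solution *)

Section HydrodynamicSolution.
Context {R : realType} {I : nat}.
Context {G g dg : 'I_I -> R -> R} {gam : 'I_I -> R} (HG : profile G g dg gam).
Implicit Types (i j : 'I_I) (u t : R) (r : 'I_I -> R).

(** The initial slot coordinate transported to [(u, t)]: the cumulative density there is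
    [G i (front u t i)]. *)
Definition front u t : 'I_I -> R :=
  get [set z | @equilibrium R I G (fun i => u - i.+1%:R * t) z].

Lemma frontP u t : @equilibrium R I G (fun i => u - i.+1%:R * t) (front u t).
Proof.
have [z hz] := equilibrium_exists HG (fun i : 'I_I => u - i.+1%:R * t).
by apply: (@getPex _ [set z | @equilibrium R I G (fun i => u - i.+1%:R * t) z]); exists z.
Qed.

Lemma front_weight u t : weight (fun j => `|g j (front u t j)|) < 1.
Proof.
apply: le_lt_trans (profile_weight HG); apply: gam_weight_norm => j.
exact: profile_bound HG _ _.
Qed.

(** The derivative of [front] when the right side of its equation moves in direction [r]. In
    direction [unit_drift] it is also the slot density, see [density_slots]. *)
Definition response r u t : 'I_I -> R := solution (fun j => g j (front u t j)) r.

Lemma responseP r u t : solves (fun j => g j (front u t j)) r (response r u t).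
Proof. exact: solutionP (front_weight u t). Qed.

Definition unit_drift : 'I_I -> R := fun=> 1.
Definition time_drift : 'I_I -> R := fun i => - i.+1%:R.

Lemma front_du i u t :
  is_derive u 1 (fun v => front v t i) (response unit_drift u t i).
Proof.
apply: (@equilibrium_derive R I G g dg gam HG (fun v => front v t)
  (fun i => - i.+1%:R * t) unit_drift u i) => v.
have := frontP v t; congr (equilibrium _ _); apply/funext => j.
rewrite /unit_drift; ring.
Qed.

Lemma front_dt i u t :
  is_derive t 1 (fun s => front u s i) (response time_drift u t i).
Proof.
apply: (@equilibrium_derive R I G g dg gam HG (fun s => front u s)
  (fun=> u) time_drift t i) => s.
have := frontP u s; congr (equilibrium _ _); apply/funext => j.
rewrite /time_drift; ring.
Qed.

(** The source term obtained by differentiating the coefficients of the system for [response r'] in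
    direction [r]; it is symmetric in the two directions. *)
Definition cross r r' u t : 'I_I -> R := fun i =>
  - \sum_(j < I) interaction i j * (dg j (front u t j) * response r u t j) * response r' u t j.

Lemma response_du r i u t :
  is_derive u 1 (fun v => response r v t i) (response (cross unit_drift r u t) u t i).
Proof.
apply: (@solves_derive R I (fun v j => g j (front v t j)) (fun v => response r v t) r
   (fun j => dg j (front u t j) * response unit_drift u t j)).
- by move=> v; exact: responseP.
- exact: front_weight.
- by move=> j; apply: derive_comp (front_du j u t); exact: profile_derive2 HG _ _.
- exact: responseP.
Qed.

Lemma response_dt r i u t :
  is_derive t 1 (fun s => response r u s i) (response (cross time_drift r u t) u t i).
Proof.
apply: (@solves_derive R I (fun s j => g j (front u s j)) (fun s => response r u s) r
   (fun j => dg j (front u t j) * response time_drift u t j)).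
- by move=> v; exact: responseP.
- exact: front_weight.
- by move=> j; apply: derive_comp (front_dt j u t); exact: profile_derive2 HG _ _.
- exact: responseP.
Qed.

(** The derivative of the cumulative density: in direction [unit_drift] the density, in direction
    [time_drift] minus the flux. *)
Definition flow r i u t := g i (front u t i) * response r u t i.

Definition flow_du r i u t :=
  g i (front u t i) * response (cross unit_drift r u t) u t i +
  response r u t i * (dg i (front u t i) * response unit_drift u t i).

Definition flow_dt r i u t :=
  g i (front u t i) * response (cross time_drift r u t) u t i +
  response r u t i * (dg i (front u t i) * response time_drift u t i).

Lemma flow_duP r i u t : is_derive u 1 (fun v => flow r i v t) (flow_du r i u t).
Proof.
apply: deriveM; last exact: response_du.
by apply: derive_comp (front_du i u t); exact: profile_derive2 HG _ _.
Qed.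

Lemma flow_dtP r i u t : is_derive t 1 (fun s => flow r i u s) (flow_dt r i u t).
Proof.
apply: deriveM; last exact: response_dt.
by apply: derive_comp (front_dt i u t); exact: profile_derive2 HG _ _.
Qed.

(** Equality of the mixed second derivatives of the cumulative density, which is the conservation
    law once the flux is identified. *)
Lemma flow_mixed i u t : flow_du time_drift i u t = flow_dt unit_drift i u t.
Proof.
rewrite /flow_du /flow_dt; congr (_ * response _ _ _ _ + _); last by ring.
by apply/funext => j; rewrite /cross; congr (- _); apply: eq_bigr => l _; ring.
Qed.

Lemma front_continuous i : continuous (fun p : R * R => front p.1 p.2 i).
Proof.
move=> [u t].
pose B (p : R * R) := (`|p.1 - u| + I%:R * `|p.2 - t|) / (1 - weight gam).
have hle p : `|front u t i - front p.1 p.2 i| <= B p.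
  rewrite distrC; apply: (equilibrium_lipschitz HG (frontP u t) (frontP p.1 p.2)) => j.
  rewrite (_ : _ - _ = (p.1 - u) - j.+1%:R * (p.2 - t)); last by ring.
  apply: le_trans (ler_normB _ _) _; rewrite lerD2l normrM ger0_norm //.
  by rewrite ler_wpM2r // ler_nat.
have hB : B @ (u, t) --> 0.
  have e : (`|u - u| + I%:R * `|t - t|) / (1 - weight gam) = 0.
    by rewrite !subrr normr0 mulr0 addr0 mul0r.
  rewrite -[X in _ --> X]e; apply: cvgM; last exact: cvg_cst.
  apply: cvgD; first by apply: cvg_norm; apply: cvgB; [exact: cvg_fst | exact: cvg_cst].
  apply: cvgM; first exact: cvg_cst.
  by apply: cvg_norm; apply: cvgB; [exact: cvg_snd | exact: cvg_cst].
apply/cvgrPdist_le => e e0; move/cvgrPdist_le : hB => /(_ e e0); apply: filterS => p.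
by rewrite sub0r normrN => hp; apply: le_trans (hle p) (le_trans (ler_norm _) hp).
Qed.

Lemma comp_front_continuous (f : 'I_I -> R -> R) i :
  continuous (f i) -> continuous (fun p : R * R => f i (front p.1 p.2 i)).
Proof.
by move=> fc p; exact: (cvg_comp _ _ (@front_continuous i p) (fc _)).
Qed.

Lemma g_continuous i : continuous (g i).
Proof. by move=> z; exact: is_derive_continuous (profile_derive2 HG i z). Qed.

Lemma response_continuous (r : R * R -> 'I_I -> R) i :
  (forall j, continuous (r ^~ j)) ->
  continuous (fun p : R * R => response (r p) p.1 p.2 i).
Proof.
move=> rc p.
apply: (@solves_cvg R _ (nbhs p) _ I (fun q j => g j (front q.1 q.2 j))
  (fun q => response (r q) q.1 q.2) r (fun j => g j (front p.1 p.2 j))).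
- by move=> j; exact: (comp_front_continuous (f := g) (@g_continuous j)).
- exact: front_weight.
- by move=> j; exact: rc.
- by apply: nearW => q; exact: responseP.
- exact: responseP.
Qed.

Lemma cst_continuous (c : R) : continuous (fun _ : R * R => c).
Proof. by move=> p; exact: cvg_cst. Qed.

Lemma cross_continuous r r' j : continuous (fun p : R * R => cross r r' p.1 p.2 j).
Proof.
move=> p; apply: cvgN; apply: cvg_sumr => l; apply: cvgM; last first.
  by apply: (@response_continuous (fun=> r') l) => m; exact: cst_continuous.
apply: cvgM; first exact: cvg_cst.
apply: cvgM; last by apply: (@response_continuous (fun=> r) l) => m; exact: cst_continuous.
by apply: comp_front_continuous; exact: profile_continuous HG _.
Qed.

Lemma flow_continuous r i : continuous (fun p : R * R => flow r i p.1 p.2).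
Proof.
move=> p; apply: cvgM; first exact: (comp_front_continuous (f := g) (@g_continuous i)).
by apply: (@response_continuous (fun=> r) i) => m; exact: cst_continuous.
Qed.

Lemma flow_derive_continuous r r' i : continuous (fun p : R * R =>
  g i (front p.1 p.2 i) * response (cross r r' p.1 p.2) p.1 p.2 i +
  response r' p.1 p.2 i * (dg i (front p.1 p.2 i) * response r p.1 p.2 i)).
Proof.
move=> p; apply: cvgD; apply: cvgM.
- exact: (comp_front_continuous (f := g) (@g_continuous i)).
- apply: (@response_continuous (fun p => cross r r' p.1 p.2) i) => j.
  exact: cross_continuous.
- by apply: (@response_continuous (fun=> r') i) => m; exact: cst_continuous.
- apply: cvgM; last by apply: (@response_continuous (fun=> r) i) => m; exact: cst_continuous.
  by apply: comp_front_continuous; exact: profile_continuous HG _.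
Qed.

Definition density := flow unit_drift.

Lemma front_neg u t i : u <= 0 -> 0 <= t -> front u t i = u - i.+1%:R * t.
Proof.
move=> u0 t0; have hneg l : u - l.+1%:R * t <= 0.
  by rewrite subr_le0 (le_trans u0) ?mulr_ge0.
have hz : @equilibrium R I G (fun i => u - i.+1%:R * t) (fun i => u - i.+1%:R * t).
  move=> j; rewrite big1 ?addr0 // => l _.
  by have [-> _] := profile_neg HG l (hneg l); rewrite mulr0.
by rewrite (equilibrium_uniq HG (frontP u t) hz).
Qed.

Lemma density_neg u t i : u <= 0 -> 0 <= t -> density i u t = 0.
Proof.
move=> u0 t0; rewrite /density /flow front_neg //.
have hneg : u - i.+1%:R * t <= 0 by rewrite subr_le0 (le_trans u0) ?mulr_ge0.
by have [_ ->] := profile_neg HG i hneg; rewrite mul0r.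
Qed.

Lemma density_slots i u t :
  1 - \sum_(j < I) interaction i j * density j u t = response unit_drift u t i.
Proof.
have := responseP unit_drift u t i; rewrite {2}/unit_drift => e.
rewrite -[X in X - _]e /density /flow.
by under eq_bigr do rewrite -mulrA; rewrite addrK.
Qed.

Lemma response_unit_gt0 u t : (forall i, 0 < response unit_drift u t i) /\
  0 < 1 - \sum_(j < I) 2 * j.+1%:R * density j u t.
Proof.
have g0 j : 0 <= g j (front u t j) by have /andP[] := profile_bound HG j (front u t j).
have [h1 h2] := solves1_gt0 g0 (responseP unit_drift u t); split=> //.
by move: h2; rewrite /density /flow; under eq_bigr do rewrite -mulrA.
Qed.

(** The ratio in the second condition of [D_density] is a value of the initial [g], hence bounded by
    [gam i] at all times: the class is preserved. *)
Lemma density_ratio i u t :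
  density i u t / (1 - \sum_(j < I) interaction i j * density j u t) = g i (front u t i).
Proof.
rewrite density_slots /density /flow mulfK //.
by have [/(_ i) h _] := response_unit_gt0 u t; rewrite gt_eqF.
Qed.

Lemma density_ge0 i u t : 0 <= density i u t.
Proof.
rewrite mulr_ge0 //; first by have /andP[] := profile_bound HG i (front u t i).
by have [/(_ i) /ltW] := response_unit_gt0 u t.
Qed.

(** [- response time_drift] solves the system with right side [i.+1], so [veffE] recognises it as
    slot density times effective velocity. *)
Lemma veff_density i u t :
  veff (fun j => density j u t) i * density i u t = - flow time_drift i u t.
Proof.
have [a0 _] := response_unit_gt0 u t.
have ratio j := density_ratio j u t.
rewrite (@veffE R I (fun j => density j u t) (fun j => - response time_drift u t j)).
- rewrite density_slots /density /flow.
  by have := a0 i; rewrite lt0r => /andP[ai _]; field.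
- by move=> j; rewrite density_slots.
- under eq_fun do rewrite ratio; exact: front_weight.
- move=> j; under eq_bigr do rewrite ratio.
  have := responseP time_drift u t j; rewrite /time_drift => e.
  rewrite -[RHS]opprK -e opprD; congr (_ + _); rewrite -sumrN.
  by apply: eq_bigr => l _; rewrite mulrN.
Qed.

Lemma quotient_is_derive (f : R -> R) (v l : R) : is_derive v 1 f l ->
  (fun h => h^-1 * (f (v + h) - f v))
    @ within [set h : R | h != 0 /\ 0 <= v + h] (nbhs (0 : R)) --> l.
Proof.
move=> /is_deriveP h; apply: cvg_trans h; apply: cvg_app => A hA.
have {}hA : nbhs (0 : R) [set h | h != 0 -> A h] by [].
suff : nbhs (0 : R) [set h | h != 0 /\ 0 <= v + h -> A h] by [].
by apply: filterS hA => x /= hx [x0 _]; exact: hx.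
Qed.

Lemma is_derive_quotient (f : R -> R) (v l : R) : 0 < v ->
  (fun h => h^-1 * (f (v + h) - f v))
    @ within [set h : R | h != 0 /\ 0 <= v + h] (nbhs (0 : R)) --> l ->
  is_derive v 1 f l.
Proof.
move=> v0 h; apply/is_deriveP; apply: cvg_trans h; apply: cvg_app => A hA.
have {}hA : nbhs (0 : R) [set h | h != 0 /\ 0 <= v + h -> A h] by [].
suff : nbhs (0 : R) [set h | h != 0 -> A h] by [].
have hv : \forall h \near (0 : R), 0 <= v + h.
  have : - v < 0 by rewrite oppr_lt0.
  by move=> /lt_nbhsr; apply: filterS => h; lra.
by apply: filterS2 hA hv => h /= h1 h2 h3; exact: h1.
Qed.

Lemma density_D_density t : 0 <= t -> D_density (fun i u => density i u t).
Proof.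
move=> t0; split; [|split].
- move=> i; split; first by move=> u _; exact: density_ge0.
  have -> : (fun u => if u < 0 then 0 else density i u t) = (fun u => density i u t).
    by apply/funext => u; case: ltP => // /ltW u0; rewrite density_neg.
  have hd u := flow_duP unit_drift i u t.
  split; first by move=> u; case: (hd u).
  have -> : derive1 (fun u => density i u t) = (fun u => flow_du unit_drift i u t).
    by apply/funext => u; rewrite derive1E; case: (hd u).
  move=> u; have := @flow_derive_continuous unit_drift unit_drift i (u, t) => hc.
  have hp : (fun v : R => (v, t)) @ u --> (u, t).
    have h1 : (fun v : R => v) @ u --> u by exact: cvg_id.
    have h2 : (fun _ : R => t) @ u --> t by exact: cvg_cst.
    exact: cvg_pair h1 h2.
  exact: (cvg_comp _ _ hp hc).
- by move=> u _; have [_] := response_unit_gt0 u t; rewrite subr_gt0.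
- have hs i : (ereal_sup [set ((density i u t / (1 - \sum_(j < I)
      2 * (minn i.+1 j.+1)%:R * density j u t))%R)%:E
        | u in [set u : R | (0 <= u)%R]] <= (gam i)%:E)%E.
    apply: ge_ereal_sup => _ [u _ <-]; rewrite lee_fin.
    by rewrite density_ratio; have /andP[] := profile_bound HG i (front u t i).
  apply: (@le_lt_trans _ _ (\sum_(i < I) (i.+1%:R * gam i)%:E)%E).
    apply: lee_sum => i _; rewrite EFinM; apply: lee_wpmul2l => //.
  rewrite sumEFin lte_fin; have := profile_weight HG; rewrite /weight.
  under eq_bigr do rewrite -mulrA; rewrite -mulr_sumr; lra.
Qed.

Lemma flow_dt_continuous r i : continuous (fun p : R * R => flow_dt r i p.1 p.2).
Proof. exact: flow_derive_continuous. Qed.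

Lemma flow_du_continuous r i : continuous (fun p : R * R => flow_du r i p.1 p.2).
Proof. exact: flow_derive_continuous. Qed.

Lemma density_classical_solution (rho0 s : 'I_I -> R -> R) :
  (forall u, 0 <= u -> @equilibrium R I G (fun=> u) (s^~ u)) ->
  (forall i u, 0 <= u -> rho0 i u =
     g i (s i u) * (1 - \sum_(j < I) interaction i j * rho0 j u)) ->
  classical_solution rho0 density.
Proof.
move=> hs hrho; split; [|split; [|split]].
- move=> i; split; first by move=> u t _ _; exact: density_ge0.
  split; first by apply: continuous_subspaceT; exact: flow_continuous.
  exists (flow_du unit_drift i), (flow_dt unit_drift i); split.
    by move=> u t _ _; split; [exact: quotient_is_derive (flow_duP _ i u t)
      | exact: quotient_is_derive (flow_dtP _ i u t)].
  by split; apply: continuous_subspaceT; [exact: flow_du_continuous | exact: flow_dt_continuous].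
- exact: density_D_density.
- move=> i u u0.
  have e : front u 0 = s^~ u.
    apply: (equilibrium_uniq HG (frontP u 0)).
    by have := hs u u0; congr (equilibrium _ _); apply/funext => j; rewrite mulr0 subr0.
  have ha : solves (fun j => g j (front u 0 j)) unit_drift
     (fun i => 1 - \sum_(j < I) interaction i j * rho0 j u).
    move=> j; rewrite e; have -> : \sum_(l < I) interaction j l * g l (s l u) *
        (1 - \sum_(m < I) interaction l m * rho0 m u) = \sum_(l < I) interaction j l * rho0 l u.
      by apply: eq_bigr => l _; rewrite -mulrA -hrho.
    by rewrite subrK.
  rewrite hrho // /density /flow e; congr (_ * _).
  exact: (solves_uniq (front_weight u 0) (responseP unit_drift u 0) ha).
- move=> i u t u0 t0; exists (flow_dt unit_drift i u t); split.
    exact: quotient_is_derive (flow_dtP _ i u t).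
  apply: (quotient_is_derive (f := fun v => veff (fun j => density j v t) i * density i v t)).
  have -> : (fun v => veff (fun j => density j v t) i * density i v t)
      = (fun v => - flow time_drift i v t) by apply/funext => v; exact: veff_density.
  rewrite -flow_mixed; have := deriveZ (-1) (flow_duP time_drift i u t).
  by rewrite mulN1r; congr (is_derive _ _ _ _); apply/funext => v; rewrite mulN1r.
Qed.

End HydrodynamicSolution.

(** * The initial profile in slot coordinates *)

Section InitialProfile.
Context {R : realType} {I : nat}.
Implicit Types (i j : 'I_I) (u z : R).

Definition extend0 (f : R -> R) (u : R) : R := if u < 0 then 0 else f u.

Lemma extend0E f u : 0 <= u -> extend0 f u = f u.
Proof. by move=> u0; rewrite /extend0 ltNge u0. Qed.

(** The left limit at the origin is zero, so continuity of the extension forces [f] to vanish at the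
    origin. *)
Lemma extend0_neg (f : R -> R) : {for 0, continuous (extend0 f)} ->
  forall u, u <= 0 -> extend0 f u = 0.
Proof.
move=> fc u; rewrite le_eqVlt => /orP[/eqP->|u0]; last by rewrite /extend0 u0.
have h1 : extend0 f @ (0 : R)^'- --> extend0 f 0 by apply: cvg_at_left_filter.
have h2 : extend0 f @ (0 : R)^'- --> 0.
  apply: (@cvg_trans _ ((fun=> 0 : R) @ (0 : R)^'-)); last exact: cvg_cst.
  apply: near_eq_cvg; near=> x; rewrite /extend0.
  by have -> : x < 0 by near: x; exact: nbhs_left_lt.
exact: (cvg_unique _ h1 h2).
Unshelve. all: by end_near. Qed.

Lemma ge0_fin_sum (x : 'I_I -> \bar R) (M : R) :
  (forall i, (0 <= x i)%E) -> (\sum_(i < I) (i.+1%:R)%:E * x i < M%:E)%E ->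
  forall i, x i \is a fin_num.
Proof.
move=> x0 hM i; rewrite ge0_fin_numE // ltey; apply/eqP => e.
have h0 : (0 <= \sum_(j < I | j != i) (j.+1%:R)%:E * x j)%E.
  by apply: sume_ge0 => j _; rewrite mule_ge0.
move: hM; rewrite (bigD1 i) //= e mulry gtr0_sg // mul1e.
by move: h0; case: (\sum_(j < I | j != i) _)%E => //= *; rewrite ltNge leey.
Qed.

Context {rho0 : 'I_I -> R -> R} (rho0_dens : D_density rho0).

Definition ext i := extend0 (rho0 i).
Definition dext i := derive1 (ext i).
Definition slot_density i u := 1 - \sum_(j < I) interaction i j * ext j u.
Definition dslot_density i u := - \sum_(j < I) interaction i j * dext j u.

Lemma ext_derive i u : is_derive u 1 (ext i) (dext i u).
Proof.
have [h _] := rho0_dens; have [_ [hd _]] := h i.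
by split; [exact: hd | rewrite /dext derive1E].
Qed.

Lemma dext_continuous i : continuous (dext i).
Proof. by have [h _] := rho0_dens; have [_ [_ hc]] := h i. Qed.

Lemma ext_continuous i : continuous (ext i).
Proof. by move=> u; exact: is_derive_continuous (ext_derive i u). Qed.

Lemma ext_neg i u : u <= 0 -> ext i u = 0.
Proof. exact: (@extend0_neg (rho0 i) (@ext_continuous i 0)). Qed.

Lemma ext_ge0 i u : 0 <= ext i u.
Proof.
case: (leP u 0) => hu; first by rewrite ext_neg.
have [h _] := rho0_dens; have [h0 _] := h i.
by rewrite /ext extend0E ?(ltW hu) //; apply: h0; exact: ltW.
Qed.

Lemma ext_sum_lt1 u : \sum_(j < I) 2 * j.+1%:R * ext j u < 1.
Proof.
case: (leP u 0) => hu; first by rewrite big1 // => j _; rewrite ext_neg // mulr0.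
have [_ [h _]] := rho0_dens; have := h u (ltW hu).
by congr (_ < _); apply: eq_bigr => j _; rewrite /ext extend0E ?(ltW hu).
Qed.

Lemma slot_density_gt0 i u : 0 < slot_density i u.
Proof.
rewrite subr_gt0; apply: le_lt_trans (ext_sum_lt1 u); apply: ler_sum => j _.
by rewrite ler_wpM2r ?ext_ge0 ?interaction_le.
Qed.

Lemma slot_density_le1 i u : slot_density i u <= 1.
Proof.
rewrite gerBl; apply: sumr_ge0 => j _.
by rewrite mulr_ge0 ?ext_ge0 ?interaction_ge0.
Qed.

Let sup_ratio i := ereal_sup [set ((rho0 i u / (1 - \sum_(j < I)
      2 * (minn i.+1 j.+1)%:R * rho0 j u))%R)%:E | u in [set u : R | (0 <= u)%R]].

Definition max_ratio i : R := fine (sup_ratio i).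

Lemma ratio_le_sup i u : 0 <= u -> ((ext i u / slot_density i u)%:E <= sup_ratio i)%E.
Proof.
move=> u0; apply: ereal_sup_ubound; exists u => //=; congr (_%:E).
rewrite /ext extend0E //; congr (_ / (1 - _)); apply: eq_bigr => j _.
by rewrite /ext extend0E.
Qed.

Lemma sup_ratio_ge0 i : (0 <= sup_ratio i)%E.
Proof.
by apply: le_trans (ratio_le_sup i (lexx 0)); rewrite ext_neg // mul0r.
Qed.

Lemma sup_ratio_fin i : sup_ratio i \is a fin_num.
Proof.
have [_ [_ h]] := rho0_dens.
exact: (@ge0_fin_sum sup_ratio _ sup_ratio_ge0 h i).
Qed.

Lemma max_ratio_ge0 i : 0 <= max_ratio i.
Proof. exact: fine_ge0 (sup_ratio_ge0 i). Qed.

Lemma ratio_le i u : 0 <= ext i u / slot_density i u <= max_ratio i.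
Proof.
rewrite divr_ge0 ?ext_ge0 ?(ltW (slot_density_gt0 _ _)) //=.
case: (leP u 0) => hu; first by rewrite ext_neg // mul0r max_ratio_ge0.
by rewrite -lee_fin /max_ratio fineK ?sup_ratio_fin // ratio_le_sup // ltW.
Qed.

Lemma max_ratio_weight : weight max_ratio < 1.
Proof.
have [_ [_ h]] := rho0_dens.
have : (\sum_(i < I) (i.+1%:R * max_ratio i)%:E < (2^-1 : R)%:E)%E.
  apply: le_lt_trans h; apply: lee_sum => i _.
  by rewrite EFinM /max_ratio fineK ?sup_ratio_fin.
rewrite sumEFin lte_fin /weight; under [X in _ -> X < _]eq_bigr do rewrite -mulrA.
by rewrite -mulr_sumr; lra.
Qed.

(** Since slot densities are at most [1], each density is at most its ratio to the slot density,
    hence at most [max_ratio]. The bound is uniform in [u], as inverting [slots] requires. *)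
Lemma slot_density_ge i u : 1 - weight max_ratio <= slot_density i u.
Proof.
rewrite lerD2l lerN2; apply: ler_sum => j _.
apply: ler_pM; rewrite ?interaction_ge0 ?ext_ge0 ?interaction_le //.
have /andP[_ h] := ratio_le j u; apply: le_trans _ h.
have a0 := slot_density_gt0 j u; rewrite ler_pdivlMr //.
by rewrite ler_piMr ?ext_ge0 ?slot_density_le1.
Qed.

Lemma slot_density_derive i u : is_derive u 1 (slot_density i) (dslot_density i u).
Proof.
apply: is_derive_eqr (deriveB (deriveC u 1) (derive_sum (fun j =>
  deriveZ (interaction i j) (ext_derive j u)))) _.
by rewrite sub0r.
Qed.

Definition cumulative i : R -> R :=
  get [set F : R -> R | (forall u : R, is_derive u 1 F (ext i u)) /\
                        forall u, u <= 0 -> F u = 0].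

Lemma cumulativeP i : (forall u : R, is_derive u 1 (cumulative i) (ext i u)) /\
  forall u, u <= 0 -> cumulative i u = 0.
Proof.
have [F hF] := antiderivative (@ext_continuous i) (@ext_neg i).
exact: (@getPex _ [set F : R -> R | (forall u : R, is_derive u 1 F (ext i u)) /\
                        forall u, u <= 0 -> F u = 0] (ex_intro _ F hF)).
Qed.

Definition slots i u := u - \sum_(j < I) interaction i j * cumulative j u.

Lemma slots_derive i u : is_derive u 1 (slots i) (slot_density i u).
Proof.
exact: deriveB (deriveI u) (derive_sum (fun j =>
  deriveZ (interaction i j) ((cumulativeP j).1 u))).
Qed.

Lemma slots_continuous i : continuous (slots i).
Proof. by move=> u; exact: is_derive_continuous (slots_derive i u). Qed.

Lemma slots_neg i u : u <= 0 -> slots i u = u.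
Proof.
by move=> u0; rewrite /slots big1 ?subr0 // => j _; rewrite (cumulativeP j).2 ?mulr0.
Qed.

Lemma slots_increase i u v : u <= v -> (1 - weight max_ratio) * (v - u) <= slots i v - slots i u.
Proof.
rewrite le_eqVlt => /orP[/eqP->|uv]; first by rewrite !subrr mulr0.
have [c _ ->] := @mean_value R (slots i) (slot_density i) u v uv
  (fun x _ => slots_derive i x) (fun x _ => @slots_continuous i x).
by rewrite ler_wpM2r ?slot_density_ge // subr_ge0 ltW.
Qed.

Lemma slots_inj i : injective (slots i).
Proof.
have k0 : 0 < 1 - weight max_ratio by rewrite subr_gt0 max_ratio_weight.
move=> u v e; wlog uv : u v e / u <= v.
  by move=> H; case: (leP u v) => h; [exact: H | apply/esym/H => //; exact: ltW].
have := slots_increase i uv; rewrite e subrr pmulr_rle0 // subr_le0 => vu.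
by apply/eqP; rewrite eq_le uv.
Qed.

Lemma slots_surj i z : exists u, slots i u = z.
Proof.
case: (leP z 0) => z0; first by exists z; rewrite slots_neg.
have k0 : 0 < 1 - weight max_ratio by rewrite subr_gt0 max_ratio_weight.
pose b := z / (1 - weight max_ratio).
have b0 : 0 <= b by rewrite divr_ge0 ?ltW.
have hb : z <= slots i b.
  have := slots_increase i b0; rewrite (slots_neg i (lexx 0)) !subr0.
  by rewrite /b mulrC divfK ?gt_eqF.
have [||c _ hc] := @IVT R (slots i) 0 b z b0.
- exact: continuous_subspaceT (@slots_continuous i).
- by rewrite (slots_neg i (lexx 0)) ge_min ltW //= le_max hb orbT.
by exists c.
Qed.

Definition unslot i z : R := get [set u | slots i u = z].

Lemma unslotK i z : slots i (unslot i z) = z.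
Proof.
have [u hu] := slots_surj i z.
exact: (@getPex _ [set u | slots i u = z] (ex_intro _ u hu)).
Qed.

Lemma slotsK i u : unslot i (slots i u) = u.
Proof. by apply: (@slots_inj i); rewrite unslotK. Qed.

Lemma unslot_derive i z : is_derive z 1 (unslot i) (slot_density i (unslot i z))^-1.
Proof.
have h1 : {near unslot i z, cancel (slots i) (unslot i)} by near=> u; exact: slotsK.
have h2 : {near unslot i z, continuous (slots i)} by near=> u; exact: slots_continuous.
rewrite -{1}(unslotK i z); apply: is_derive_inverse h1 h2 (slots_derive i _) _.
by rewrite gt_eqF ?slot_density_gt0.
Unshelve. all: by end_near. Qed.

Lemma unslot_le0 i z : z <= 0 -> unslot i z = z.
Proof. by move=> z0; apply: (@slots_inj i); rewrite unslotK slots_neg. Qed.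

Lemma unslot_continuous i : continuous (unslot i).
Proof. by move=> z; exact: is_derive_continuous (unslot_derive i z). Qed.

Definition soliton_profile i z := cumulative i (unslot i z).
Definition ratio i u := ext i u * (slot_density i u)^-1.
Definition dratio i u :=
  ext i u * (- (slot_density i u) ^- 2 * dslot_density i u) +
  (slot_density i u)^-1 * dext i u.

Lemma ratio_derive i u : is_derive u 1 (ratio i) (dratio i u).
Proof.
apply: deriveM (ext_derive i u) _; apply: is_deriveV (slot_density_derive i u).
by rewrite gt_eqF ?slot_density_gt0.
Qed.

Lemma slot_density_continuous i : continuous (slot_density i).
Proof. by move=> u; exact: is_derive_continuous (slot_density_derive i u). Qed.

Lemma slot_densityV_continuous i : continuous (fun u => (slot_density i u)^-1).
Proof.
move=> u; apply: cvgV; first by rewrite gt_eqF ?slot_density_gt0.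
exact: slot_density_continuous.
Qed.

Lemma dratio_continuous i : continuous (dratio i).
Proof.
move=> u; apply: cvgD; apply: cvgM.
- exact: ext_continuous.
- apply: cvgM.
    apply: cvgN; apply: cvgV; first by rewrite expf_neq0 // gt_eqF ?slot_density_gt0.
    by rewrite expr2; apply: cvgM; exact: slot_density_continuous.
  apply: cvgN; apply: cvg_sumr => j; apply: cvgM; first exact: cvg_cst.
  exact: dext_continuous.
- exact: slot_densityV_continuous.
- exact: dext_continuous.
Qed.

(** Slot coordinates have derivative [slot_density], so the cumulative density has derivative
    [ratio] with respect to them; the weight bound is the second condition of [D_density],
    doubled. *)
Lemma soliton_profileP : profile soliton_profile (fun i z => ratio i (unslot i z))
  (fun i z => dratio i (unslot i z) * (slot_density i (unslot i z))^-1) max_ratio.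
Proof.
split.
- move=> i z; exact: derive_comp ((cumulativeP i).1 _) (unslot_derive i z).
- move=> i z; exact: derive_comp (ratio_derive i _) (unslot_derive i z).
- move=> i z; apply: cvgM.
    exact: (cvg_comp _ _ (@unslot_continuous i z) (@dratio_continuous i _)).
  exact: (cvg_comp _ _ (@unslot_continuous i z) (@slot_densityV_continuous i _)).
- by move=> i z; exact: ratio_le.
- exact: max_ratio_weight.
- move=> i z z0; rewrite /soliton_profile /ratio unslot_le0 //.
  by rewrite (cumulativeP i).2 // ext_neg // mul0r.
Qed.

Lemma soliton_profile_slots i u : soliton_profile i (slots i u) = cumulative i u.
Proof. by rewrite /soliton_profile slotsK. Qed.

Lemma slots_equilibrium u : equilibrium (G := soliton_profile) (fun=> u) (slots^~ u).
Proof.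
move=> i; under eq_bigr do rewrite soliton_profile_slots.
by rewrite subrK.
Qed.

Lemma rho0_slots i u : 0 <= u -> rho0 i u =
  ratio i (unslot i (slots i u)) * (1 - \sum_(j < I) interaction i j * rho0 j u).
Proof.
move=> u0; rewrite slotsK /ratio.
have -> : 1 - \sum_(j < I) interaction i j * rho0 j u = slot_density i u.
  by congr (1 - _); apply: eq_bigr => j _; rewrite /ext extend0E.
by rewrite mulfVK ?gt_eqF ?slot_density_gt0 // /ext extend0E.
Qed.

End InitialProfile.

(** * Uniqueness of the hydrodynamic solution *)

Section ParametricAntiderivative.
Context {R : realType}.
Implicit Types (u s t U : R).

Definition antiderivative_of (f F : R -> R -> R) := forall t, 0 <= t ->
  (forall u : R, is_derive u 1 (F^~ t) (f u t)) /\ F 0 t = 0.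

Lemma max0_ge0 t : 0 <= Num.max t 0.
Proof. by rewrite le_max lexx orbT. Qed.

Lemma antiderivative_time (f F : R -> R -> R) U t e :
  antiderivative_of f F -> continuous (fun p : R * R => clamp f p.1 p.2) ->
  0 <= U -> 0 < e -> \forall s \near t, forall u, 0 <= u <= U ->
    `|F u (Num.max s 0) - F u (Num.max t 0)| <= e.
Proof.
move=> hF fc U0 e0.
have e1 : 0 < e / (U + 1) by rewrite divr_gt0 // ltr_wpDl.
have := uniform_in_time U t fc e1; apply: filterS => s hs u /andP[u0 uU].
have [hds hs0] := hF _ (max0_ge0 s); have [hdt ht0] := hF _ (max0_ge0 t).
have hd v := deriveB (hds v) (hdt v).
have := @mean_value_le R (fun v => F v (Num.max s 0) - F v (Num.max t 0))
  (fun v => f v (Num.max s 0) - f v (Num.max t 0)) 0 u (e / (U + 1)) u0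
  (fun v _ => hd v) (fun v _ => is_derive_continuous (hd v)).
rewrite hs0 ht0 !subr0 => h; apply: le_trans (h _) _.
  move=> v /andP[v0 vu]; have := hs v.
  rewrite /clamp (max_l (ltW v0)) (ltW v0) (le_trans (ltW vu)) //.
  by move=> /(_ isT)/ltW.
by rewrite mulrAC ler_pdivrMr ?ltr_wpDl // ler_wpM2l ?(ltW e0) // ler_wpDr.
Qed.

Lemma antiderivative_continuous (f F : R -> R -> R) :
  antiderivative_of f F -> continuous (fun p : R * R => clamp f p.1 p.2) ->
  continuous (fun p : R * R => clamp F p.1 p.2).
Proof.
move=> hF fc [u t]; apply/cvgrPdist_le => e e0.
have e2 : 0 < e / 2 by rewrite divr_gt0.
pose U := Num.max u 0 + 1.
have U0 : 0 <= U by rewrite addr_ge0 ?max0_ge0.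
have h1 := antiderivative_time t hF fc U0 e2.
have h2 : \forall v \near u, `|F (Num.max u 0) (Num.max t 0) - F (Num.max v 0) (Num.max t 0)| <= e / 2.
  have : {for u, continuous ((F^~ (Num.max t 0)) \o (fun v => Num.max v 0))}.
    apply: continuous_comp; first exact: max0_continuous.
    by have [h _] := hF _ (max0_ge0 t); exact: is_derive_continuous (h _).
  by move/cvgrPdist_le => /(_ _ e2).
have h3 : \forall v \near u, Num.max v 0 < U.
  have := @max0_continuous R u; move/cvgr_lt; apply; rewrite /U ltrDl //.
have h23 : \forall v \near u, Num.max v 0 < U /\
  `|F (Num.max u 0) (Num.max t 0) - F (Num.max v 0) (Num.max t 0)| <= e / 2.
  by near=> v; split; near: v.
exists ([set v | Num.max v 0 < U /\ `|F (Num.max u 0) (Num.max t 0) - F (Num.max v 0) (Num.max t 0)| <= e / 2],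
  [set s | forall u, 0 <= u <= U -> `|F u (Num.max s 0) - F u (Num.max t 0)| <= e / 2]) => //.
move=> [v s] /= [[hv1 hv2] hs].
have {}hs := hs (Num.max v 0); rewrite max0_ge0 (ltW hv1) in hs.
rewrite /clamp (_ : _ - _ = (F (Num.max u 0) (Num.max t 0) - F (Num.max v 0) (Num.max t 0))
  - (F (Num.max v 0) (Num.max s 0) - F (Num.max v 0) (Num.max t 0))); last by ring.
by rewrite (le_trans (ler_normB _ _)) // (splitr e) lerD // hs.
Unshelve. all: by end_near. Qed.

(** Instead of differentiating under the integral, the mean value theorem is applied in space to the
    time quotient of [F] plus [q]. Its derivative is [ft v tau - ft v t] for an intermediate time
    [tau], small uniformly in [v]. *)
Lemma conservation_law (f q ft F : R -> R -> R) U t :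
  antiderivative_of f F -> continuous (fun p : R * R => clamp ft p.1 p.2) ->
  (forall u s, 0 < u -> 0 < s -> is_derive s 1 (f u) (ft u s)) ->
  (forall u, 0 < u -> is_derive u 1 (q^~ t) (- ft u t)) ->
  continuous (q^~ t) -> q 0 t = 0 -> 0 <= U -> 0 < t ->
  is_derive t 1 (F U) (- q U t).
Proof.
move=> hF ftc hf hq qc q0 U0 t0; apply/is_deriveP; apply/cvgrPdist_le => e e0.
have e1 : 0 < e / (U + 1) by rewrite divr_gt0 // ltr_wpDl.
have := uniform_in_time U t ftc e1.
move=> [d /= d0 hd].
(* The bound by [t] keeps [t + h] positive. *)
exists (Num.min d t) => /=; first by rewrite lt_min d0.
move=> h /=; rewrite sub0r normrN lt_min => /andP[hhd hht] h0.
have th0 : 0 < t + h by move: hht; rewrite ltr_norml; lra.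
have [hdh hh0] := hF _ (ltW th0); have [hdt ht0] := hF _ (ltW t0).
have hD (v : R) : 0 < v -> is_derive v 1 (fun v => h^-1 * (F v (t + h) - F v t) + q v t)
    (h^-1 * (f v (t + h) - f v t) + - ft v t).
  by move=> v0; apply: deriveD (hq v v0); apply: deriveZ; exact: deriveB.
have hDc (v : R) : {for v, continuous (fun v => h^-1 * (F v (t + h) - F v t) + q v t)}.
  apply: cvgD; last exact: qc.
  exact: is_derive_continuous (deriveZ h^-1 (deriveB (hdh v) (hdt v))).
have := @mean_value_le R _ _ 0 U (e / (U + 1)) U0 (fun v hv => hD v (proj1 (elimT andP hv))) (fun v _ => hDc v).
rewrite hh0 ht0 q0 subrr mulr0 addr0 !subr0 => H.
rewrite -normrN opprB opprK; apply: le_trans (H _) _.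
- move=> v /andP[v0 vU].
  have [tau htau htau2] : exists2 tau, `|t - tau| < d & 0 < tau /\
      h^-1 * (f v (t + h) - f v t) = ft v tau.
    move: h0; rewrite neq_lt => /orP[hn|hp].
      have ab : t + h < t by lra.
      have [||tau htau e2] := @mean_value R (f v) (ft v) (t + h) t ab.
      - by move=> x hx; apply: hf => //; lra.
      - by move=> x hx; apply: is_derive_continuous (hf v x v0 _); lra.
      exists tau; first by move: hhd; rewrite !ltr_norml; lra.
      split; first by lra.
      rewrite -[X in _ * X]opprB e2; field; lra.
    have ab : t < t + h by lra.
    have [||tau htau e2] := @mean_value R (f v) (ft v) t (t + h) ab.
    - by move=> x hx; apply: hf => //; lra.
    - by move=> x hx; apply: is_derive_continuous (hf v x v0 _); lra.
    exists tau; first by move: hhd; rewrite !ltr_norml; lra.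
    split; first by lra.
    rewrite e2; field; lra.
  case: htau2 => tau0 ->.
  have := hd tau htau v; rewrite (clampE _ (ltW v0) (ltW tau0)) (clampE _ (ltW v0) (ltW t0)).
  by rewrite (ltW v0) (ltW vU) => /(_ isT)/ltW.
- by rewrite mulrAC ler_pdivrMr ?ltr_wpDl // ler_wpM2l ?(ltW e0) // ler_wpDr.
Qed.

End ParametricAntiderivative.

(** * The energy argument for two descriptions of one classical solution *)

Section Uniqueness.
Context {R : realType} {I : nat} {rho0 : 'I_I -> R -> R} (rho0_dens : D_density rho0).
Context {r : 'I_I -> R -> R -> R} (hr : classical_solution rho0 r).
Implicit Types (i j : 'I_I) (u t v s w : R).
Local Notation clamped_continuous f := (continuous (fun p : R * R => clamp f p.1 p.2)).

Let rt t : 'I_I -> R -> R := fun j u => r j u t.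
Let re i u t := @ext R I (rt t) i u.
Let NN i u t := @cumulative R I (rt t) i u.
Let aa i u t := @slot_density R I (rt t) i u.
Let gg i u t := @ratio R I (rt t) i u.
(** Slot density times effective velocity, so that [qq] is the flux; nonnegativity of [yy] is what
    gives the energy flux its sign. *)
Let yy i u t := solution (fun j => gg j u t) (fun i => i.+1%:R) i.
Let qq i u t := yy i u t * gg i u t.

Let dens t : 0 <= t -> D_density (rt t).
Proof. by case: hr => _ [h _]; exact: h. Qed.

Let reE i u t : 0 <= u -> re i u t = r i u t.
Proof. exact: extend0E. Qed.

Let aaE i u t : 0 <= u -> aa i u t = 1 - \sum_(j < I) interaction i j * r j u t.
Proof.
move=> u0; rewrite /aa /slot_density; congr (1 - _); apply: eq_bigr => j _.
by congr (_ * _); exact: reE.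
Qed.

Let gg_weight u t : 0 <= t -> weight (fun j => `|gg j u t|) < 1.
Proof.
move=> t0; apply: le_lt_trans (max_ratio_weight (dens t0)); apply: gam_weight_norm => j.
exact: (ratio_le (dens t0)).
Qed.

Let yyP u t : 0 <= t -> solves (fun j => gg j u t) (fun i => i.+1%:R) (fun i => yy i u t).
Proof. by move=> t0; exact: solutionP (gg_weight u t0). Qed.

Let gg_ge0 i u t : 0 <= t -> 0 <= gg i u t.
Proof. by move=> t0; have /andP[] := ratio_le (dens t0) i u. Qed.

Let yy_ge0 i u t : 0 <= t -> 0 <= yy i u t.
Proof.
by move=> t0; apply: (solves_index_ge0 _ (yyP u t0)) => j; exact: gg_ge0.
Qed.

Let aa_gt0 i u t : 0 <= t -> 0 < aa i u t.
Proof. by move=> t0; exact: (slot_density_gt0 (dens t0)). Qed.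

Let gg_aa i u t : 0 <= t -> gg i u t * aa i u t = re i u t.
Proof. by move=> t0; rewrite /gg /ratio divfK // gt_eqF // aa_gt0. Qed.

Let qqE i u t : 0 <= u -> 0 <= t -> qq i u t = veff (fun j => r j u t) i * r i u t.
Proof.
move=> u0 t0.
have ha j : 1 - \sum_(l < I) interaction j l * r l u t = aa j u t by rewrite aaE.
have hg j : r j u t / (1 - \sum_(l < I) interaction j l * r l u t) = gg j u t.
  by rewrite ha -(reE j t u0).
rewrite (@veffE R I (fun j => r j u t) (fun j => yy j u t)).
- by rewrite ha /qq /gg /ratio -/(re i u t) reE // mulrAC mulrA.
- by move=> j; rewrite ha aa_gt0.
- by under eq_fun do rewrite hg; exact: gg_weight.
- by under eq_fun do rewrite hg; exact: yyP.
Qed.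

Let NN_antiderivative i : antiderivative_of (re i) (NN i).
Proof.
move=> t t0; have [h1 h2] := cumulativeP (dens t0) i; split; first exact: h1.
exact: h2.
Qed.

Let NN_neg i u t : 0 <= t -> u <= 0 -> NN i u t = 0.
Proof. by move=> t0; have [_ h] := cumulativeP (dens t0) i; exact: h. Qed.

Let gg_neg i u t : 0 <= t -> u <= 0 -> gg i u t = 0.
Proof. by move=> t0 u0; rewrite /gg /ratio (ext_neg (dens t0)) // mul0r. Qed.

Let gg_continuous i t : 0 <= t -> continuous (fun u => gg i u t).
Proof.
by move=> t0 u; exact: (is_derive_continuous (ratio_derive (dens t0) i u)).
Qed.

Let yy_continuous i t : 0 <= t -> continuous (fun u => yy i u t).
Proof.
move=> t0 u; apply: (@solves_cvg R _ (nbhs u) _ I (fun v j => gg j v t)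
  (fun v j => yy j v t) (fun v i => i.+1%:R) (fun j => gg j u t)
  (fun j => yy j u t) (fun i => i.+1%:R)).
- by move=> j; exact: gg_continuous.
- exact: gg_weight.
- by move=> j; exact: cvg_cst.
- by apply: nearW => v; exact: yyP.
- exact: yyP.
Qed.

Let clamp_re i u t : clamp (re i) u t = clamp (r i) u t.
Proof. by rewrite /clamp reE ?max0_ge0. Qed.

Let re_clamp_continuous i : clamped_continuous (re i).
Proof.
have -> : (fun p : R * R => clamp (re i) p.1 p.2) = (fun p : R * R => clamp (r i) p.1 p.2).
  by apply/funext => p; exact: clamp_re.
by apply: clamp_continuous; case: hr => h _; have [_ [h1 _]] := h i.
Qed.

Let NN_clamp_continuous i : clamped_continuous (NN i).
Proof. exact: antiderivative_continuous (@NN_antiderivative i) (@re_clamp_continuous i). Qed.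

Let aa_clamp_continuous i : clamped_continuous (aa i).
Proof.
move=> p; apply: cvgB; first exact: cvg_cst.
apply: cvg_sumr => j; apply: cvgM; first exact: cvg_cst.
exact: re_clamp_continuous.
Qed.

Let gg_clamp_continuous i : clamped_continuous (gg i).
Proof.
move=> p; apply: cvgM; first exact: re_clamp_continuous.
apply: cvgV; last exact: aa_clamp_continuous.
by rewrite gt_eqF // aa_gt0 ?max0_ge0.
Qed.

Let yy_clamp_continuous i : clamped_continuous (yy i).
Proof.
move=> p; apply: (@solves_cvg R _ (nbhs p) _ I (fun q j => clamp (gg j) q.1 q.2)
  (fun q j => clamp (yy j) q.1 q.2) (fun q i => i.+1%:R) (fun j => clamp (gg j) p.1 p.2)
  (fun j => clamp (yy j) p.1 p.2) (fun i => i.+1%:R)).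
- by move=> j; exact: gg_clamp_continuous.
- exact: gg_weight (max0_ge0 _).
- by move=> j; exact: cvg_cst.
- by apply: nearW => v; exact: yyP (max0_ge0 _).
- exact: yyP (max0_ge0 _).
Qed.

Let time_derivative : exists dt : 'I_I -> R -> R -> R,
  [/\ forall i, clamped_continuous (dt i),
      forall i u t, 0 < u -> 0 < t -> is_derive t 1 (re i u) (dt i u t) &
      forall i u t, 0 < u -> 0 < t -> is_derive u 1 (fun v => qq i v t) (- dt i u t)].
Proof.
case: hr => hC [_ [_ hP]].
have /choice[dt hdt] : forall i, exists dt : R -> R -> R,
    (forall u t, 0 <= u -> 0 <= t -> has_dt (r i) u t (dt u t)) /\
    {within @quadrant R, continuous (fun p => dt p.1 p.2)}.
  move=> i; have [_ [_ [du [dt [h1 [_ h3]]]]]] := hC i; exists dt; split=> //.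
  by move=> u t u0 t0; have [] := h1 u t u0 t0.
have hr' i u t : 0 < u -> 0 < t -> is_derive t 1 (r i u) (dt i u t).
  by move=> u0 t0; apply: is_derive_quotient => //; apply: (hdt i).1; exact: ltW.
exists dt; split.
- by move=> i; apply: clamp_continuous; case: (hdt i).
- move=> i u t u0 t0; have -> : re i u = r i u.
    by apply/funext => s; rewrite reE // ltW.
  exact: hr'.
- move=> i u t u0 t0.
  have [d [h1 h2]] := hP i u t (ltW u0) (ltW t0).
  have -> : dt i u t = d.
    exact: is_derive_uniq (hr' i u t u0 t0) (is_derive_quotient t0 h1).
  apply: derive_near (is_derive_quotient u0 h2) _.
  by move: (lt_nbhsr u0); apply: filterS => v v0; rewrite qqE ?ltW.
Qed.

Let zz i u t := u - \sum_(j < I) interaction i j * NN j u t - i.+1%:R * t.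
Let G := @soliton_profile R I rho0.
Let g : 'I_I -> R -> R := fun i z => @ratio R I rho0 i (@unslot R I rho0 i z).

Let gap i u t := NN i u t - G i (zz i u t).

Let zz_du i u t : 0 <= t -> is_derive u 1 (fun v => zz i v t) (aa i u t).
Proof.
move=> t0; apply: is_derive_eqr (deriveB (deriveB (deriveI u) (derive_sum (fun j =>
  deriveZ (interaction i j) ((NN_antiderivative j t0).1 u)))) (deriveC u _)) _.
by rewrite subr0.
Qed.

Let gap_du i u t : 0 <= t ->
  is_derive u 1 (fun v => gap i v t) (re i u t - g i (zz i u t) * aa i u t).
Proof.
move=> t0; apply: deriveB; first exact: (NN_antiderivative i t0).1.
exact: derive_comp (profile_derive (soliton_profileP rho0_dens) i _) (zz_du i u t0).
Qed.

Let gap_neg i u t : 0 <= t -> u <= 0 -> gap i u t = 0.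
Proof.
move=> t0 u0; rewrite /gap NN_neg // sub0r /zz big1 => [|j _]; last by rewrite NN_neg // mulr0.
have hn : u - 0 - i.+1%:R * t <= 0 by rewrite subr0 subr_le0 (le_trans u0) ?mulr_ge0.
by have [h _] := profile_neg (soliton_profileP rho0_dens) i hn; rewrite /G h oppr0.
Qed.

Let gap_initial i u : gap i u 0 = 0.
Proof.
have e j : NN j u 0 = @cumulative R I rho0 j u.
  have ee l : @ext R I (rt 0) l = @ext R I rho0 l.
    apply/funext => v; rewrite /ext /extend0; case: ltP => // v0.
    by case: hr => _ [_ [h _]]; exact: h.
  by rewrite /NN /cumulative ee.
rewrite /gap /zz mulr0 subr0 e; under eq_bigr do rewrite e.
by rewrite -/(@slots R I rho0 i u) /G soliton_profile_slots // subrr.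
Qed.

Let max_fst_continuous : continuous (fun p : R * R => Num.max p.1 0).
Proof.
move=> p; have : {for p, continuous ((fun a : R => Num.max a 0) \o @fst R R)} by
  apply: continuous_comp; [exact: cvg_fst | exact: max0_continuous].
by [].
Qed.

Let max_snd_continuous : continuous (fun p : R * R => Num.max p.2 0).
Proof.
move=> p; have : {for p, continuous ((fun a : R => Num.max a 0) \o @snd R R)} by
  apply: continuous_comp; [exact: cvg_snd | exact: max0_continuous].
by [].
Qed.

Let zz_clamp_continuous i : clamped_continuous (zz i).
Proof.
move=> p; apply: cvgB; last by apply: cvgM; [exact: cvg_cst | exact: max_snd_continuous].
apply: cvgB; first exact: max_fst_continuous.
by apply: cvg_sumr => j; apply: cvgM; [exact: cvg_cst | exact: NN_clamp_continuous].
Qed.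

Let G_continuous i : continuous (G i).
Proof.
by move=> z; exact: is_derive_continuous (profile_derive (soliton_profileP rho0_dens) i z).
Qed.

Let gz_continuous i : continuous (g i).
Proof.
by move=> z; exact: is_derive_continuous (profile_derive2 (soliton_profileP rho0_dens) i z).
Qed.

Let gap_clamp_continuous i : clamped_continuous (gap i).
Proof.
move=> p; apply: cvgB; first exact: NN_clamp_continuous.
exact: (cvg_comp _ _ (@zz_clamp_continuous i p) (@G_continuous i _)).
Qed.

(** With [gap_du] this shows that [gap] is transported: [aa] times its time derivative plus [yy]
    times its space derivative is zero. *)
Let gap_dt i u t : 0 < u -> 0 < t ->
  is_derive t 1 (gap i u) (- qq i u t + g i (zz i u t) * yy i u t).
Proof.
move=> u0 t0; have [dt [dtc dt_re dt_qq]] := time_derivative.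
have hN j : is_derive t 1 (NN j u) (- qq j u t).
  apply: (conservation_law (@NN_antiderivative j) (dtc j)) => //.
  - by move=> v v0; exact: dt_qq.
  - move=> v; apply: cvgM; first exact: yy_continuous (ltW t0) v.
    exact: gg_continuous (ltW t0) v.
  - by rewrite /qq gg_neg ?mulr0 // ltW.
  - exact: ltW.
have hz : is_derive t 1 (zz i u) (- yy i u t).
  apply: is_derive_eqr (deriveB (deriveB (deriveC t u) (derive_sum (fun j =>
    deriveZ (interaction i j) (hN j)))) (deriveZ i.+1%:R (deriveI t))) _.
  have /= e := yyP u (ltW t0) i.
  have -> : \sum_(j < I) interaction i j * - qq j u t =
      - \sum_(j < I) interaction i j * gg j u t * yy j u t.
    by rewrite -sumrN; apply: eq_bigr => j _; rewrite /qq; ring.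
  by lra.
apply: is_derive_eqr (deriveB (hN i) (derive_comp
  (profile_derive (soliton_profileP rho0_dens) i _) hz)) _.
by rewrite /g; ring.
Qed.

(* [f] obeys [f_t = - q_u] with [q >= 0]; integrated over [[0,u]] this makes the total
   of [f] nonincreasing in time. *)
Let gap0 i u t : 0 <= t -> gap i u t = 0.
Proof.
move=> t0; have [dt [dtc dt_re dt_qq]] := time_derivative.
pose f u t := aa i u t * (gap i u t * gap i u t).
pose q u t := yy i u t * (gap i u t * gap i u t).
pose da u t := - \sum_(j < I) interaction i j * dt j u t.
pose dg u t := - qq i u t + g i (zz i u t) * yy i u t.
pose ft u t := aa i u t * (gap i u t * dg u t + gap i u t * dg u t) + gap i u t * gap i u t * da u t.
have hgap v s : 0 <= s -> {for v, continuous (gap i ^~ s)}.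
  by move=> s0; exact: is_derive_continuous (gap_du i v s0).
have f_neg v s : 0 <= s -> v <= 0 -> f v s = 0.
  by move=> s0 v0; rewrite /f gap_neg // !mulr0.
have f_cont s : 0 <= s -> continuous (f^~ s).
  move=> s0 v; apply: cvgM; last by apply: cvgM; exact: hgap.
  exact: (is_derive_continuous (slot_density_derive (dens s0) i v)).
have /choice[K hK] : forall s, exists K : R -> R, 0 <= s ->
    (forall v : R, is_derive v 1 K (f v s)) /\ (forall v, v <= 0 -> K v = 0).
  move=> s; case: (leP 0 s) => s0; last by exists (fun=> 0).
  by have [K hK] := antiderivative (f_cont s s0) (fun v => f_neg v s s0); exists K.
pose F u t := K t u.
have hF : antiderivative_of f F.
  by move=> s s0; have [h1 h2] := hK s s0; split=> //; exact: h2.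
have fc : clamped_continuous f.
  move=> p; apply: cvgM; first exact: aa_clamp_continuous.
  by apply: cvgM; exact: gap_clamp_continuous.
have ftc : clamped_continuous ft.
  have dgc : clamped_continuous dg.
    move=> p; apply: cvgD.
      by apply: cvgN; apply: cvgM; [exact: yy_clamp_continuous | exact: gg_clamp_continuous].
    apply: cvgM; last exact: yy_clamp_continuous.
    exact: (cvg_comp _ _ (@zz_clamp_continuous i p) (@gz_continuous i _)).
  move=> p; apply: cvgD; apply: cvgM.
  - exact: aa_clamp_continuous.
  - by apply: cvgD; apply: cvgM; [exact: gap_clamp_continuous | exact: dgc
                                 | exact: gap_clamp_continuous | exact: dgc].
  - by apply: cvgM; exact: gap_clamp_continuous.
  - by apply: cvgN; apply: cvg_sumr => j; apply: cvgM; [exact: cvg_cst | exact: dtc].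
have hft v s : 0 < v -> 0 < s -> is_derive s 1 (f v) (ft v s).
  move=> v0 s0; apply: deriveM; last by apply: deriveM; exact: gap_dt.
  apply: is_derive_eqr (deriveB (deriveC s 1) (derive_sum (fun j =>
    deriveZ (interaction i j) (dt_re j v s v0 s0)))) _.
  by rewrite sub0r.
(* Two cancellations: [gap] is transported with velocity [yy / aa], and slots are themselves
   conserved, as [hy] says that the space derivative of [yy] is minus the time derivative of
   [aa]. *)
have hqf v s : 0 < v -> 0 < s -> is_derive v 1 (q^~ s) (- ft v s).
  move=> v0 s0.
  have hy : is_derive v 1 (fun w => yy i w s) (- da v s).
    have -> : (fun w => yy i w s) = (fun w => i.+1%:R - \sum_(j < I) interaction i j * qq j w s).
      apply/funext => w; rewrite -(yyP w (ltW s0) i).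
      rewrite [X in _ = _ + X - _](eq_bigr (fun j => interaction i j * qq j w s)) ?addrK //.
      by move=> j _; rewrite /qq; ring.
    apply: is_derive_eqr (deriveB (deriveC v _) (derive_sum (fun j =>
      deriveZ (interaction i j) (dt_qq j v s v0 s0)))) _.
    by rewrite sub0r /da; congr (- _); rewrite -sumrN; apply: eq_bigr => j _; rewrite mulrN.
  have hg := gap_du i v (ltW s0).
  apply: is_derive_eqr (deriveM hy (deriveM hg hg)) _.
  have := gg_aa i v (ltW s0) => e.
  by rewrite /ft /dg /qq -e; ring.
have K_dt v s : 0 <= v -> 0 < s -> is_derive s 1 (F v) (- q v s).
  move=> v0 s0; apply: (@conservation_law R f q ft F v s hF ftc hft) => //.
  - by move=> w w0; exact: hqf.
  - move=> w; apply: cvgM; first exact: yy_continuous (ltW s0) w.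
    by apply: cvgM; apply: hgap; exact: ltW.
  - by rewrite /q gap_neg ?mulr0 // ltW.
have K0 v : 0 <= v -> F v t <= 0.
  move=> v0; have Fv0 : F v 0 = 0.
    have [h1 h2] := hK 0 (lexx 0); rewrite /F -[RHS](h2 0 (lexx 0)).
    apply/esym; apply: (@derive_ge0_eq R (K 0) (fun w => f w 0) 0 v v0) => w _.
    - exact: is_derive_continuous (h1 w).
    - by rewrite /f gap_initial !mulr0.
  rewrite -oppr_ge0 -[X in X <= _]oppr0 -Fv0.
  (* Freezing the time at [0] for negative [s] gives two-sided continuity at the initial time. *)
  have := @derive_ge0_le R (fun s => - F v (Num.max s 0)) (fun s => q v s) 0 t t0.
  rewrite maxxx (max_l t0); apply.
  - move=> s /andP[s0 _].
    have h := deriveZ (-1) (K_dt v s v0 s0).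
    rewrite mulN1r opprK in h; apply: derive_near h _.
    move: (lt_nbhsr s0); apply: filterS => x x0.
    by rewrite mulN1r max_l // ltW.
  - move=> s _; apply: cvgN; apply/cvgrPdist_le => e e0.
    have := antiderivative_time s hF fc v0 e0; apply: filterS => x hx.
    by rewrite distrC; apply: hx; rewrite v0 lexx.
  - by move=> s /andP[s0 _]; rewrite /q mulr_ge0 ?yy_ge0 ?(ltW s0) // -expr2 sqr_ge0.
case: (leP u 0) => u0; first exact: gap_neg.
have [h1 h2] := hK t t0.
have Kz v : 0 <= v -> F v t = 0.
  move=> v0; apply/eqP; rewrite eq_le K0 //= -[X in X <= _](h2 0 (lexx 0)).
  apply: (@derive_ge0_le R (K t) (fun w => f w t) 0 v v0) => w _.
    exact: is_derive_continuous (h1 w).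
  by rewrite /f mulr_ge0 ?(ltW (aa_gt0 _ _ _)) // -expr2 sqr_ge0.
have : f u t = 0.
  apply: (is_derive_uniq (h1 u)); apply: derive_near (deriveC u 0) _.
  by move: (lt_nbhsr u0); apply: filterS => v v0; rewrite -(Kz v) ?ltW.
move/eqP; rewrite /f mulf_eq0 gt_eqF ?aa_gt0 //= mulf_eq0 orbb => /eqP //.
Qed.

(** With zero gap the [zz] satisfy the fixed point equation, hence equal [front], and both densities
    differentiate the same cumulative function. *)
Lemma classical_solution_unique i u t : 0 <= u -> 0 <= t ->
  r i u t = density (G := G) (g := g) i u t.
Proof.
move=> u0 t0; have HG := soliton_profileP rho0_dens.
have hN j v : NN j v t = G j (zz j v t).
  by apply/eqP; rewrite -subr_eq0; apply/eqP; exact: gap0.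
have hz v : front (G := G) v t = (fun j => zz j v t).
  apply: (equilibrium_uniq HG (frontP HG v t)) => j.
  under eq_bigr do rewrite -/G -hN.
  by rewrite /zz; ring.
move: u0; rewrite le_eqVlt => /orP[/eqP<-|u0].
  by rewrite (density_neg HG) // -reE // /re (ext_neg (dens t0)).
rewrite -reE ?ltW //.
apply: (is_derive_uniq ((NN_antiderivative i t0).1 u)).
have -> : (fun v => NN i v t) = (fun v => G i (front (G := G) v t i)).
  by apply/funext => v; rewrite hN hz.
exact: derive_comp (profile_derive HG i _) (front_du HG i u t).
Qed.

End Uniqueness.

(** * Empirical measures and test functions *)

Section EmpiricalMeasures.
Context {R : realType}.
Implicit Types (u v K : R) (b : nat -> bool) (N x : nat).

Definition tally b x : nat := (\sum_(1 <= y < x.+1) b y)%N.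

Definition empirical N b (F : R -> R) x : R :=
  \sum_(1 <= y < x.+1) (N%:R^-1 * (if b y then F (y%:R / N%:R) else 0)).

Lemma scaled_truncn N u : (0 < N)%N -> 0 <= u ->
  (Num.truncn (N%:R * u))%:R / N%:R <= u <= (Num.truncn (N%:R * u))%:R / N%:R + N%:R^-1.
Proof.
move=> N0 u0; have NR : 0 < N%:R :> R by rewrite ltr0n.
have /andP[h1 h2] := truncn_itv (mulr_ge0 (ltW NR) u0).
rewrite ler_pdivrMr // [u * _]mulrC h1 /= -[X in _ + X]mul1r -mulrDl natr1.
by rewrite ler_pdivlMr // mulrC ltW.
Qed.

Lemma tallyS b x : tally b x.+1 = (tally b x + b x.+1)%N.
Proof. by rewrite /tally big_nat_recr. Qed.

Lemma empiricalS N b F x : empirical N b F x.+1 =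
  empirical N b F x + N%:R^-1 * (if b x.+1 then F (x.+1%:R / N%:R) else 0).
Proof. by rewrite /empirical big_nat_recr. Qed.

Lemma tally_le b x : (tally b x <= x)%N.
Proof. by elim: x => [|x IH]; [rewrite /tally big_geq | rewrite tallyS; case: (b _); lia]. Qed.

Lemma tally_homo b x y : (x <= y)%N -> (tally b x <= tally b y)%N.
Proof.
move=> /subnKC <-; elim: (y - x)%N => [|n IH]; first by rewrite addn0.
by rewrite addnS tallyS (leq_trans IH) ?leq_addr.
Qed.

Lemma empirical_bounds N b (F : R -> R) (x y : nat) (lo hi : R) : (x <= y)%N ->
  (forall z, (x < z <= y)%N -> lo <= F (z%:R / N%:R) <= hi) ->
  lo * ((tally b y)%:R - (tally b x)%:R) / N%:R <= empirical N b F y - empirical N b F x <=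
  hi * ((tally b y)%:R - (tally b x)%:R) / N%:R.
Proof.
move=> /subnKC <-; elim: (y - x)%N => [|n IH] h; first by rewrite addn0 !subrr !mulr0 !mul0r lexx.
have /andP[h1 h2] : lo * ((tally b (x + n))%:R - (tally b x)%:R) / N%:R <=
    empirical N b F (x + n) - empirical N b F x <=
    hi * ((tally b (x + n))%:R - (tally b x)%:R) / N%:R.
  by apply: IH => z hz; apply: h; lia.
have /andP[h3 h4] := h (x + n).+1 ltac:(lia).
have N0 : 0 <= N%:R^-1 :> R by rewrite invr_ge0.
rewrite addnS tallyS empiricalS natrD; case: (b _) => /=; last by rewrite mulr0 !addr0 h1 h2.
have h5 := ler_wpM2l N0 h3; have h6 := ler_wpM2l N0 h4.
set Y := N%:R^-1 * F _ in h5 h6 *.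
by apply/andP; split; lra.
Qed.

(** Cut [[0, K]] into [M] cells. Freezing [F] on a cell costs [w] times the mass of the cell in the
    sum and in the integral, in total [2 * w * K]; each cell has two ends, where the cumulative
    counts are off by [e]. *)
Lemma stieltjes_sum (F rho D H : R -> R) (K w B e : R) (M N : nat) b :
  0 < K -> (0 < M)%N -> (0 < N)%N -> 0 <= w -> 0 <= B ->
  (forall u : R, is_derive u 1 D (rho u)) -> (forall u, 0 <= u <= K -> 0 <= rho u <= 1) ->
  (forall u : R, is_derive u 1 H (F u * rho u)) -> D 0 = 0 ->
  (forall u v, 0 <= u <= K -> 0 <= v <= K -> `|u - v| <= K / M%:R -> `|F u - F v| <= w) ->
  (forall u, 0 <= u <= K -> `|F u| <= B) ->
  (forall u, 0 <= u <= K -> `|(tally b (Num.truncn (N%:R * u)))%:R / N%:R - D u| <= e) ->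
  `|empirical N b F (Num.truncn (N%:R * K)) - (H K - H 0)| <= 2 * w * K + 2 * M%:R * B * e.
Proof.
move=> K0 M0 N0 w0 B0 hD hrho hH D0 osc hB hcl.
have NR : 0 < N%:R :> R by rewrite ltr0n.
have MR : 0 < M%:R :> R by rewrite ltr0n.
pose p (m : nat) := m%:R * (K / M%:R); pose X m := Num.truncn (N%:R * p m).
have step0 : 0 <= K / M%:R by rewrite divr_ge0 ?ltW.
have pK m : (m <= M)%N -> 0 <= p m <= K.
  move=> hm; rewrite mulr_ge0 //= /p mulrCA -[leRHS]mulr1 ler_pM2l //.
  by rewrite ler_pdivrMr // mul1r ler_nat.
have pS m : p m.+1 = p m + K / M%:R by rewrite /p -natr1; ring.
have key m : (m <= M)%N -> `|empirical N b F (X m) - (H (p m) - H 0)| <=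
   w * (tally b (X m))%:R / N%:R + w * p m + 2 * m%:R * B * e.
  elim: m => [|m IH] hm.
    rewrite /X /p mul0r mulr0 truncn0 /empirical big_geq // subrr subrr normr0.
    by rewrite /tally big_geq // !mulr0 !mul0r !addr0.
  have {}IH := IH (ltnW hm).
  have pm := pK m (ltnW hm); have pm1 := pK m.+1 hm.
  have /andP[pm0 pmK] := pm; have /andP[pm10 pm1K] := pm1.
  have Xle : (X m <= X m.+1)%N by apply: le_truncn; rewrite ler_pM2l // pS lerDl.
  have hcell z : (X m < z <= X m.+1)%N ->
      F (p m) - w <= F (z%:R / N%:R) <= F (p m) + w.
    move=> /andP[h1 h2].
    have hz1 : p m < z%:R / N%:R.
      by rewrite ltr_pdivlMr // [p m * _]mulrC -truncn_lt_nat // mulr_ge0 // ltW.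
    have hz2 : z%:R / N%:R <= p m.+1.
      by rewrite ler_pdivrMr // [p _ * _]mulrC -truncn_ge_nat // mulr_ge0 // ltW.
    have : `|F (z%:R / N%:R) - F (p m)| <= w.
      apply: osc => //; first by rewrite (le_trans pm0 (ltW hz1)) (le_trans hz2).
      by rewrite gtr0_norm ?subr_gt0 // lerBlDl -pS.
    by rewrite ler_norml => /andP[? ?]; apply/andP; split; lra.
  have /andP[b1 b2] := empirical_bounds b Xle hcell.
  have hc1 := hcl _ pm; have hc2 := hcl _ pm1.
  have hHD : `|H (p m.+1) - F (p m) * D (p m.+1) - (H (p m) - F (p m) * D (p m))| <= w * (p m.+1 - p m).
    have hd v := deriveB (hH v) (deriveZ (F (p m)) (hD v)).
    apply: (@mean_value_le R (fun v => H v - F (p m) * D v) (fun v => F v * rho v - F (p m) * rho v)).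
    - by rewrite pS lerDl.
    - by move=> v _; exact: is_derive_continuous (hd v).
    move=> v /andP[v1 v2].
    have hv : 0 <= v <= K by rewrite (le_trans pm0 (ltW v1)) (le_trans (ltW v2)).
    have /andP[r0 r1] := hrho v hv.
    rewrite -mulrBl normrM (ger0_norm r0) -[leRHS]mulr1; apply: ler_pM => //.
    apply: osc => //; rewrite ger0_norm ?subr_ge0 ?(ltW v1) //.
    by rewrite lerBlDl -pS ltW.
  have hBp := hB _ pm.
  set T1 := (tally b (X m.+1))%:R in b1 b2 hc2 *.
  set T0 := (tally b (X m))%:R in b1 b2 hc1 IH *.
  have b1' : F (p m) * (T1 / N%:R - T0 / N%:R) - w * (T1 / N%:R - T0 / N%:R) <=
    empirical N b F (X m.+1) - empirical N b F (X m) by apply: le_trans b1; rewrite le_eqVlt; apply/orP; left; apply/eqP; ring.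
  have b2' : empirical N b F (X m.+1) - empirical N b F (X m) <=
    F (p m) * (T1 / N%:R - T0 / N%:R) + w * (T1 / N%:R - T0 / N%:R).
    by apply: le_trans b2 _; rewrite le_eqVlt; apply/orP; left; apply/eqP; ring.
  rewrite -!mulrA in IH *; rewrite (_ : w * (T1 / N%:R) = w * (T1 / N%:R)) //.
  set t1 := T1 / N%:R in b1' b2' hc2 *; set t0 := T0 / N%:R in b1' b2' hc1 IH *.
  have hprod : `|F (p m) * ((t1 - D (p m.+1)) - (t0 - D (p m)))| <= B * (2 * e).
    rewrite normrM; apply: ler_pM => //.
    by rewrite (le_trans (ler_normB _ _)) // mulr_natl mulr2n lerD.
  move: IH hHD hprod b1' b2'; rewrite !ler_norml -natr1.
  move=> /andP[i1 i2] /andP[d1 d2] /andP[q1 q2] b1' b2'.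
  apply/andP; split; lra.
have := key M (leqnn _).
have -> : p M = K by rewrite /p mulrC divfK ?gt_eqF.
have -> : X M = Num.truncn (N%:R * K) by rewrite /X /p mulrC; congr Num.truncn; field; rewrite gt_eqF.
move=> h; apply: le_trans h _; rewrite lerD2r.
have hS : (tally b (Num.truncn (N%:R * K)))%:R / N%:R <= K.
  rewrite ler_pdivrMr // [K * _]mulrC; apply: (@le_trans _ _ (Num.truncn (N%:R * K))%:R).
    by rewrite ler_nat tally_le.
  by rewrite truncn_le mulr_ge0 ?ltW.
have := ler_wpM2l w0 hS; rewrite mulrA; lra.
Qed.

End EmpiricalMeasures.

(** * Passing between cumulative counts and test functions *)

Section TestFunctions.
Context {R : realType}.
Implicit Types (u v K : R) (b : nat -> bool) (N x : nat).

Lemma empirical_support N b (F : R -> R) K x : (0 < N)%N -> 0 <= K ->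
  (forall u, K < u -> F u = 0) -> (Num.truncn (N%:R * K) <= x)%N ->
  empirical N b F x = empirical N b F (Num.truncn (N%:R * K)).
Proof.
move=> N0 K0 hF /subnKC <-; elim: (x - _)%N => [|n IH]; first by rewrite addn0.
rewrite addnS empiricalS IH hF ?if_same ?mulr0 ?addr0 //.
rewrite ltr_pdivlMr ?ltr0n // mulrC -truncn_lt_nat ?mulr_ge0 //.
by rewrite ltnS leq_addr.
Qed.

Lemma eq_empirical N b (F G : R -> R) x : (forall u, 0 <= u -> F u = G u) ->
  empirical N b F x = empirical N b G x.
Proof.
by move=> h; apply: eq_bigr => y _; rewrite h // divr_ge0.
Qed.

Lemma half_line_continuous (F : R -> R) :
  {within [set u : R | 0 <= u], continuous F} -> continuous (fun u => F (Num.max u 0)).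
Proof.
move=> hF u.
have hc v : [set u : R | 0 <= u] (Num.max v 0) by rewrite /= le_max lexx orbT.
have hw : (fun v : R => Num.max v 0) @ u --> within [set u : R | 0 <= u] (nbhs (Num.max u 0)).
  move=> A hA; have h1 := @max0_continuous R u [set q | 0 <= q -> A q] hA.
  by apply: (@filterS _ (nbhs u) _ _ ((fun v : R => Num.max v 0) @^-1` A) _ h1) => q h; exact: h (hc q).
have := @subspace_continuousP _ [set u : R | 0 <= u] _ F.
move=> [/(_ hF) /(_ _ (hc u)) hf' _].
exact: (cvg_comp _ _ hw hf').
Qed.

Lemma oscillation (F : R -> R) K w : continuous F -> 0 < w -> exists2 d, 0 < d &
  forall u v, 0 <= u <= K -> 0 <= v <= K -> `|u - v| < d -> `|F u - F v| <= w.
Proof.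
move=> Fc w0.
have fc : continuous (fun p : R * R => F (p.1 + p.2)).
  move=> p; apply: (@continuous_comp _ _ _ (fun p : R * R => p.1 + p.2) F); last exact: Fc.
  by apply: cvgD; [exact: cvg_fst | exact: cvg_snd].
have [d /= d0 hd] := uniform_in_time K 0 (f := fun u s => F (u + s)) fc w0.
exists d => // u v hu hv huv; have := hd (u - v); rewrite /= sub0r normrN => /(_ huv) /(_ v hv).
by rewrite addr0 (_ : v + (u - v) = u) => [/ltW|]; last by ring.
Qed.

Lemma continuous_bounded (F : R -> R) K : 0 < K -> continuous F ->
  exists2 B, 0 <= B & forall u, 0 <= u <= K -> `|F u| <= B.
Proof.
move=> K0 Fc; have Fn : {within `[0, K], continuous (fun u => `|F u|)}.
  by apply: continuous_subspaceT => u; apply: cvg_norm; exact: Fc.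
have [c _ hc] := EVT_max (ltW K0) Fn; by exists `|F c| => // u hu; apply: hc; rewrite in_itv.
Qed.

(** The tolerance [e] depends on [F] and [eps] but not on [N] or [b], so one control of the counts
    serves all configurations. *)
Lemma weak_limit (F rho D rhoS : R -> R) : C0_Rplus F ->
  (forall u : R, is_derive u 1 D (rho u)) -> continuous rho ->
  (forall u, 0 <= rho u <= 1) -> (forall u, u <= 0 -> rho u = 0) -> D 0 = 0 ->
  (forall u, 0 <= u -> rhoS u = rho u) ->
  exists K, [/\ 0 < K, forall u, K < u -> F u = 0 &
   forall eps, 0 < eps -> exists2 e, 0 < e & forall N b, (0 < N)%N ->
    (forall u, 0 <= u <= K -> `|(tally b (Num.truncn (N%:R * u)))%:R / N%:R - D u| <= e) ->
    `|empirical N b F (Num.truncn (N%:R * K)) - leb_int_Rplus (fun u => F u * rhoS u)| <= eps].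
Proof.
move=> [/half_line_continuous Fc [K1 hK1]] hD rhoc hrho rho_neg D0 hS.
set Fe := fun u => F (Num.max u 0) in Fc.
pose K := Num.max K1 1; have K0 : 0 < K by rewrite lt_max ltr01 orbT.
have hK u : K < u -> F u = 0 by rewrite gt_max => /andP[/hK1].
exists K; split=> // eps eps0.
have FeE u : 0 <= u -> F u = Fe u by move=> u0; rewrite /Fe max_l.
have [H [hH _]] : exists H : R -> R, (forall u : R, is_derive u 1 H (Fe u * rho u)) /\
    (forall u, u <= 0 -> H u = 0).
  apply: antiderivative => [u|u u0]; first by apply: cvgM; [exact: Fc | exact: rhoc].
  by rewrite rho_neg ?mulr0.
have hint : leb_int_Rplus (fun u => F u * rhoS u) = H K - H 0.
  apply: (leb_int_RplusE (h := fun u => Fe u * rho u)) => //.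
  - by move=> u /andP[u0 _]; rewrite FeE // hS.
  - by move=> u uK; rewrite hK ?mul0r.
  - by move=> u; apply: cvgM; [exact: Fc | exact: rhoc].
have [B B0 hB] := continuous_bounded K0 Fc.
(* Each error term of [stieltjes_sum] is made at most [eps / 2]: [w] settles the first, [M] follows
   from uniform continuity, and [e] then settles the second; [B + 1] avoids division by zero. *)
pose w := eps / (4 * K).
have w0 : 0 < w by rewrite divr_gt0 ?mulr_gt0.
have [d d0 hd] := oscillation K Fc w0.
pose M := (Num.truncn (K / d)).+1.
have M0 : 0 < M%:R :> R by rewrite ltr0n.
have hM : K / M%:R < d.
  have /andP[_ h] := truncn_itv (divr_ge0 (ltW K0) (ltW d0)).
  by rewrite ltr_pdivrMr // mulrC -ltr_pdivrMr.
pose e := eps / (4 * M%:R * (B + 1)).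
have B1 : 0 < B + 1 by rewrite ltr_wpDl.
exists e; first by rewrite divr_gt0 // !mulr_gt0.
move=> N b N0 hcl; rewrite (eq_empirical N b _ FeE) hint.
apply: le_trans (@stieltjes_sum R Fe rho D H K w B e M N b K0 isT N0 (ltW w0) B0 hD _ hH D0 _ hB hcl) _.
- by move=> u _; exact: hrho.
- by move=> u v hu hv huv; apply: hd => //; exact: le_lt_trans hM.
have -> : 2 * w * K = eps / 2 by rewrite /w; field; rewrite gt_eqF.
have h1 : B / (B + 1) <= 1 by rewrite ler_pdivrMr // mul1r lerDl.
have -> : 2 * M%:R * B * e = eps / 2 * (B / (B + 1)).
  by rewrite /e; field; rewrite !gt_eqF.
have : eps / 2 * (B / (B + 1)) <= eps / 2 by rewrite ler_piMr // divr_ge0 // ltW.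
lra.
Qed.

Lemma pi_pair_empirical N k i (F : R -> R) eta K : (0 < N)%N -> 0 <= K ->
  (forall u, K < u -> F u = 0) ->
  pi_pair N k i F eta =
  empirical N (fun x => `[< sigma eta i x k >]) F (Num.truncn (N%:R * K)).
Proof.
move=> N0 K0 hF; rewrite /pi_pair; apply: lim_near_cst => //.
exists (Num.truncn (N%:R * K)).+1 => // n /= hn.
case: n hn => // n hn; rewrite -(empirical_support _ N0 K0 hF hn) //.
Qed.

(** A continuous substitute for the indicator of an initial interval: [1] up to [m * h], [0] from
    [(m + 1) * h], linear in between. *)
Definition ramp (h : R) (m : nat) (u : R) : R := Num.min 1 (Num.max 0 (m.+1%:R - u / h)).

Lemma ramp_itv h m u : 0 <= ramp h m u <= 1.
Proof. by rewrite /ramp le_min ler01 le_max lexx ge_min lexx. Qed.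

Lemma ramp1 h m u : 0 < h -> u <= m%:R * h -> ramp h m u = 1.
Proof.
move=> h0 hu; have : u / h <= m%:R by rewrite ler_pdivrMr.
by move=> hu'; apply: min_l; rewrite le_max -natr1; apply/orP; right; lra.
Qed.

Lemma ramp0 h m u : 0 < h -> m.+1%:R * h <= u -> ramp h m u = 0.
Proof.
move=> h0 hu; have : m.+1%:R <= u / h by rewrite ler_pdivlMr.
move=> hu'; rewrite /ramp max_l ?min_r //; lra.
Qed.

Lemma ramp_continuous h m : continuous (ramp h m).
Proof.
move=> u; apply: (@continuous_min _ _ (fun=> 1) (fun u => Num.max 0 (m.+1%:R - u / h))); first exact: cvg_cst.
apply: (@continuous_max _ _ (fun=> 0) (fun u => m.+1%:R - u / h)); first exact: cvg_cst.
by apply: cvgB; [exact: cvg_cst | apply: cvgM; [exact: cvg_id | exact: cvg_cst]].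
Qed.

Lemma ramp_C0 h m : 0 < h -> C0_Rplus (ramp h m).
Proof.
move=> h0; split; first by apply: continuous_subspaceT; exact: ramp_continuous.
by exists (m.+1%:R * h) => u /ltW; exact: ramp0.
Qed.

Lemma ramp_integral (rho D rhoS : R -> R) h m : 0 < h ->
  (forall u : R, is_derive u 1 D (rho u)) -> continuous rho ->
  (forall u, 0 <= rho u <= 1) -> (forall u, u <= 0 -> rho u = 0) -> D 0 = 0 ->
  (forall u, 0 <= u -> rhoS u = rho u) ->
  D (m%:R * h) <= leb_int_Rplus (fun u => ramp h m u * rhoS u) <= D (m.+1%:R * h).
Proof.
move=> h0 hD rhoc hrho rho_neg D0 hS.
have fc : continuous (fun u => ramp h m u * rho u).
  by move=> u; apply: cvgM; [exact: ramp_continuous | exact: rhoc].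
have [H [hH _]] : exists H : R -> R, (forall u : R, is_derive u 1 H (ramp h m u * rho u)) /\
    (forall u, u <= 0 -> H u = 0).
  by apply: antiderivative => // u u0; rewrite rho_neg ?mulr0.
have K0 : 0 < m.+1%:R * h by rewrite mulr_gt0.
have -> : leb_int_Rplus (fun u => ramp h m u * rhoS u) = H (m.+1%:R * h) - H 0.
  apply: (leb_int_RplusE (h := fun u => ramp h m u * rho u)) => //.
  - by move=> u /andP[u0 _]; rewrite hS.
  - by move=> u uK; rewrite ramp0 ?mul0r // ltW.
have hc u := is_derive_continuous (hH u).
have hdiff u := deriveB (hD u) (hH u).
have h1 : D 0 - H 0 <= D (m.+1%:R * h) - H (m.+1%:R * h).
  apply: (@derive_ge0_le R (fun u => D u - H u) (fun u => rho u - ramp h m u * rho u) _ _ (ltW K0)).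
  - by move=> u _; exact: is_derive_continuous (hdiff u).
  - move=> u _; have /andP[r0 r1] := hrho u; have /andP[_ p1] := ramp_itv h m u.
    by rewrite subr_ge0 ler_piMl.
have m0 : 0 <= m%:R * h by rewrite mulr_ge0 // ltW.
have h2 : D 0 - H 0 = D (m%:R * h) - H (m%:R * h).
  apply: (@derive_ge0_eq R (fun u => D u - H u) (fun u => rho u - ramp h m u * rho u) _ _ m0).
  - by move=> u _; exact: is_derive_continuous (hdiff u).
  - by move=> u /andP[_ /ltW hu]; rewrite ramp1 // mul1r subrr.
have h3 : H (m%:R * h) <= H (m.+1%:R * h).
  apply: (@derive_ge0_le R H (fun u => ramp h m u * rho u)).
  - by rewrite ler_pM2r // ler_nat.
  - by move=> u _; exact: hc.
  - move=> u _; have /andP[r0 r1] := hrho u; have /andP[p0 _] := ramp_itv h m u.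
    exact: mulr_ge0.
by move: h1 h2; rewrite D0 => h1 h2; apply/andP; split; lra.
Qed.

Lemma ramp_empirical_ge N b h m u : (0 < N)%N -> 0 < h -> 0 <= u <= m%:R * h ->
  (tally b (Num.truncn (N%:R * u)))%:R / N%:R <=
  empirical N b (ramp h m) (Num.truncn (N%:R * (m.+1%:R * h))).
Proof.
move=> N0 h0 /andP[u0 um]; have NR : 0 < N%:R :> R by rewrite ltr0n.
have hle : (Num.truncn (N%:R * u) <= Num.truncn (N%:R * (m.+1%:R * h)))%N.
  by apply: le_truncn; rewrite ler_pM2l // (le_trans um) // ler_pM2r // ler_nat.
have e0 : empirical N b (ramp h m) 0 = 0 by rewrite /empirical big_geq.
have t0 : tally b 0 = 0%N by rewrite /tally big_geq.
have /andP[h1 _] := @empirical_bounds R N b (ramp h m) _ _ 0 1 hle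
  (fun z _ => ramp_itv h m _).
have hone z : (0 < z <= Num.truncn (N%:R * u))%N -> 1 <= ramp h m (z%:R / N%:R) <= 1.
  move=> /andP[_ hz]; rewrite ramp1 ?lexx //.
  rewrite ler_pdivrMr //; apply: le_trans (ler_wpM2r (ltW NR) um).
  by rewrite [u * _]mulrC -truncn_ge_nat // mulr_ge0 // ltW.
have /andP[h2 _] := empirical_bounds b (leq0n _) hone.
move: h1 h2; rewrite e0 t0 !subr0 !mul0r mul1r => h1 h2.
by apply: le_trans h2 _; rewrite -subr_ge0.
Qed.

Lemma ramp_empirical_le N b h m u : (0 < N)%N -> 0 < h -> m.+1%:R * h <= u ->
  empirical N b (ramp h m) (Num.truncn (N%:R * (m.+1%:R * h))) <=
  (tally b (Num.truncn (N%:R * u)))%:R / N%:R.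
Proof.
move=> N0 h0 um; have NR : 0 < N%:R :> R by rewrite ltr0n.
have e0 : empirical N b (ramp h m) 0 = 0 by rewrite /empirical big_geq.
have t0 : tally b 0 = 0%N by rewrite /tally big_geq.
have /andP[_ h2] := @empirical_bounds R N b (ramp h m) 0 (Num.truncn (N%:R * (m.+1%:R * h)))
   0 1 isT (fun z _ => ramp_itv h m _).
move: h2; rewrite e0 t0 !subr0 mul1r => h2; apply: le_trans h2 _.
rewrite ler_pM2r ?invr_gt0 // ler_nat; apply: tally_homo; apply: le_truncn.
by rewrite ler_pM2l.
Qed.

(** A count up to [u] lies between two ramps, and [D] has slope at most [1]. With mesh [e / 4] at
    most two cells, that is [e / 2], are lost besides the tolerance [e / 2]; only finitely many
    ramps are needed. *)
Lemma initial_closeness (rho D rhoS : R -> R) (U e : R) :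
  (forall u : R, is_derive u 1 D (rho u)) -> continuous rho ->
  (forall u, 0 <= rho u <= 1) -> (forall u, u <= 0 -> rho u = 0) -> D 0 = 0 ->
  (forall u, 0 <= u -> rhoS u = rho u) -> 0 <= U -> 0 < e ->
  forall N b, (0 < N)%N ->
    (forall m, (m <= (Num.truncn (U / (e / 4))).+1)%N ->
     `|empirical N b (ramp (e / 4) m) (Num.truncn (N%:R * (m.+1%:R * (e / 4))))
       - leb_int_Rplus (fun u => ramp (e / 4) m u * rhoS u)| <= e / 2) ->
  forall u, 0 <= u <= U -> `|(tally b (Num.truncn (N%:R * u)))%:R / N%:R - D u| <= e.
Proof.
move=> hD rhoc hrho rho_neg D0 hS U0 e0 N b N0 htest u /andP[u0 uU].
set h := e / 4 in htest *; have h0 : 0 < h by rewrite divr_gt0.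
have Dmono (x y : R) : x <= y -> D x <= D y.
  move=> xy; apply: (@derive_ge0_le R D rho _ _ xy).
  - by move=> v _; exact: is_derive_continuous (hD v).
  - by move=> v _; have /andP[] := hrho v.
have Dlip (x y : R) : x <= y -> D y <= D x + (y - x).
  move=> xy; have hid v := deriveB (deriveI v) (hD v).
  have : x - D x <= y - D y.
    apply: (@derive_ge0_le R (fun v => v - D v) (fun v => 1 - rho v) _ _ xy).
    - by move=> v _; exact: is_derive_continuous (hid v).
    - by move=> v _; have /andP[_] := hrho v; rewrite subr_ge0.
  lra.
pose m := Num.truncn (u / h).
have /andP[m1 m2] : m%:R <= u / h < m.+1%:R by apply: truncn_itv; rewrite divr_ge0 // ltW.
have {}m1 : m%:R * h <= u by rewrite -ler_pdivlMr.
have {}m2 : u < m.+1%:R * h by rewrite -ltr_pdivrMr.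
have hm : (m <= Num.truncn (U / h))%N by apply: le_truncn; rewrite ler_pM2r ?invr_gt0.
have S1 (n : nat) : n.+1%:R * h = n%:R * h + h by rewrite -natr1; ring.
have hlow : D u - e <= (tally b (Num.truncn (N%:R * u)))%:R / N%:R.
  case: m m1 m2 hm => [|m] m1 m2 hm.
    have h1 := Dlip 0 u u0; rewrite D0 in h1.
    have : 0 <= (tally b (Num.truncn (N%:R * u)))%:R / N%:R :> R by rewrite divr_ge0.
    by move: m2; rewrite mul1r /h; lra.
  have h1 := ramp_empirical_le b N0 h0 m1.
  have /andP[h2 _] := ramp_integral m h0 hD rhoc hrho rho_neg D0 hS.
  have h3 := htest m (leq_trans (ltnW hm) (leqnSn _)).
  move: h3; rewrite ler_norml => /andP[h3 _].
  have hmu : m%:R * h <= u by move: m1; rewrite S1; lra.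
  have h4 := Dlip _ _ hmu; move: m2; rewrite !S1 => m2; have eh : h = e / 4 by [].
  set P := m%:R * h in h2 h4 m1 m2 *; lra.
have hupp : (tally b (Num.truncn (N%:R * u)))%:R / N%:R <= D u + e.
  have hu : 0 <= u <= m.+1%:R * h by rewrite u0 ltW.
  have h1 := ramp_empirical_ge b N0 h0 hu.
  have /andP[_ h2] := ramp_integral m.+1 h0 hD rhoc hrho rho_neg D0 hS.
  have h3 := htest m.+1 hm; move: h3; rewrite ler_norml => /andP[_ h3].
  have hmu : u <= m.+2%:R * h by move: m2; rewrite !S1; lra.
  have h4 := Dlip _ _ hmu; have eP : m.+2%:R * h = m%:R * h + h + h by rewrite !S1.
  have eh : h = e / 4 by [].
  set P := m.+2%:R * h in h2 h4 eP *; lra.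
by rewrite ler_norml; apply/andP; split; lra.
Qed.

End TestFunctions.

(** * The deterministic limit *)

Section DeterministicLimit.
Context {R : realType} {I : nat} {rho0 : 'I_I -> R -> R} (rho0_dens : D_density rho0).
Implicit Types (i j : 'I_I) (u v t : R).

Local Notation G := (@soliton_profile R I rho0).
Local Notation g := (fun i z => @ratio R I rho0 i (@unslot R I rho0 i z)).
Local Notation kappa := (weight (@max_ratio R I rho0)).
Local Notation W := (@weight R I (fun=> 1)).
Let HG := soliton_profileP rho0_dens.

Lemma weight1_ge0 : 0 <= W.
Proof. by apply: sumr_ge0 => j _; rewrite mulr1 mulr_ge0. Qed.

Lemma interaction_sum_le i : \sum_(j < I) interaction i j <= W.
Proof. by apply: ler_sum => j _; rewrite mulr1 interaction_le. Qed.

Lemma kappa_lt1 : 0 < 1 - kappa.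
Proof. by rewrite subr_gt0; exact: profile_weight HG. Qed.

Lemma max_ratio_le1 i : @max_ratio R I rho0 i <= 1.
Proof.
have h : 2 * i.+1%:R * @max_ratio R I rho0 i <= kappa.
  rewrite /weight (bigD1 i) //= lerDl; apply: sumr_ge0 => j _.
  by rewrite !mulr_ge0 // (gam_ge0 HG).
have := kappa_lt1; have := gam_ge0 HG i => h0 h1.
have : 1 <= i.+1%:R :> R by rewrite ler1n.
nra.
Qed.

Lemma profile_increment i (z z' : R) : z <= z' -> 0 <= G i z' - G i z <= z' - z.
Proof.
move=> zz'; rewrite (slopeP (g := g)); have /andP[s0 s1] := slope_bound HG i z z'.
have d0 : 0 <= z' - z by rewrite subr_ge0.
by rewrite mulr_ge0 //= ler_piMl // (le_trans s1) // max_ratio_le1.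
Qed.

Lemma profile_ge0 i (z : R) : 0 <= G i z.
Proof.
case: (leP z 0) => z0; first by have [-> _] := profile_neg HG i z0.
have /andP[h _] := profile_increment i (ltW z0).
by have [e _] := profile_neg HG i (lexx (0 : R)); move: h; rewrite e subr0.
Qed.

Lemma profile_lipschitz i (z z' : R) : `|G i z' - G i z| <= `|z' - z|.
Proof.
wlog zz' : z z' / z <= z'.
  move=> H; case: (leP z z') => h; first exact: H.
  by rewrite distrC [leRHS]distrC; apply: H; exact: ltW.
have /andP[h1 h2] := profile_increment i zz'.
by rewrite !ger0_norm // subr_ge0.
Qed.

Lemma mass_real (n : 'I_I -> nat) i :
  (2 * \sum_(j < I) minn i.+1 j.+1 * n j)%N%:R = \sum_(j < I) interaction i j * (n j)%:R :> R.
Proof.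
rewrite natrM natr_sum mulr_sumr; apply: eq_bigr => j _.
by rewrite natrM mulrA.
Qed.

Let natr3 (a b c : nat) : (a + b + c)%N%:R = a%:R + b%:R + c%:R :> R.
Proof. by rewrite !natrD. Qed.

Let natr4 (a b c d : nat) : (a + b + c + d)%N%:R = a%:R + b%:R + c%:R + d%:R :> R.
Proof. by rewrite !natrD. Qed.

Let natr2 (a b : nat) : (a + b)%N%:R = a%:R + b%:R :> R.
Proof. exact: natrD. Qed.

(** [D] covers the transport error, the rounding of sites and the error [e] summed over the
    interactions; moving the slot coordinate by [D] therefore triggers the discrete comparisons. The
    bound on [U] keeps the comparison points in the range of [hcl]. *)
Lemma transport_limit (N C k x : nat) (n0 : 'I_I -> nat -> nat) (n : 'I_I -> nat) (e U : R)
  (D := C.+1%:R / N%:R + W * e) (E := D + e + C%:R / N%:R) :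
  (0 < N)%N -> 0 <= e ->
  (forall i x',
    (x + 2 * \sum_(j < I) minn i.+1 j.+1 * n0 j x' + C <=
       x' + 2 * \sum_(j < I) minn i.+1 j.+1 * n j + i.+1 * k)%N -> (n i <= n0 i x' + C)%N) ->
  (forall i x',
    (x' + 2 * \sum_(j < I) minn i.+1 j.+1 * n j + i.+1 * k + C <=
     x + 2 * \sum_(j < I) minn i.+1 j.+1 * n0 j x')%N -> (n0 i x' <= n i + C)%N) ->
  (forall i u, 0 <= u <= U ->
    `|(n0 i (Num.truncn (N%:R * u)))%:R / N%:R - @cumulative R I rho0 i u| <= e) ->
  x%:R / N%:R + D <= (1 - kappa) * U ->
  forall i, `|(n i)%:R / N%:R - G i (front (G := G) (x%:R / N%:R) (k%:R / N%:R) i)|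
    <= E + W * E / (1 - kappa).
Proof.
move=> N0 e0 ha hb hcl hU; have NR : 0 < N%:R :> R by rewrite ltr0n.
have NN0 : N%:R != 0 :> R by rewrite gt_eqF.
set X := x%:R / N%:R in hU *; set tau := k%:R / N%:R.
have X0 : 0 <= X by rewrite divr_ge0.
have tau0 : 0 <= tau by rewrite divr_ge0.
have D0 : 0 <= D by rewrite addr_ge0 ?divr_ge0 ?mulr_ge0 ?weight1_ge0.
have C0 : 0 <= C%:R / N%:R :> R by rewrite divr_ge0.
pose nu j : R := (n j)%:R / N%:R.
(* The slot coordinate computed from the observed counts; the aim is that [nu i] is nearly
   [G i (zeta i)]. *)
pose zeta i := X - \sum_(j < I) interaction i j * nu j - i.+1%:R * tau.
have nu0 j : 0 <= nu j by rewrite divr_ge0.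
have zetaX i : zeta i <= X.
  rewrite /zeta -addrA gerDl -opprD oppr_le0 addr_ge0 ?mulr_ge0 //.
  by apply: sumr_ge0 => j _; rewrite mulr_ge0 ?interaction_ge0.
have sumE (m : 'I_I -> nat) i : \sum_(j < I) interaction i j * (m j)%:R / N%:R =
    \sum_(j < I) interaction i j * ((m j)%:R / N%:R).
  by apply: eq_bigr => j _; rewrite mulrA.
have close u i : 0 <= u <= U ->
    let x' := Num.truncn (N%:R * u) in
    `|x'%:R / N%:R - \sum_(j < I) interaction i j * ((n0 j x')%:R / N%:R)
      - @slots R I rho0 i u| <= N%:R^-1 + W * e /\
    x'%:R / N%:R - \sum_(j < I) interaction i j * ((n0 j x')%:R / N%:R)
      <= @slots R I rho0 i u + W * e.
  move=> hu x'; have /andP[u0 _] := hu.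
  have /andP[h3 h4] := scaled_truncn N0 u0; rewrite -/x' in h3 h4.
  have h5 : `|\sum_(j < I) interaction i j * ((n0 j x')%:R / N%:R) -
     \sum_(j < I) interaction i j * @cumulative R I rho0 j u| <= W * e.
    rewrite -sumrB; apply: le_trans (ler_norm_sum _ _ _) _.
    apply: le_trans (ler_wpM2r e0 (interaction_sum_le i)); rewrite mulr_suml.
    apply: ler_sum => j _; rewrite -mulrBr normrM (ger0_norm (interaction_ge0 _ _)).
    by rewrite ler_wpM2l ?interaction_ge0 // hcl.
  move: h5; rewrite /slots !ler_norml => /andP[h5 h6]; split.
    by apply/andP; split; lra.
  by lra.
have unslotU i z : 0 <= z -> z <= X + D -> 0 <= @unslot R I rho0 i z <= U.
  move=> z0 zX; have hk := kappa_lt1.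
  have u0 : 0 <= @unslot R I rho0 i z.
    rewrite leNgt; apply/negP => hlt.
    have := unslotK rho0_dens i z; rewrite slots_neg ?ltW // => e1.
    by move: hlt; rewrite e1 ltNge z0.
  have := slots_increase rho0_dens i u0.
  rewrite (slots_neg rho0_dens i (lexx 0)) !subr0 unslotK // => h.
  rewrite u0 /= -(ler_pM2l hk); lra.
have Ecum i u : @cumulative R I rho0 i u = G i (@slots R I rho0 i u).
  by rewrite soliton_profile_slots.
have upper i : nu i <= G i (zeta i) + E.
  (* The comparison point has slot coordinate [zeta i + D], cut at zero so that it is a point of the
     half line; [G i] vanishes at zero, so the cut is harmless. *)
  pose z := Num.max (zeta i + D) 0.
  have z0 : 0 <= z by rewrite le_max lexx orbT.
  have zX : z <= X + D by rewrite ge_max lerD2r zetaX /= addr_ge0.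
  have hu := unslotU i z z0 zX; set u := unslot i z in hu.
  have [h1 _] := close u i hu; have hc := hcl i u hu.
  set x' := Num.truncn (N%:R * u) in h1 hc.
  have hsl : @slots R I rho0 i u = z by exact: unslotK.
  rewrite Ecum hsl in hc; rewrite hsl in h1.
  have hn : (n i <= n0 i x' + C)%N.
    apply: ha; rewrite -(ler_nat R) (natr3 x) (natr3 x') (mass_real (n0^~ x')) (mass_real n) natrM.
    rewrite -(ler_pM2r (_ : 0 < N%:R^-1)) ?invr_gt0 // !mulrDl !mulr_suml.
    rewrite !sumE -mulrA -/X -/tau.
    have : zeta i + D <= z by rewrite le_max lexx.
    move: h1; rewrite ler_norml => /andP[h1 _].
    by rewrite /zeta /D -natr1 mulrDl mul1r; lra.
  have {}hn : nu i <= (n0 i x')%:R / N%:R + C%:R / N%:R.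
    by rewrite -mulrDl ler_pM2r ?invr_gt0 // -natrD ler_nat.
  have hG : G i z <= G i (zeta i) + D.
    rewrite /z; case: (leP (zeta i + D) 0) => hz.
      have [-> _] := profile_neg HG i (lexx (0 : R)).
      by rewrite addr_ge0 // profile_ge0.
    have hzD : zeta i <= zeta i + D by rewrite lerDl.
    by have /andP[_] := profile_increment i hzD; lra.
  by move: hc; rewrite ler_norml /E => /andP[_]; lra.
have lower i : G i (zeta i) <= nu i + E.
  case: (leP (zeta i - D) 0) => hz.
    have hG : G i (zeta i) <= D.
      have [e1 _] := profile_neg HG i hz.
      have hzD : zeta i - D <= zeta i by rewrite gerBl.
      by have /andP[_] := profile_increment i hzD; rewrite e1; lra.
    by have := nu0 i; rewrite /E; lra.
  have zX : zeta i - D <= X + D by have := zetaX i; lra.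
  have hu := unslotU i _ (ltW hz) zX; set u := unslot i _ in hu.
  have [_ h1] := close u i hu; have hc := hcl i u hu.
  set x' := Num.truncn (N%:R * u) in h1 hc.
  have hsl : @slots R I rho0 i u = zeta i - D by exact: unslotK.
  rewrite Ecum hsl in hc; rewrite hsl in h1.
  have hn : (n0 i x' <= n i + C)%N.
    apply: hb; rewrite -(ler_nat R) natr4 (natr2 x) (mass_real (n0^~ x')) (mass_real n) natrM.
    rewrite -(ler_pM2r (_ : 0 < N%:R^-1)) ?invr_gt0 // !mulrDl !mulr_suml.
    rewrite !sumE -mulrA -/X -/tau.
    have NV : 0 <= N%:R^-1 :> R by rewrite invr_ge0.
    by move: h1; rewrite /zeta /D -natr1 mulrDl mul1r; lra.
  have {}hn : (n0 i x')%:R / N%:R <= nu i + C%:R / N%:R.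
    by rewrite -mulrDl ler_pM2r ?invr_gt0 // -natrD ler_nat.
  have hG : G i (zeta i) <= G i (zeta i - D) + D.
    have hzD : zeta i - D <= zeta i by rewrite gerBl.
    by have /andP[_] := profile_increment i hzD; lra.
  by move: hc; rewrite ler_norml /E => /andP[h2 _]; lra.
have E0 : 0 <= E by apply: addr_ge0 => //; apply: addr_ge0.
have near i : `|G i (zeta i) - nu i| <= E.
  by rewrite ler_norml; have := upper i; have := lower i => h1 h2; apply/andP; split; lra.
(* So [zeta] solves the fixed point equation with a right side perturbed by at most [W * E], and the
   Lipschitz bound compares it with [front]. *)
have heq : @equilibrium R I G (fun i => X - i.+1%:R * tau +
    \sum_(j < I) interaction i j * (G j (zeta j) - nu j)) zeta.
  move=> i; under [in RHS]eq_bigr do rewrite mulrBr; rewrite sumrB /zeta; ring.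
move=> i; rewrite (_ : _ - _ = (nu i - G i (zeta i)) + (G i (zeta i) - G i (front (G := G) X tau i))); last by rewrite /nu; ring.
apply: le_trans (ler_normD _ _) _; apply: lerD; first by rewrite distrC; exact: near.
apply: le_trans (profile_lipschitz _ _ _) _.
apply: (equilibrium_lipschitz HG (frontP HG X tau) heq) => j.
rewrite addrAC subrr add0r; apply: le_trans (ler_norm_sum _ _ _) _.
apply: le_trans (ler_wpM2r E0 (interaction_sum_le j)); rewrite mulr_suml.
apply: ler_sum => l _; rewrite normrM (ger0_norm (interaction_ge0 _ _)).
by rewrite ler_wpM2l ?interaction_ge0.
Qed.

End DeterministicLimit.

(** * From counts at time zero to pairings at time [t] *)

Section HydrodynamicLimit.
Context {R : realType} {I : nat} {rho0 : 'I_I -> R -> R} (rho0_dens : D_density rho0).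
Implicit Types (i j : 'I_I) (u v t : R).

Local Notation G := (@soliton_profile R I rho0).
Local Notation g := (fun i z => @ratio R I rho0 i (@unslot R I rho0 i z)).
Local Notation kappa := (weight (@max_ratio R I rho0)).
Local Notation W := (@weight R I (fun=> 1)).
Let HG := soliton_profileP rho0_dens.

Lemma le1_of_weight (r : 'I_I -> R) i : (forall j, 0 <= r j) ->
  \sum_(j < I) 2 * j.+1%:R * r j < 1 -> r i <= 1.
Proof.
move=> r0; rewrite (bigD1 i) //= => h.
have h1 : 0 <= \sum_(j < I | j != i) 2 * j.+1%:R * r j.
  by apply: sumr_ge0 => j _; rewrite !mulr_ge0.
have : 1 <= i.+1%:R :> R by rewrite ler1n.
have := r0 i; nra.
Qed.

Lemma hydrodynamic_cumulative i t : 0 <= t ->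
  let rho := fun u => density (G := G) (g := g) i u t in
  let D := fun u => G i (front (G := G) u t i) in
  [/\ forall u : R, is_derive u 1 D (rho u), continuous rho,
      forall u, 0 <= rho u <= 1, forall u, u <= 0 -> rho u = 0 & D 0 = 0].
Proof.
move=> t0 rho D; split.
- by move=> u; exact: derive_comp (profile_derive HG i _) (front_du HG i u t).
- by move=> u; exact: is_derive_continuous (flow_duP HG unit_drift i u t).
- move=> u; rewrite (density_ge0 HG) /=.
  apply: (@le1_of_weight (fun j => density (G := G) (g := g) j u t)) => [j|].
    exact: (density_ge0 HG).
  by have [_] := response_unit_gt0 HG u t; rewrite subr_gt0.
- by move=> u u0; exact: (density_neg HG).
- rewrite /D (front_neg HG) //; have hn : 0 - i.+1%:R * t <= 0.
    by rewrite sub0r oppr_le0 mulr_ge0.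
  by have [-> _] := profile_neg HG i hn.
Qed.

Lemma hydrodynamic_counts (K t e : R) : 0 < K -> 0 < t -> 0 < e ->
  exists (U d : R) (N1 : nat), [/\ 0 <= U, 0 < d & forall N eta,
    (N1 <= N)%N -> (0 < N)%N -> in_Omega_I I eta ->
    (forall i u, 0 <= u <= U ->
      `|(soliton_count eta i.+1 (Num.truncn (N%:R * u)))%:R / N%:R
        - @cumulative R I rho0 i u| <= d) ->
    forall i u, 0 <= u <= K ->
      `|(soliton_count (iter (Num.truncn (N%:R * t)) bbs_step eta) i.+1
           (Num.truncn (N%:R * u)))%:R / N%:R - G i (front (G := G) u t i)| <= e].
Proof.
move=> K0 t0 e0; set k1 := 1 - kappa.
have hk : 0 < k1 := kappa_lt1 rho0_dens.
have W0 : 0 <= W := weight1_ge0.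
pose C := transport_error I.
(* The error of [transport_limit] is [E * A]. Its part proportional to [d] is [(W + 1) * d * A],
   made [e / 2] by the choice of [d]; [B] collects the coefficients of [1 / N], including the
   rounding of [u] and [t]. *)
pose A := 1 + W / k1.
have A0 : 0 < A by rewrite ltr_wpDr // divr_ge0 // ltW.
pose d := e / (2 * A * (W + 1)).
have W1 : 0 < W + 1 by rewrite ltr_wpDl.
have d0 : 0 < d by rewrite divr_gt0 // !mulr_gt0.
pose B := (2 * C%:R + 1) * A + (1 + I%:R) / k1.
have B0 : 0 <= B.
  apply: addr_ge0; first by rewrite mulr_ge0 ?ltW // addr_ge0 // mulr_ge0.
  by rewrite divr_ge0 ?ltW // addr_ge0.
pose U := (K + C.+1%:R + W * d) / k1.
exists U, d, (Num.truncn (2 * B / e)).+1; split=> //.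
  rewrite divr_ge0 ?(ltW hk) // addr_ge0 ?(mulr_ge0 W0 (ltW d0)) //.
  by rewrite addr_ge0 ?(ltW K0).
move=> N eta hN N0 hI hcl i u /andP[u0 uK].
have NR : 0 < N%:R :> R by rewrite ltr0n.
have hBN : B / N%:R <= e / 2.
  rewrite ler_pdivrMr //; have : 2 * B / e < N%:R.
    have /andP[_ h] := truncn_itv (divr_ge0 (mulr_ge0 (ler0n R 2) B0) (ltW e0)).
    by apply: lt_le_trans h _; rewrite ler_nat.
  by rewrite ltr_pdivrMr // => h; lra.
set k := Num.truncn (N%:R * t); set x := Num.truncn (N%:R * u).
have /andP[xN xN'] := scaled_truncn N0 u0; rewrite -/x in xN xN'.
have /andP[kN kN'] := scaled_truncn N0 (ltW t0); rewrite -/k in kN kN'.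
have N1 : N%:R^-1 <= 1 :> R by rewrite invf_le1 // ler1n.
have hU : x%:R / N%:R + (C.+1%:R / N%:R + W * d) <= k1 * U.
  rewrite /U [leRHS]mulrC divfK ?gt_eqF //.
  have : C.+1%:R / N%:R <= C.+1%:R :> R by rewrite ler_piMr.
  lra.
have hT := transport_limit rho0_dens (N := N) (C := C) (k := k) (x := x)
  (n0 := fun j y => soliton_count eta j.+1 y)
  (n := fun j => soliton_count (iter k bbs_step eta) j.+1 x) (e := d) (U := U)
  N0 (ltW d0) (fun j x' => (soliton_count_transport k x x' j hI).1)
  (fun j x' => (soliton_count_transport k x x' j hI).2) hcl hU i.
have hF : `|front (G := G) u t i - front (G := G) (x%:R / N%:R) (k%:R / N%:R) i|
    <= ((1 + I%:R) / N%:R) / k1.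
  apply: (equilibrium_lipschitz HG (frontP HG _ _) (frontP HG _ _)) => j.
  rewrite (_ : _ - _ = (u - x%:R / N%:R) - j.+1%:R * (t - k%:R / N%:R)); last by ring.
  apply: le_trans (ler_normB _ _) _; rewrite mulrDl mul1r; apply: lerD.
    by rewrite ger0_norm ?subr_ge0 // lerBlDl.
  rewrite normrM ger0_norm // ger0_norm ?subr_ge0 //.
  by apply: ler_pM; rewrite ?subr_ge0 // ?ler_nat // lerBlDl.
rewrite (_ : _ - _ = ((soliton_count (iter k bbs_step eta) i.+1 x)%:R / N%:R
    - G i (front (G := G) (x%:R / N%:R) (k%:R / N%:R) i))
  - (G i (front (G := G) u t i) - G i (front (G := G) (x%:R / N%:R) (k%:R / N%:R) i)));
  last by ring.
apply: le_trans (ler_normB _ _) _; apply: le_trans (lerD hT _) _.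
  by apply: le_trans (profile_lipschitz rho0_dens _ _ _) _; exact: hF.
have hd : (W + 1) * d * A = e / 2.
  have h (a b : R) : 0 < a -> 0 < b -> b * (e / (2 * a * b)) * a = e / 2.
    by move=> a0 b0; field; rewrite !gt_eqF.
  exact: h.
have -> : C.+1%:R = C%:R + 1 :> R by rewrite natr1.
rewrite (_ : _ + _ = (W + 1) * d * A + B / N%:R); last first.
  by rewrite /B /A -/k1; field; rewrite !gt_eqF.
rewrite hd; lra.
Qed.

Lemma hydrodynamic_pairings (t eps : R) (F : 'I_I -> R -> R) :
  0 < t -> 0 < eps -> (forall i, C0_Rplus (F i)) ->
  exists (h d : R) (M N1 : nat), [/\ 0 < h, 0 < d & forall N eta,
    (N1 <= N)%N -> (0 < N)%N -> in_Omega_I I eta ->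
    (forall m i, (m <= M)%N ->
      `|pi_pair N 0 i.+1 (ramp h m) eta
        - leb_int_Rplus (fun u => ramp h m u * rho0 i u)| <= d) ->
    forall i, `|pi_pair N (Num.truncn (N%:R * t)) i.+1 (F i) eta
      - leb_int_Rplus (fun u => F i u * density (G := G) (g := g) i u t)| <= eps].
Proof.
move=> t0 eps0 hF.
have hw i : exists Ke : R * R, [/\ 0 < Ke.1, 0 < Ke.2, forall u, Ke.1 < u -> F i u = 0 &
   forall N b, (0 < N)%N ->
    (forall u, 0 <= u <= Ke.1 -> `|(tally b (Num.truncn (N%:R * u)))%:R / N%:R -
       G i (front (G := G) u t i)| <= Ke.2) ->
    `|empirical N b (F i) (Num.truncn (N%:R * Ke.1)) -
       leb_int_Rplus (fun u => F i u * density (G := G) (g := g) i u t)| <= eps].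
  have [d1 d2 d3 d4 d5] := hydrodynamic_cumulative i (ltW t0).
  have [K [K0 hK hlim]] := weak_limit (hF i) d1 d2 d3 d4 d5 (fun u _ => erefl).
  by have [e e0 he] := hlim eps eps0; exists (K, e).
have /choice[Ke hKe] := hw.
(* One interval and one tolerance for all indices; the initial value [1] keeps both positive even if
   [I] is zero. *)
pose K := \big[Num.max/1]_(i < I) (Ke i).1.
pose e := \big[Num.min/1]_(i < I) (Ke i).2.
have K0 : 0 < K by apply: lt_le_trans ltr01 _; exact: bigmax_ge_id.
have e0 : 0 < e by apply: lt_bigmin => // i _; have [] := hKe i.
have [U [d [N1 [U0 d0 hcount]]]] := hydrodynamic_counts K0 t0 e0.
exists (d / 4), (d / 2), (Num.truncn (U / (d / 4))).+1, N1.
split; rewrite ?divr_gt0 // => N eta hN N0 hI htest i.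
have [Ki0 ei0 hKi hlim] := hKe i.
rewrite (pi_pair_empirical _ _ eta N0 (ltW Ki0) hKi); apply: hlim => // u /andP[u0 uK].
apply: le_trans (_ : e <= _); last by apply: bigmin_le_cond.
apply: (hcount N eta hN N0 hI).
  move=> j; apply: (initial_closeness ((cumulativeP rho0_dens j).1)
    (@ext_continuous _ _ _ rho0_dens j) _ (@ext_neg _ _ _ rho0_dens j) _ _ U0 d0 N0).
  - move=> v; rewrite (ext_ge0 rho0_dens) /=.
    apply: (@le1_of_weight (fun j => @ext R I rho0 j v)) => [l|]; first exact: (ext_ge0 rho0_dens).
    exact: (ext_sum_lt1 rho0_dens).
  - by rewrite (cumulativeP rho0_dens j).2.
  - by move=> v v0; rewrite /ext extend0E.
  - move=> m hm; have := htest m j hm.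
    rewrite (pi_pair_empirical _ _ eta N0 (K := m.+1%:R * (d / 4))) //.
      by rewrite mulr_ge0 // divr_ge0 // ltW.
    by move=> v /ltW; apply: ramp0; rewrite divr_gt0.
rewrite u0 /=; apply: le_trans uK _.
by apply: (le_bigmax_cond _ (fun i => (Ke i).1)).
Qed.

End HydrodynamicLimit.

(** * Measurability and convergence in probability *)

Section Measurability.
Context {d : measure_display} {T : measurableType d} (e : T -> config)
  (e_meas : forall x, measurable [set w | e w x]).

Lemma word_measurable n (s : seq bool) : measurable [set w | word (e w) n = s].
Proof.
elim: n s => [|n IH] s.
  case: s => [|b s].
    by rewrite (_ : [set _ | _] = setT)//; apply/seteqP; split.
  by rewrite (_ : [set _ | _] = set0)//; apply/seteqP; split.
case/lastP: s => [|s b].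
  by rewrite (_ : [set _ | _] = set0)//; apply/seteqP; split.
have -> : [set w | word (e w) n.+1 = rcons s b] =
    [set w | word (e w) n = s] `&` [set w | e w n.+1 = b].
  apply/seteqP; split=> w; rewrite /setI /mkset wordS; first by move=> /rcons_inj[-> ->].
  by case=> -> ->.
apply: measurableI => //; case: b; first exact: e_meas.
rewrite (_ : [set _ | _] = ~` [set w | e w n.+1]); first exact/measurableC/e_meas.
by apply/seteqP; split=> w /=; case: (e w n.+1).
Qed.

(** The event is a union of cylinders over the countable set of words. *)
Lemma finite_dependence_measurable n (Q : config -> Prop) :
  (forall c c', word c n = word c' n -> Q c -> Q c') -> measurable [set w | Q (e w)].
Proof.
move=> hQ.
have -> : [set w | Q (e w)] = \bigcup_(s : seq bool)
    ([set w | word (e w) n = s] `&` [set w | exists2 c, Q c & word c n = s]).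
  apply/seteqP; split=> w /=.
    by move=> h; exists (word (e w) n) => //; split=> //; exists (e w).
  by case=> s _ [<-] [c hc hw]; exact: hQ hw hc.
apply: countable_bigcupT_measurable => [|s]; first exact: countableP.
apply: measurableI; first exact: word_measurable.
have [h|h] := pselect (exists2 c, Q c & word c n = s).
  by rewrite (_ : [set _ | _] = setT)//; apply/seteqP; split.
by rewrite (_ : [set _ | _] = set0)//; apply/seteqP; split.
Qed.

Lemma word_agree c c' n : word c n = word c' n ->
  forall x, (x < n)%N -> c x.+1 = c' x.+1.
Proof.
move=> h x hx; have := congr1 (fun s => nth false s x) h.
by rewrite !(nth_map 0%N) ?size_iota // !nth_iota // add1n.
Qed.

Lemma word_agree_le c c' n m : word c n = word c' n -> (m <= n)%N ->
  word c m = word c' m.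
Proof. by move=> h hm; rewrite -(take_word c hm) h take_word. Qed.

Lemma record_agree c c' n x : word c n = word c' n -> (x <= n)%N ->
  record c x = record c' x.
Proof.
case: x => // x h hx; rewrite /record /= (word_agree h hx).
by rewrite -!load_word (word_agree_le h (ltnW hx)).
Qed.

Lemma sigma_measurable i x k : measurable [set w | sigma (e w) i x k].
Proof.
pose Q x0 x1 (c : config) := let c' := iter k bbs_step c in
  [/\ record c' x0, record c' x1, (x0 < x1)%N,
      forall y, (x0 < y < x1)%N -> ~~ record c' y
    & (i, x) \in solitons (segment c' x0 x1)].
(* No fixed number of sites decides whether [x] starts a soliton, but once the bracketing records
   are fixed the sites up to [x1] do. *)
have -> : [set w | sigma (e w) i x k] = \bigcup_x0 \bigcup_x1 [set w | Q x0 x1 (e w)].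
  apply/seteqP; split=> w /=.
    case=> x0 [x1 [/recordP h0 [/recordP h1 [h01 [hn hs]]]]].
    exists x0 => //; exists x1 => //; split=> // y /hn h; apply/negP => /recordP; exact: h.
  case=> x0 _ [x1 _ [h0 h1 h01 hn hs]]; exists x0, x1.
  split; first exact/recordP; split; first exact/recordP.
  by split=> //; split=> // y /hn h /recordP; apply/negP.
apply: bigcupT_measurable => x0; apply: bigcupT_measurable => x1.
apply: (@finite_dependence_measurable x1) => c c' h.
have {}h : word (iter k bbs_step c) x1 = word (iter k bbs_step c') x1.
  by rewrite !word_iter_bbs_step h.
move=> [h0 h1 h01 hn hs]; split=> //.
- by rewrite -(record_agree h) // ltnW.
- by rewrite -(record_agree h).
- by move=> y hy; rewrite -(record_agree h) ?hn //; case/andP: hy => _ /ltnW.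
- rewrite (_ : segment _ _ _ = segment (iter k bbs_step c) x0 x1) //.
  apply/eq_in_map => -[|y]; rewrite mem_iota => hy; first by [].
  by rewrite (word_agree h) //; lia.
Qed.

End Measurability.

(** * Measurable deviations and the union bound *)

Section Probability.
Context {R : realType} {I : nat} {d : measure_display} {T : measurableType d}.

Lemma deviation_measurable (e : T -> config) (F : 'I_I -> R -> R) (c : 'I_I -> R) eps N k :
  (forall x, measurable [set w | e w x]) -> (forall i, C0_Rplus (F i)) ->
  (0 < N)%N -> 0 < eps ->
  measurable [set w | eps < \big[Num.max/0]_(i < I) `|pi_pair N k i.+1 (F i) (e w) - c i|].
Proof.
move=> he hF N0 eps0.
have -> : [set w | eps < \big[Num.max/0]_(i < I) `|pi_pair N k i.+1 (F i) (e w) - c i|] =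
    \bigcup_(i : 'I_I) [set w | eps < `|pi_pair N k i.+1 (F i) (e w) - c i|].
  apply/seteqP; split=> w /=.
    by move=> /bigmax_gtP[|[i _ h]]; [rewrite ltNge (ltW eps0) | exists i].
  by case=> i _ h; apply/bigmax_gtP; right; exists i.
apply: countable_bigcupT_measurable => [|i]; first exact: countableP.
have [_ [K hK]] := hF i; pose K1 := Num.max 0 K.
have K10 : 0 <= K1 by rewrite le_max lexx.
have hK1 u : K1 < u -> F i u = 0 by rewrite gt_max => /andP[_ /hK].
pose b w : config := fun x => `[< sigma (e w) i.+1 x k >].
have hb x : measurable [set w | b w x].
  rewrite (_ : [set _ | _] = [set w | sigma (e w) i.+1 x k]).
    exact: sigma_measurable.
  by apply/seteqP; split=> w /asboolP.
set n := Num.truncn (N%:R * K1).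
have -> : [set w | eps < `|pi_pair N k i.+1 (F i) (e w) - c i|] =
    [set w | eps < `|empirical N (b w) (F i) n - c i|].
  by apply/seteqP; split=> w /=; rewrite (pi_pair_empirical _ _ _ N0 K10 hK1).
apply: (finite_dependence_measurable hb (n := n)
  (Q := fun a => eps < `|empirical N a (F i) n - c i|)) => a a' h.
rewrite (_ : empirical N a _ _ = empirical N a' (F i) n) //.
apply: eq_big_nat => -[|x] hx //.
by rewrite (word_agree h) //; lia.
Qed.

Lemma cvg0_of_subcover (P : nat -> probability T R) (B : nat -> set T) (N1 M : nat)
    (A : nat -> nat -> set T) :
  (forall N, (N1 <= N)%N -> measurable (B N)) ->
  (forall N m, (N1 <= N)%N -> measurable (A N m)) ->
  (forall N, {ae P N, forall w, (N1 <= N)%N -> B N w -> exists2 m, (m <= M)%N & A N m w}) ->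
  (forall m, (m <= M)%N -> (fun N => P N (A N m)) @ \oo --> 0%E) ->
  (fun N => P N (B N)) @ \oo --> 0%E.
Proof.
move=> hB hA hae hlim.
have hsum : (fun N => \sum_(m < M.+1) P N (A N m))%E @ \oo --> (0 : \bar R).
  have : forall n, (n <= M.+1)%N -> (fun N => \sum_(m < n) P N (A N m))%E @ \oo --> (0 : \bar R).
    elim=> [|n IH] hn.
      by rewrite (_ : (fun _ => _) = cst 0%E); [exact: cvg_cst | apply/funext => N; rewrite big_ord0].
    rewrite (_ : (fun _ => _) = fun N => (\sum_(m < n) P N (A N m) + P N (A N n))%E); last first.
      by apply/funext => N; rewrite big_ord_recr.
    rewrite -[X in _ --> X]adde0; apply: cvgeD => //; first exact/IH/ltnW.
    exact: hlim.
  by apply.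
apply: (squeeze_cvge _ (cvg_cst 0%E) hsum).
exists N1 => // N hN; apply/andP; split; first exact: measure_ge0.
have [Z [mZ PZ hZ]] := hae N.
(* The exceptional null set takes index [0], so that subadditivity applies to a genuine
   inclusion. *)
pose C k := if k is m.+1 then A N m else Z.
have -> : (\sum_(m < M.+1) P N (A N m) = \sum_(k < M.+2) P N (C k))%E.
  by rewrite [RHS]big_ord_recl PZ add0e.
apply: content_subadditive.
- by case=> [|k] _ //; apply: hA.
- exact: hB.
- move=> w hw; rewrite -bigcup_mkord.
  have [hz|hz] := pselect (Z w); first by exists 0%N.
  have [m hm hAm] : exists2 m, (m <= M)%N & A N m w.
    by apply: contrapT => h; apply: hz; apply: hZ => /= /(_ hN hw).
  by exists m.+1.
Qed.

End Probability.

Theorem theorem1p1 (R : realType) (I : nat)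
  (d : measure_display) (T : measurableType d)
  (P : nat -> probability T R) (eta : nat -> T -> config)
  (eta_meas : forall (N x : nat), measurable [set w | eta N w x])
  (eta_supp : forall N : nat, {ae P N, forall w, in_Omega_I I (eta N w)})
  (rho0 : 'I_I -> R -> R) (rho0_dens : D_density rho0)
  (hinit : forall (eps : R) (F : 'I_I -> R -> R), 0 < eps ->
     (forall i, C0_Rplus (F i)) ->
     (fun N : nat => P N [set w | eps < \big[Num.max/0]_(i < I)
         `| pi_pair N 0 i.+1 (F i) (eta N w)
            - leb_int_Rplus (fun u => F i u * rho0 i u) |]) @ \oo --> 0%E) :
  exists rho : 'I_I -> R -> R -> R,
    classical_solution rho0 rho /\
    (forall rho' : 'I_I -> R -> R -> R, classical_solution rho0 rho' ->
       forall i u t, 0 <= u -> 0 <= t -> rho' i u t = rho i u t) /\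
    (forall (eps t : R) (F : 'I_I -> R -> R), 0 < eps -> 0 < t ->
       (forall i, C0_Rplus (F i)) ->
       (fun N : nat => P N [set w | eps < \big[Num.max/0]_(i < I)
           `| pi_pair N (Num.truncn (N%:R * t)) i.+1 (F i) (eta N w)
              - leb_int_Rplus (fun u => F i u * rho i u t) |]) @ \oo --> 0%E).
Proof.
have HG := soliton_profileP rho0_dens.
pose g (i : 'I_I) (z : R) := ratio (rho0 := rho0) i (unslot (rho0 := rho0) i z).
exists (density (G := soliton_profile (rho0 := rho0)) (g := g)); split; [|split].
- apply: (density_classical_solution HG (s := slots (rho0 := rho0))) => [u _|i u u0].
    exact: slots_equilibrium.
  exact: rho0_slots.
- by move=> rho' hrho' i u t u0 t0; exact: classical_solution_unique.
move=> eps t F eps0 t0 hF.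
have [h [dl [M [N1 [h0 dl0 hlim]]]]] := hydrodynamic_pairings rho0_dens t0 eps0 hF.
have hramp m (i : 'I_I) : C0_Rplus (ramp h m) := ramp_C0 m h0.
(* [maxn N1 1] excludes [N = 0], where the scaling degenerates. *)
apply: (@cvg0_of_subcover _ _ _ _ _ (maxn N1 1) M (fun N m => [set w | dl <
    \big[Num.max/0]_(i < I) `|pi_pair N 0 i.+1 (ramp h m) (eta N w)
      - leb_int_Rplus (fun u => ramp h m u * rho0 i u)|])).
- by move=> N; rewrite geq_max => /andP[_ hN]; exact: deviation_measurable (eta_meas N) hF hN eps0.
- move=> N m; rewrite geq_max => /andP[_ hN].
  exact: deviation_measurable (eta_meas N) (hramp m) hN dl0.
(* Contrapositive: if every ramp deviates by at most [dl] at time zero, the pairings at time [t]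
   deviate by at most [eps]. *)
- move=> N; apply: filterS (eta_supp N) => w hI; rewrite geq_max => /andP[hN N0] hbad.
  apply: contrapT => hno; move: hbad; apply/negP; rewrite -leNgt.
  apply: bigmax_le => [|i _]; first exact: ltW.
  apply: (hlim N (eta N w) hN N0 hI) => m j hm.
  rewrite leNgt; apply/negP => hj; apply: hno; exists m => //.
  by apply: lt_le_trans hj _; exact: (le_bigmax _ (fun j : 'I_I => `|pi_pair N 0 j.+1 (ramp h m) (eta N w)
      - leb_int_Rplus (fun u => ramp h m u * rho0 j u)|)).
- by move=> m _; exact: (hinit dl (fun=> ramp h m) dl0 (hramp m)).
Qed.
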